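(* Let $(M,\varphi_i,\xi_i,\eta_i,g)$, $i=1,2,3$, be a $3$-$(\alpha,\delta)$-Sasaki manifold with Levi-Civita connection $\nabla^g$. Then, for every vector field $X$ and every even permutation $(i,j,k)$ of $(1,2,3)$, $$\nabla^g_X\xi_i=-\alpha\varphi_iX-(\alpha-\delta)\,[\eta_k(X)\xi_j-\eta_j(X)\xi_k],$$ $$\nabla^g_{\xi_i}\xi_i=0,\qquad \nabla^g_{\xi_i}\xi_j=-\nabla^g_{\xi_j}\xi_i=\delta\,\xi_k.$$ Consequently, each $\xi_i$ is a Killing vector field. Furthermore, the distribution $\mathcal V=\langle\xi_1,\xi_2,\xi_3\rangle$ is integrable with totally geodesic leaves.
   Context: An almost contact metric structure $(\varphi,\xi,\eta,g)$ consists of a $(1,1)$-tensor field $\varphi$, a vector field $\xi$, a $1$-form $\eta$ and a Riemannian metric $g$ with $\varphi^2=-I+\eta\otimes\xi$, $\eta(\xi)=1$, $g(\varphi X,\varphi Y)=g(X,Y)-\eta(X)\eta(Y)$. Its fundamental form is $\Phi(X,Y)=g(X,\varphi Y)$. An almost $3$-contact metric manifold $(M,\varphi_i,\xi_i,\eta_i,g)$, $i=1,2,3$, is a manifold of dimension $4n+3$ with three almost contact metric structures with the same $g$ such that, for every even permutation $(i,j,k)$ of $(1,2,3)$, $\varphi_k=\varphi_i\varphi_j-\eta_j\otimes\xi_i=-\varphi_j\varphi_i+\eta_i\otimes\xi_j$, $\xi_k=\varphi_i\xi_j=-\varphi_j\xi_i$, $\eta_k=\eta_i\circ\varphi_j=-\eta_j\circ\varphi_i$.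 It is $3$-$(\alpha,\delta)$-Sasaki if $d\eta_i=2\alpha\Phi_i+2(\alpha-\delta)\eta_j\wedge\eta_k$ for every even permutation $(i,j,k)$ of $(1,2,3)$, with real constants $\alpha\neq0$, $\delta$. Conventions: $d\eta(X,Y)=X(\eta(Y))-Y(\eta(X))-\eta([X,Y])$, $(\eta\wedge\zeta)(X,Y)=\eta(X)\zeta(Y)-\eta(Y)\zeta(X)$. *)

(* Defs.v *)
From HB Require Import structures.
From mathcomp Require Import all_boot all_order all_algebra all_fingroup.
From mathcomp Require Import all_classical all_reals all_analysis.

Set Implicit Arguments.
Unset Strict Implicit.
Unset Printing Implicit Defensive.

Import Order.TTheory GRing.Theory Num.Theory.
Import numFieldNormedType.Exports.

Local Open Scope classical_set_scope.
Local Open Scope ring_scope.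

Section smooth_calculus.
Context {R : realType}.

(* f is C^k on the open set U: f is differentiable on U and each directional
   derivative is C^(k-1) on U. In finite dimension this is the usual notion. *)
Fixpoint Ck {V W : normedModType R} (k : nat) (U : set V) (f : V -> W) : Prop :=
  if k is k'.+1 then
    (forall x, U x -> differentiable f x) /\ (forall v, Ck k' U ('D_v f))
  else forall x, U x -> {for x, continuous f}.

Definition smooth_on {V W : normedModType R} (U : set V) (f : V -> W) : Prop :=
  forall k, Ck k U f.

Lemma near_eq_differentiable (V W : normedModType R) (f g : V -> W) (x : V) :
  (\near x, f x = g x) -> differentiable f x -> differentiable g x.
Proof.
move=> fg df.
have -> : g = f + (g - f) by rewrite addrC subrK.
apply: differentiableD => //.
have fx : g x - f x = 0 by rewrite (nbhs_singleton fg) subrr.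
have key : (g - f) \o shift x = cst ((g - f) x) + (\0 : V -> W) +o_ 0 id.
  apply/eqaddoP => _ /posnumP[e].
  have fg0 : \forall h \near 0, f (h + x) = g (h + x).
    by move: fg; rewrite (near_shift 0) /= subr0.
  apply: filterS fg0 => h fgh.
  have -> : ((g - f) \o shift x - (cst ((g - f) x) + \0)) h = 0.
    by rewrite /= !fctE /= fgh subrr fx addr0 subr0.
  by rewrite normr0 mulr_ge0.
have c0 : continuous (\0 : V -> W) by move=> y; exact: cvg_cst.
apply/diff_locallyP; rewrite (diff_unique c0 key).
by split.
Qed.


Lemma Ck_local (V W : normedModType R) k (U : set V) (f : V -> W) :
  (forall x, U x -> exists A, A x /\ Ck k A f) -> Ck k U f.
Proof.
elim: k f => [|k IH] f loc; first by move=> x /loc[A [Ax cf]]; exact: cf.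
split=> [x /loc[A [Ax [df _]]]|v]; first exact: df.
by apply: IH => x /loc[A [Ax [_ Df]]]; exists A; split=> //; exact: Df.
Qed.

Section closure.
Context {V : normedModType R} (U : set V).
Hypothesis oU : open U.

Lemma Ck_ext (W : normedModType R) k (f g : V -> W) :
  (forall x, U x -> f x = g x) -> Ck k U f -> Ck k U g.
Proof.
have nearU x : U x -> \forall y \near x, U y by move=> Ux; exact: open_nbhs_nbhs.
elim: k f g => [|k IH] f g fg /=.
  move=> cf x Ux; have nfg : \forall y \near x, f y = g y.
    by apply: filterS (nearU _ Ux).
  have : f x' @[x' --> x] --> f x by exact: cf.
  rewrite (fg _ Ux) => fx; rewrite /prop_for /continuous_at.
  exact: cvg_trans (near_eq_cvg nfg) fx.
move=> [df Df]; split => [x Ux|v].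
  apply: near_eq_differentiable (df _ Ux).
  by apply: filterS (nearU _ Ux).
apply: IH (Df v) => x Ux; apply: near_eq_derive.
by apply: filterS (nearU _ Ux).
Qed.

Lemma Ck_le (W : normedModType R) k (f : V -> W) : Ck k.+1 U f -> Ck k U f.
Proof.
elim: k f => [|k IH] f [df Df].
  by move=> x Ux; exact/differentiable_continuous/df.
by split=> // v; exact/IH/Df.
Qed.

Lemma Ck_cst (W : normedModType R) k (c : W) : Ck k U (cst c).
Proof.
elim: k c => [|k IH] c; first by move=> x _; exact: cvg_cst.
split=> [x _|v]; first exact: differentiable_cst.
by apply: Ck_ext (IH 0) => x _; rewrite derive_cst.
Qed.

Lemma CkD (W : normedModType R) k (f g : V -> W) :
  Ck k U f -> Ck k U g -> Ck k U (f + g).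
Proof.
elim: k f g => [|k IH] f g.
  by move=> cf cg x Ux; apply: continuousD; [exact: cf|exact: cg].
move=> [df Df] [dg Dg]; split=> [x Ux|v].
  by apply: differentiableD; [exact: df|exact: dg].
apply: Ck_ext (IH _ _ (Df v) (Dg v)) => x Ux.
by rewrite deriveD//; apply: diff_derivable; [exact: df|exact: dg].
Qed.

Lemma CkM k (f g : V -> R) : Ck k U f -> Ck k U g -> Ck k U (f * g).
Proof.
elim: k f g => [|k IH] f g.
  by move=> cf cg x Ux; apply: continuousM; [exact: cf|exact: cg].
move=> Cf Cg; have [[df Df] [dg Dg]] := (Cf, Cg); split=> [x Ux|v].
  by apply: differentiableM; [exact: df|exact: dg].
apply: Ck_ext (CkD (IH _ _ (Ck_le Cf) (Dg v)) (IH _ _ (Ck_le Cg) (Df v))) => x Ux.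
by rewrite deriveM//; apply: diff_derivable; [exact: df|exact: dg].
Qed.

Lemma Ck_sum (W : normedModType R) k n (f : 'I_n -> V -> W) :
  (forall i, Ck k U (f i)) -> Ck k U (\sum_i f i).
Proof.
move=> Cf; elim/big_ind : _ => //; first exact: Ck_cst.
by move=> ? ?; exact: CkD.
Qed.

Lemma Ck_coord m k (f : V -> 'rV[R]_m) i :
  Ck k U f -> Ck k U (fun x => f x 0 i).
Proof.
elim: k f => [|k IH] f.
  move=> cf x Ux; apply: (@continuous_comp _ _ _ f (fun M : 'rV[R]_m => M 0 i)).
    exact: cf.
  exact: coord_continuous.
move=> [df Df]; split=> [x Ux|v].
  apply: (@differentiable_comp _ _ _ _ f (fun M : 'rV[R]_m => M 0 i)).
    exact: df.
  exact: differentiable_coord.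
apply: Ck_ext (IH _ (Df v)) => x Ux.
rewrite derive_mx ?mxE//; exact/diff_derivable/df.
Qed.

End closure.

Lemma Ck_comp (V : normedModType R) m (A : set V) (U : set 'rV[R]_m) k
    (g : V -> 'rV[R]_m) (f : 'rV[R]_m -> R) :
  open A -> (forall x, A x -> U (g x)) ->
  Ck k A g -> Ck k U f -> Ck k A (f \o g).
Proof.
move=> oA AU; elim: k f => [|k IH] f.
  by move=> cg cf x Ax; apply: continuous_comp; [exact: cg|exact/cf/AU].
move=> Cg [df Df]; have [dg Dg] := Cg; split=> [x Ax|v].
  by apply: differentiable_comp; [exact: dg|exact/df/AU].
have C : Ck k A (\sum_i ((fun x => ('D_v g x) 0 i) *
                          (('D_(delta_mx 0 i) f) \o g))).
  apply: Ck_sum => // i; apply: CkM => //; first exact: (Ck_coord oA i (Dg v)).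
  by apply: IH; [exact: Ck_le|exact: Df].
apply: Ck_ext C => // x Ax.
have dgx := dg _ Ax; have dfx := df _ (AU _ Ax).
rewrite deriveE; last exact: differentiable_comp.
have -> : 'd (f \o g) x v = 'd f (g x) ('D_v g x).
  by rewrite diff_comp//= (deriveE _ dgx).
rewrite [in RHS](row_sum_delta ('D_v g x)) linear_sum fct_sumE.
apply: eq_bigr => i _; rewrite linearZ /= -(deriveE _ dfx) //.
Qed.

End smooth_calculus.

(* chart_map and chart_inv are total functions; only their restrictions to
   chart_dom and to its image are meaningful. *)
Record chart (R : realType) (m : nat) (M : topologicalType) := Chart {
  chart_dom : set M;
  chart_map :> M -> 'rV[R]_m;
  chart_inv : 'rV[R]_m -> M;
  chart_dom_open : open chart_dom;
  chart_cod_open : open (chart_map @` chart_dom);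
  chart_mapK : forall p, chart_dom p -> chart_inv (chart_map p) = p;
  chart_map_cts : forall p, chart_dom p -> {for p, continuous chart_map};
  chart_inv_cts : forall x, (chart_map @` chart_dom) x ->
    {for x, continuous chart_inv}
}.

Definition chart_cod R m (M : topologicalType) (c : chart R m M) :
  set 'rV[R]_m := c @` chart_dom c.

Lemma open_chart_cod R m (M : topologicalType) (c : chart R m M) :
  open (chart_cod c).
Proof. exact: chart_cod_open. Qed.
Arguments open_chart_cod {R m M} c.

(* Smooth m-manifold without boundary; the atlas need not be maximal. *)
Record manifold (R : realType) (m : nat) := Manifold {
  carrier :> topologicalType;
  manifold_hausdorff : hausdorff_space carrier;
  manifold_second_countable : @second_countable carrier;
  atlas : set (chart R m carrier);
  atlas_cover : forall p, exists2 c, atlas c & chart_dom c p;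
  atlas_smooth : forall c d, atlas c -> atlas d ->
    smooth_on (c @` (chart_dom c `&` chart_dom d)) (d \o chart_inv c)
}.

Section smooth_functions.
Context {R : realType} {m : nat} (M : manifold R m).

Definition smooth_fun : {pred M -> R} := [pred f : M -> R |
  `[< forall c, atlas c -> smooth_on (chart_cod c) (f \o chart_inv c) >]].

(* The commutative ring (and real algebra) of smooth functions on M. *)
Record Cinf := MkCinf { cinf_fun :> M -> R; _ : cinf_fun \in smooth_fun }.

HB.instance Definition _ := [isSub for cinf_fun].
HB.instance Definition _ := [Choice of Cinf by <:].

Lemma smooth_funP (f : M -> R) c : f \in smooth_fun -> atlas c ->
  smooth_on (chart_cod c) (f \o chart_inv c).
Proof. by move=> /asboolW H ca; exact: H. Qed.

Lemma smooth_fun_cst (a : R) : (cst a : M -> R) \in smooth_fun.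
Proof. by apply/asboolP => c _ k; exact: (Ck_cst (open_chart_cod c) k a). Qed.

Lemma smooth_fun_subring : subring_closed smooth_fun.
Proof.
have sM f g : f \in smooth_fun -> g \in smooth_fun -> f * g \in smooth_fun.
  move=> sf sg; apply/asboolP => c ca k.
  by apply: (CkM (open_chart_cod c)); exact: smooth_funP.
split => //; first exact: (smooth_fun_cst 1).
move=> f g sf sg; have sNg := sM _ _ (smooth_fun_cst (-1)) sg.
apply/asboolP => c ca k.
have -> : f - g = f + cst (-1) * g by congr (_ + _); apply/funext => x; rewrite !fctE mulN1r.
by apply: (CkD (open_chart_cod c)); [exact: smooth_funP|exact: (smooth_funP sNg)].
Qed.

HB.instance Definition _ :=
  GRing.SubChoice_isSubPzRing.Build (M -> R) smooth_fun Cinf smooth_fun_subring.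
HB.instance Definition _ :=
  GRing.SubPzRing_isSubComPzRing.Build (M -> R) smooth_fun Cinf.

Lemma smooth_fun_submod : subsemimod_closed smooth_fun.
Proof.
case: smooth_fun_subring => s1 sB sM.
have s0 : 0 \in smooth_fun by rewrite -(subrr 1); exact: sB.
split; first split => // f g sf sg.
  by rewrite -[g]opprK; apply: (sB) => //; rewrite -sub0r; exact: sB.
move=> a f sf; have -> : a *: f = cst a * f by [].
apply: sM => //; exact: smooth_fun_cst.
Qed.

HB.instance Definition _ :=
  GRing.SubZmodule_isSubLmodule.Build R (M -> R) smooth_fun Cinf
    smooth_fun_submod.

Definition cst_Cinf (a : R) : Cinf := MkCinf (smooth_fun_cst a).

Lemma scale_CinfE (a : R) (f : Cinf) : a *: f = cst_Cinf a * f.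
Proof. exact: val_inj. Qed.

End smooth_functions.
Arguments smooth_fun {R m} M.

Section vector_fields.
Context {R : realType} {m : nat} (M : manifold R m).

Definition derivation : {pred Cinf M -> (Cinf M)^o} :=
  [pred X : Cinf M -> Cinf M | `[<
     (forall (a : R) (f h : Cinf M), X (a *: f + h) = a *: X f + X h) /\
     (forall f h : Cinf M, X (f * h) = f * X h + h * X f) >]].

(* Smooth vector fields are the derivations of the ring of smooth functions;
   they form a module over it. Accordingly a 1-form is a {scalar vector_field M}
   and a (1,1)-tensor field is a {linear vector_field M -> vector_field M}, both
   over the ring Cinf M. *)
Record vector_field := MkVectorField {
  vf_fun :> Cinf M -> Cinf M;
  _ : vf_fun \in derivation }.

HB.instance Definition _ := [isSub for vf_fun].
HB.instance Definition _ := [Choice of vector_field by <:].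

Lemma derivationP (X : Cinf M -> Cinf M) : X \in derivation ->
  (forall (a : R) (f h : Cinf M), X (a *: f + h) = a *: X f + X h) /\
  (forall f h : Cinf M, X (f * h) = f * X h + h * X f).
Proof. by move=> /asboolW. Qed.

Lemma vfP (X : vector_field) :
  (forall (a : R) (f h : Cinf M), X (a *: f + h) = a *: X f + X h) /\
  (forall f h : Cinf M, X (f * h) = f * X h + h * X f).
Proof. exact: derivationP (valP X). Qed.

Lemma derivation_submod : subsemimod_closed derivation.
Proof.
split; first split.
- apply/asboolP; split=> [a f h|f h].
    by change (0 = a *: (0 : Cinf M) + 0); rewrite scaler0 addr0.
  by change (0 = f * 0 + h * 0 :> Cinf M); rewrite !mulr0 addr0.
- move=> X Y /derivationP[lX pX] /derivationP[lY pY].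
  apply/asboolP; split=> [a f h|f h].
    change (X (a *: f + h) + Y (a *: f + h) =
            a *: ((X f : Cinf M) + Y f) + ((X h : Cinf M) + Y h)).
    by rewrite lX lY scalerDr addrACA.
  change (X (f * h) + Y (f * h) =
          f * ((X h : Cinf M) + Y h) + h * ((X f : Cinf M) + Y f)).
  by rewrite pX pY !mulrDr addrACA.
- move=> u X /derivationP[lX pX]; apply/asboolP; split=> [a f h|f h].
    change (u * X (a *: f + h) = a *: (u * (X f : Cinf M)) + u * (X h : Cinf M)).
    by rewrite lX mulrDr !scale_CinfE mulrCA.
  change (u * X (f * h) = f * (u * (X h : Cinf M)) + h * (u * (X f : Cinf M))).
  by rewrite pX mulrDr !(mulrCA u).
Qed.

HB.instance Definition _ := GRing.SubChoice_isSubLmodule.Build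
  (Cinf M) (Cinf M -> (Cinf M)^o) derivation vector_field derivation_submod.

Lemma bracket_derivation (X Y : vector_field) :
  (fun f => X (Y f) - Y (X f) : Cinf M) \in derivation.
Proof.
have [lX pX] := vfP X; have [lY pY] := vfP Y.
have aX f h : X (f + h) = X f + X h by rewrite -[f]scale1r lX !scale1r.
have aY f h : Y (f + h) = Y f + Y h by rewrite -[f]scale1r lY !scale1r.
apply/asboolP; split=> [a f h|f h].
  by rewrite lY lX lX lY scalerBr opprD addrACA.
rewrite pY aX !pX aY !pY.
rewrite addrACA [X in _ - X]addrACA (mulrC (X h)) (mulrC (X f)).
rewrite [Y h * _ + _]addrC opprD addrACA subrr addr0.
by rewrite opprD addrACA !mulrBr.
Qed.

Definition bracket (X Y : vector_field) : vector_field :=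
  MkVectorField (bracket_derivation X Y).

(* Tangent vectors at p are the derivations at p of the ring Cinf M. *)
Definition tangent_space (p : M) : set (Cinf M -> R) :=
  [set v | (forall (a : R) (f h : Cinf M), v (a *: f + h) = a * v f + v h) /\
           (forall f h : Cinf M, v (f * h) = f p * v h + h p * v f)].

Definition value_at (X : vector_field) (p : M) : Cinf M -> R := fun f => X f p.

End vector_fields.
Arguments bracket {R m M} X Y.
Arguments value_at {R m M} X p.
Arguments tangent_space {R m} M p.

Section smooth_maps.
Context {R : realType} {d m : nat} (N : manifold R d) (M : manifold R m).

Record smooth_map := MkSmoothMap {
  smap_fun :> N -> M;
  smap_cts : continuous smap_fun;
  smap_smooth : forall (c : chart R d N) (e : chart R m M), atlas c -> atlas e ->
    smooth_on (c @` (chart_dom c `&` smap_fun @^-1` chart_dom e))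
              (e \o smap_fun \o chart_inv c) }.

Lemma smooth_fun_comp (F : smooth_map) (f : Cinf M) : f \o F \in smooth_fun N.
Proof.
apply/asboolP => c cN k; apply: Ck_local => _ [q cq <-].
have [e eM eq] := atlas_cover (F q).
pose A := c @` (chart_dom c `&` F @^-1` chart_dom e).
have oA : open A.
  have -> : A = chart_cod c `&` chart_inv c @^-1` (F @^-1` chart_dom e).
    apply/seteqP; split => [_ [r [cr er] <-]|x [[r cr <-]]] /=.
      by split; [exists r|rewrite chart_mapK].
    by rewrite /= chart_mapK // => er; exists r.
  rewrite openE => x [cx ex]; apply: filterI.
    by apply: open_nbhs_nbhs; split => //; exact: open_chart_cod.
  apply: (chart_inv_cts cx); apply: open_nbhs_nbhs; split => //.
  by apply: open_comp => [? _|]; [exact: smap_cts|exact: chart_dom_open].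
exists A; split; first by exists q.
have fE x : A x -> ((f \o chart_inv e) \o (e \o F \o chart_inv c)) x =
                   (f \o F \o chart_inv c) x.
  by move=> [r [cr er] <-] /=; rewrite chart_mapK // chart_mapK.
apply: (Ck_ext oA fE).
apply: (Ck_comp oA _ (smap_smooth F cN eM k) (smooth_funP (valP f) eM k)).
by move=> _ [r [cr er] <-] /=; exists (F r) => //; rewrite chart_mapK.
Qed.

Definition pullback (F : smooth_map) (f : Cinf M) : Cinf N :=
  MkCinf (smooth_fun_comp F f).

Definition differential (F : smooth_map) (v : Cinf N -> R) : Cinf M -> R :=
  fun f => v (pullback F f).

End smooth_maps.

Section distributions.
Context {R : realType} {m : nat} (M : manifold R m).

Definition tangent_distribution := forall p : M, set (Cinf M -> R).

Definition span_distribution r (X : 'I_r -> vector_field M) : tangent_distribution :=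
  fun p => [set v | exists a : 'I_r -> R,
    v = \sum_(i < r) a i *: value_at (X i) p].

Definition immersion d (N : manifold R d) (F : smooth_map N M) : Prop :=
  forall q, set_inj (tangent_space N q) (differential F).

(* The immersed submanifold is the image of the injective immersion F; N carries
   its manifold structure, whose topology may be finer than the induced one. *)
Definition integral_manifold (D : tangent_distribution) d (N : manifold R d)
    (F : smooth_map N M) : Prop :=
  [/\ [set: N] !=set0, injective F, immersion F &
      forall q, differential F @` tangent_space N q = D (F q)].

Definition integrable_distribution (D : tangent_distribution) : Prop :=
  forall p, exists d (N : manifold R d) (F : smooth_map N M),
    integral_manifold D F /\ range F p.

(* A maximal connected integral manifold. *)
Definition leaf (D : tangent_distribution) d (N : manifold R d) (F : smooth_map N M) :
    Prop :=
  [/\ integral_manifold D F, connected [set: N] &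
      forall d' (N' : manifold R d') (F' : smooth_map N' M),
        integral_manifold D F' -> connected [set: N'] ->
        range F `<=` range F' -> range F' `<=` range F].

End distributions.

Section riemannian_geometry.
Context {R : realType} {m : nat} (M : manifold R m).
Local Notation vf := (vector_field M).

(* A (0,2)-tensor field is a Cinf M-bilinear map; positive definiteness is
   required at every point. *)
Record riemannian_metric := MkMetric {
  metric_fun :> vf -> vf -> Cinf M;
  metric_sym : forall X Y, metric_fun X Y = metric_fun Y X;
  metric_lin : forall (f : Cinf M) X Y Z,
    metric_fun (f *: X + Y) Z = f * metric_fun X Z + metric_fun Y Z;
  metric_ge0 : forall X p, 0 <= metric_fun X X p;
  metric_def : forall X p, metric_fun X X p = 0 -> value_at X p = 0
}.

Implicit Types (g : riemannian_metric) (nabla : vf -> vf -> vf).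

Definition affine_connection nabla : Prop :=
  [/\ forall (f : Cinf M) (X Y Z : vf),
        nabla (f *: X + Y) Z = f *: nabla X Z + nabla Y Z,
      forall X Y Z : vf, nabla X (Y + Z) = nabla X Y + nabla X Z &
      forall (X : vf) (f : Cinf M) (Y : vf), nabla X (f *: Y) = X f *: Y + f *: nabla X Y].

Definition levi_civita g nabla : Prop :=
  [/\ affine_connection nabla,
      forall X Y : vf, nabla X Y - nabla Y X = bracket X Y &
      forall X Y Z : vf, X (g Y Z) = g (nabla X Y) Z + g Y (nabla X Z)].

(* The Lie derivative (L_X g)(Y, Z). *)
Definition lie_metric g (X Y Z : vf) : Cinf M :=
  X (g Y Z) - g (bracket X Y) Z - g Y (bracket X Z).

Definition killing g (X : vf) : Prop := forall Y Z, lie_metric g X Y Z = 0.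

Definition tangent_along d (N : manifold R d) (F : smooth_map N M) (X : vf) :
  set N := [set q | (differential F @` tangent_space N q) (value_at X (F q))].

(* The second fundamental form of F vanishes: II(X, Y) at q is the normal part
   of nabla_X Y, computed with fields X and Y on M that are tangent to the
   submanifold at all points F r with r near q in N. Every pair of vector fields
   on N has such extensions near q, an immersion being locally an embedding. *)
Definition totally_geodesic nabla d (N : manifold R d) (F : smooth_map N M) :
    Prop :=
  forall (X Y : vf) (q : N),
    (\forall r \near q, tangent_along F X r /\ tangent_along F Y r) ->
    tangent_along F (nabla X Y) q.

Definition ext_diff (eta : {scalar vf}) (X Y : vf) : Cinf M :=
  X (eta Y) - Y (eta X) - eta (bracket X Y).

Definition wedge_form (eta zeta : {scalar vf}) (X Y : vf) : Cinf M :=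
  eta X * zeta Y - eta Y * zeta X.

Definition almost_contact_metric g (phi : {linear vf -> vf}) (xi : vf)
    (eta : {scalar vf}) : Prop :=
  [/\ forall X, phi (phi X) = - X + eta X *: xi,
      eta xi = 1 &
      forall X Y, g (phi X) (phi Y) = g X Y - eta X * eta Y].

Definition fundamental_form g (phi : {linear vf -> vf}) (X Y : vf) : Cinf M :=
  g X (phi Y).

End riemannian_geometry.

(* The indices 1, 2, 3 are represented by 0, 1, 2 : 'I_3. *)
Definition even_permutation (i j k : 'I_3) : Prop :=
  exists s : 'S_3, ~~ odd_perm s /\ [/\ i = s 0, j = s 1 & k = s 2%:R].

Section almost_3_contact.
Context {R : realType} {n : nat} (M : manifold R (4 * n + 3)%N).
Local Notation vf := (vector_field M).
Variables (g : riemannian_metric M) (phi : 'I_3 -> {linear vf -> vf})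
  (xi : 'I_3 -> vf) (eta : 'I_3 -> {scalar vf}).

Definition almost_3_contact_metric : Prop :=
  (forall i, almost_contact_metric g (phi i) (xi i) (eta i)) /\
  forall i j k, even_permutation i j k ->
    [/\ forall X, phi k X = phi i (phi j X) - eta j X *: xi i,
        forall X, phi k X = - phi j (phi i X) + eta i X *: xi j,
        xi k = phi i (xi j) /\ xi k = - phi j (xi i) &
        forall X, eta k X = eta i (phi j X) /\ eta k X = - eta j (phi i X)].

Definition three_alpha_delta_Sasaki (alpha delta : R) : Prop :=
  [/\ almost_3_contact_metric, alpha != 0 &
      forall i j k, even_permutation i j k -> forall X Y,
        ext_diff (eta i) X Y =
          cst_Cinf M (2 * alpha) * fundamental_form g (phi i) X Y +
          cst_Cinf M (2 * (alpha - delta)) * wedge_form (eta j) (eta k) X Y].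

End almost_3_contact.

(* Main.v *)
From HB Require Import structures.
Require Import Defs.
From mathcomp Require Import all_boot all_order all_algebra all_fingroup.
From mathcomp Require Import all_classical all_reals all_analysis.
From mathcomp Require Import ring lra.
Set Implicit Arguments.
Unset Strict Implicit.
Unset Printing Implicit Defensive.
Import Order.TTheory GRing.Theory Num.Theory.
Import numFieldNormedType.Exports.
Local Open Scope classical_set_scope.
Local Open Scope ring_scope.

(** Write [L] for the Lie derivative along [xi i], and let [(i,j,k)] be even.
    As [L] commutes with the exterior derivative, the structure equations give
    [L Phi_i = 0], [L Phi_j = 2 delta Phi_k] and [L Phi_k = - 2 delta Phi_j].
    Applying [L] to [phi_k = phi_i phi_j - eta_j (x) xi_i] one gets
    [(L g)(phi_i X, phi_j Y) = 0], and this forces [L g = 0]. Then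
    [2 g(nabla_X xi_i, Y) = d eta_i(X, Y) + (L g)(X, Y)] determines [nabla xi_i].

    By the resulting formulas the Reeb fields span an involutive distribution. The
    Frobenius theorem is proved by passing to a frame [zeta] with
    [zeta_a(w_b) = delta_ab] for some functions [w_b]; such a frame commutes. Let
    [F(u)] be the value at time 1 of the integral curve [y] of [sum_a u_a zeta_a].
    Since the frame commutes, [t |-> y(t) + t sum_a h_a zeta_a(y(t))] solves the
    equation for [u + h] up to [O(|h|^2)], so [F] is differentiable with
    [dF(h) = sum_a h_a zeta_a(F)], and smooth by iterating this equation: smooth
    dependence of solutions on parameters is not needed.

    The leaves are totally geodesic because [nabla_{xi_j} xi_i] is vertical and
    [nabla_X Z] vanishes at a point of a leaf if [Z] vanishes along the leaf and
    [X] is tangent to it. *)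

(** The obstacle is that vector fields are derivations of the ring of global smooth functions.
    Components in a chart therefore have to be produced: Hadamard's lemma shows that a tangent
    vector at a point is a directional derivative in the chart, and bump functions turn functions
    and fields given near a point into global ones. For the differential equations the fields are
    cut off in a chart, which makes them bounded and Lipschitz on the whole of ['rV[R]_m]. Taking
    the coefficients [u] small then replaces taking the time small: for small [u] the field has
    Lipschitz constant at most 1/4, so the Picard operator halves distances on [[-2, 2]], and time 1
    is an interior time at which the solution is differentiable. Differentiability is obtained each
    time from an explicit quadratic remainder: for the flat functions at 0, for integrals depending
    on a parameter, and for the flow. *)

Local Notation cball := (closed_ball_ Num.Def.normr).

(** * Calculus on row vectors *)

Section calculus.
Context {R : realType}.

Lemma coord_le_norm m (v : 'rV[R]_m) i : `|v 0 i| <= `|v|.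
Proof.
by rewrite [leRHS]/Num.Def.normr /= mx_normrE; apply/bigmax_geP; right => /=; exists (0, i).
Qed.

Lemma rV_norm_le m (v : 'rV[R]_m) c : 0 <= c -> (forall i, `|v 0 i| <= c) -> `|v| <= c.
Proof.
move=> c0 vc; rewrite [leLHS]/Num.Def.normr /= mx_normrE; apply: bigmax_le => // -[i j] _ /=.
by rewrite (ord1 i).
Qed.

Lemma rVDE m (u v : 'rV[R]_m) i : (u + v) 0 i = u 0 i + v 0 i.
Proof. by rewrite mxE. Qed.

Lemma rVNE m (u : 'rV[R]_m) i : (- u) 0 i = - u 0 i.
Proof. by rewrite mxE. Qed.

Lemma rVZE m a (u : 'rV[R]_m) i : (a *: u) 0 i = a * u 0 i.
Proof. by rewrite mxE. Qed.

Definition rVE := (rVDE, rVNE, rVZE).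

Lemma cballC (V : normedModType R) (x y : V) e : cball x e y -> `|y - x| <= e.
Proof. by rewrite /closed_ball_ /= distrC. Qed.

Lemma cball_center (V : normedModType R) (x : V) e : 0 <= e -> cball x e x.
Proof. by rewrite /closed_ball_ /= subrr normr0. Qed.

Lemma cball_convex (V : normedModType R) (c x y : V) e t : 0 <= t <= 1 ->
  cball c e x -> cball c e y -> cball c e (x + t *: (y - x)).
Proof.
move=> /andP[t0 t1]; rewrite /closed_ball_ /= => cx cy.
have -> : c - (x + t *: (y - x)) = (1 - t) *: (c - x) + t *: (c - y).
  rewrite scalerBl scale1r -addrA (addrC (- _)) -scalerBr opprB.
  by rewrite [in RHS](addrC (c - y)) subrKA -(opprB y) scalerN opprD addrA.
apply: le_trans (ler_normD _ _) _; rewrite !normrZ ger0_norm ?subr_ge0 // (ger0_norm t0).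
have -> : e = (1 - t) * e + t * e by rewrite -mulrDl subrK mul1r.
by apply: lerD; apply: ler_wpM2l; rewrite ?subr_ge0.
Qed.

Lemma compact_cball m (x : 'rV[R]_m) e : compact (cball x e).
Proof.
apply: bounded_closed_compact; last exact: closed_closed_ball_.
exists (`|x| + e); split; first exact: num_real.
move=> M hM y /cballC yx; apply: le_trans (ltW hM).
by rewrite -[y](subrK x) addrC; apply: le_trans (ler_normD _ _) _; rewrite lerD2l.
Qed.

Lemma is_derive_rV_row m (y : R -> 'rV[R]_m) (t : R) (v : 'rV[R]_m) :
  is_derive t 1 y v -> forall i, is_derive t 1 (fun s => y s 0 i) (v 0 i).
Proof.
move=> [dy <-] i; have dyi := (derivable_mxP _ _ _).1 dy 0 i.
by apply: DeriveDef => //; rewrite derive_mx // mxE.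
Qed.

Lemma is_derive_row m (y : R -> 'rV[R]_m) (t : R) (v : 'rV[R]_m) :
  (forall i, is_derive t 1 (fun s => y s 0 i) (v 0 i)) -> is_derive t 1 y v.
Proof.
move=> dy; have d : derivable y t 1.
  by apply/derivable_mxP => i j; rewrite (ord1 i); case: (dy j).
apply: DeriveDef => //; rewrite derive_mx //; apply/matrixP => i j; rewrite mxE (ord1 i).
by case: (dy j).
Qed.

Lemma mean_value_le (f df : R -> R) (a b K : R) : a <= b ->
  (forall t, a <= t <= b -> is_derive t 1 f (df t)) ->
  (forall t, a <= t <= b -> `|df t| <= K) -> `|f b - f a| <= K * (b - a).
Proof.
move=> ab fd dfK.
have [||c + ->] := @MVT_segment R f df a b ab.
- by move=> x; rewrite in_itv /= => /andP[ax xb]; apply: fd; rewrite !ltW.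
- by apply: derivable_within_continuous => x; rewrite in_itv /= => /fd[].
rewrite in_itv /= => cab; rewrite normrM (ger0_norm (x := b - a)) ?subr_ge0 //.
by apply: ler_wpM2r; rewrite ?subr_ge0 // dfK.
Qed.

(** The norm is the maximum norm, so the scalar estimate applies to each coordinate and the constant
    is unchanged. *)
Lemma mean_value_rV_le m (f df : R -> 'rV[R]_m) (a b K : R) : a <= b -> 0 <= K ->
  (forall t, a <= t <= b -> is_derive t 1 f (df t)) ->
  (forall t, a <= t <= b -> `|df t| <= K) -> `|f b - f a| <= K * (b - a).
Proof.
move=> ab K0 fd dfK; apply: rV_norm_le => [|i]; first by rewrite mulr_ge0 // subr_ge0.
rewrite !rVE.
apply: (@mean_value_le (fun s => f s 0 i) (fun s => df s 0 i)) => // t tab.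
  exact: (is_derive_rV_row (fd t tab)).
exact: le_trans (coord_le_norm _ _) (dfK t tab).
Qed.

Lemma derive_coord m (f : 'rV[R]_m -> R) x v : differentiable f x ->
  'D_v f x = \sum_i v 0 i * 'D_(delta_mx 0 i) f x.
Proof.
move=> df; rewrite deriveE // [in LHS](row_sum_delta v) linear_sum.
by apply: eq_bigr => i _; rewrite linearZ /= -deriveE.
Qed.

Lemma derive_coord_le m (f : 'rV[R]_m -> R) x v K : differentiable f x ->
  (forall i, `|'D_(delta_mx 0 i) f x| <= K) -> `|'D_v f x| <= m%:R * K * `|v|.
Proof.
move=> df DK; rewrite derive_coord //; apply: le_trans (ler_norm_sum _ _ _) _.
apply: le_trans (_ : \sum_(i < m) `|v| * K <= _).
  by apply: ler_sum => i _; rewrite normrM ler_pM // coord_le_norm.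
by rewrite sumr_const card_ord -mulrA (mulrC K) mulr_natl.
Qed.

Lemma is_derive_line (V : normedModType R) (f : V -> R) x v (t : R) :
  differentiable f (x + t *: v) ->
  is_derive t 1 (fun s : R => f (x + s *: v)) ('D_v f (x + t *: v)).
Proof.
move=> df; have dv : derivable f (x + t *: v) v := diff_derivable df.
have E : (fun h : R => h^-1 *: (((fun s : R => f (x + s *: v)) \o shift t) (h *: (1 : R)) -
      f (x + t *: v))) =
    (fun h : R => h^-1 *: ((f \o shift (x + t *: v)) (h *: v) - f (x + t *: v))).
  apply/funext => h /=; congr (_ *: (f _ - _)).
  by rewrite [h *: (1 : R)]mulr1 scalerDl addrCA.
by apply: DeriveDef; rewrite /derivable /derive E.
Qed.

Lemma lipschitz_of_derive m (f : 'rV[R]_m -> R) c e K :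
  (forall x, cball c e x -> differentiable f x /\
    forall i, `|'D_(delta_mx 0 i) f x| <= K) ->
  forall x y, cball c e x -> cball c e y -> `|f y - f x| <= m%:R * K * `|y - x|.
Proof.
move=> fK x y cx cy.
have seg t : 0 <= t <= 1 -> cball c e (x + t *: (y - x)) by move=> ?; exact: cball_convex.
have := @mean_value_le (fun s => f (x + s *: (y - x)))
  (fun s => 'D_(y - x) f (x + s *: (y - x))) 0 1 (m%:R * K * `|y - x|) ler01.
rewrite scale1r scale0r addr0 subr0 mulr1 [x + _]addrC subrK; apply => t /seg /fK[df DK].
  exact: is_derive_line.
exact: derive_coord_le.
Qed.

Lemma Ck_bounded m (U : set 'rV[R]_m) (f : 'rV[R]_m -> R) c e :
  Ck 0 U f -> cball c e `<=` U -> exists2 K, 0 <= K & forall x, cball c e x -> `|f x| <= K.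
Proof.
(* For [e < 0] the ball is empty, while the extreme value theorem asks for a point. *)
move=> Cf BU; have [e0|e0] := ltP e 0.
  exists 0 => // x /cballC h; have := le_lt_trans h e0.
  by rewrite ltNge normr_ge0.
have cf : {within cball c e, continuous (fun x => `|f x|)}.
  apply: continuous_in_subspaceT => x /set_mem /BU /Cf cf.
  by apply: continuous_comp => //; exact: norm_continuous.
have [|k _ hk] := compact_EVT_max _ (@compact_cball m c e) cf.
  by exists c; exact: cball_center.
by exists `|f k| => // x cx; apply: hk; exact/mem_set.
Qed.

Lemma C1_lipschitz m (U : set 'rV[R]_m) (f : 'rV[R]_m -> R) c e :
  Ck 1 U f -> cball c e `<=` U -> exists2 K, 0 <= K &
  forall x y, cball c e x -> cball c e y -> `|f y - f x| <= K * `|y - x|.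
Proof.
move=> [df Df] BU.
have /choice[K hK] i : exists K, 0 <= K /\
    forall x, cball c e x -> `|'D_(delta_mx 0 i) f x| <= K.
  by have [K K0 hK] := Ck_bounded (Df (delta_mx 0 i)) BU; exists K.
have S0 : 0 <= \sum_i K i by apply: sumr_ge0 => i _; case: (hK i).
exists (m%:R * \sum_i K i); first by rewrite mulr_ge0.
apply: lipschitz_of_derive => x cx; split; first exact/df/BU.
move=> i; apply: le_trans ((hK i).2 x cx) _; rewrite (bigD1 i) //= lerDl.
by apply: sumr_ge0 => j _; case: (hK j).
Qed.

(** By the mean value theorem the increment is ['D_h f] at a point of the segment, and the partial
    derivatives are Lipschitz on the ball. The remainder has the form that [quadratic_diff] takes as
    input. *)
Lemma C2_taylor m (U : set 'rV[R]_m) (f : 'rV[R]_m -> R) c e :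
  Ck 2 U f -> cball c e `<=` U -> exists2 K, 0 <= K &
  forall x h, cball c e x -> cball c e (x + h) ->
    `|f (x + h) - f x - 'D_h f x| <= K * `|h| ^+ 2.
Proof.
move=> [df Df] BU.
have /choice[K hK] i : exists K, 0 <= K /\ forall x y, cball c e x -> cball c e y ->
    `|'D_(delta_mx 0 i) f y - 'D_(delta_mx 0 i) f x| <= K * `|y - x|.
  by have [K K0 hK] := C1_lipschitz (Df (delta_mx 0 i)) BU; exists K.
have S0 : 0 <= \sum_i K i by apply: sumr_ge0 => i _; case: (hK i).
exists (\sum_i K i) => // x h cx cxh.
have xhx : x + h - x = h by rewrite addrC addKr.
have seg t : 0 <= t <= 1 -> cball c e (x + t *: h).
  by move=> t01; have := cball_convex t01 cx cxh; rewrite xhx.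
have [||t] := @MVT_segment R (fun s => f (x + s *: h)) (fun s => 'D_h f (x + s *: h)) 0 1 ler01.
- move=> t; rewrite in_itv /= => /andP[t0 t1]; apply: is_derive_line; apply/df/BU/seg.
  by rewrite !ltW.
- apply: derivable_within_continuous => t; rewrite in_itv /= => t01.
  by case: (@is_derive_line _ f x h t (df _ (BU _ (seg _ t01)))).
rewrite in_itv /= scale1r scale0r addr0 subr0 mulr1 => t01 ->.
have ct := seg _ t01; rewrite !derive_coord; [|exact/df/BU..].
rewrite -sumrB mulr_suml; apply: le_trans (ler_norm_sum _ _ _) _; apply: ler_sum => i _.
rewrite -mulrBr normrM expr2 mulrA mulrC; apply: ler_pM => //; last exact: coord_le_norm.
apply: le_trans ((hK i).2 _ _ cx ct) _; apply: ler_wpM2l; first by case: (hK i).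
rewrite addrC addKr normrZ; case/andP: t01 => t0 t1.
by rewrite ger0_norm // ler_piMl.
Qed.

Lemma quadratic_diff (V W : normedModType R) (f : V -> W) (L : {linear V -> W}) (x : V)
    (K : R) : continuous L ->
  (\forall h \near (0 : V), `|f (x + h) - f x - L h| <= K * `|h| ^+ 2) ->
  differentiable f x /\ 'd f x = L :> (V -> W).
Proof.
move=> cL fK.
have key : f \o shift x = cst (f x) + (L : V -> W) +o_ 0 id.
  apply/eqaddoP => e e0.
  have small : \forall h \near (0 : V), `|K| * `|h| <= e.
    have K1 : 0 < `|K| + 1 by rewrite ltr_wpDl.
    have : \forall h \near (0 : V), `|h| < e / (`|K| + 1).
      apply/nbhs_normP; exists (e / (`|K| + 1)); first by rewrite /= divr_gt0.
      by move=> h /=; rewrite sub0r normrN.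
    apply: filterS => h; rewrite ltr_pdivlMr // => /ltW; apply: le_trans.
    by rewrite mulrC; apply: ler_wpM2l => //; rewrite lerDl.
  apply: filterS2 fK small => h fh sh.
  rewrite /= !fctE /= [h + x]addrC opprD addrA; apply: le_trans fh _.
  rewrite expr2 mulrA; apply: ler_wpM2r => //; apply: le_trans sh.
  by apply: ler_wpM2r => //; exact: ler_norm.
have dE := diff_unique cL key.
by split => //; apply/diff_locallyP; rewrite dE.
Qed.

Lemma quadratic_differentiable m (f : 'rV[R]_m -> R) (x : 'rV[R]_m)
    (l : 'I_m -> R) (K : R) :
  (\forall h \near (0 : 'rV[R]_m), `|f (x + h) - f x - \sum_i h 0 i * l i| <= K * `|h| ^+ 2) ->
  differentiable f x /\ forall h, 'D_h f x = \sum_i h 0 i * l i.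
Proof.
move=> fK; pose L (h : 'rV[R]_m) : R := \sum_i h 0 i * l i.
have Llin : linear L.
  move=> a u v; rewrite /L scaler_sumr -big_split; apply: eq_bigr => i _ /=.
  by rewrite !rVE mulrDl -mulrA.
pose LL := GRing.isLinear.Build R 'rV[R]_m R *:%R L Llin.
pose Ll : {linear 'rV[R]_m -> R} := HB.pack L LL.
have cL : continuous Ll.
  move=> h; have -> : (Ll : _ -> _) = \sum_i (fun h : 'rV[R]_m => h 0 i * l i).
    by apply/funext => u; rewrite fct_sumE.
  have := @Ck_sum R 'rV[R]_m setT openT R 0 m (fun i h => h 0 i * l i); apply => // i u _.
  apply: (@continuousM _ _ (fun h : 'rV[R]_m => h 0 i) (cst (l i))).
    exact: coord_continuous.
  exact: cst_continuous.
have [df dE] := quadratic_diff cL fK.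
by split => // h; rewrite deriveE // dE.
Qed.

Lemma differentiable_row (V : normedModType R) m (f : V -> 'rV[R]_m) x :
  (forall i, differentiable (fun y => f y 0 i) x) -> differentiable f x.
Proof.
move=> df; have -> : f = \sum_i (fun y => f y 0 i *: delta_mx 0 i).
  by apply/funext => y; rewrite fct_sumE [LHS]row_sum_delta.
by apply: differentiable_sum => i; exact: differentiableZl.
Qed.

Lemma Ck_row (V : normedModType R) (U : set V) m k (f : V -> 'rV[R]_m) : open U ->
  (forall i, Ck k U (fun y => f y 0 i)) -> Ck k U f.
Proof.
move=> oU; elim: k f => [|k IH] f Cf.
  have -> : f = \sum_i (fun y => f y 0 i *: delta_mx 0 i).
    by apply/funext => y; rewrite fct_sumE [LHS]row_sum_delta.
  apply: Ck_sum => // i x Ux; apply: cvgZ; [exact: Cf|exact: cvg_cst].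
have df x : U x -> differentiable f x.
  by move=> Ux; apply: differentiable_row => i; case: (Cf i) => + _; apply.
split=> // v; apply: IH => i; case: (Cf i) => _ /(_ v); apply: (Ck_ext oU) => x Ux.
by rewrite derive_mx ?mxE //; exact/diff_derivable/df.
Qed.

(** The derivative of [1/f] is [- (1/f)^2 f'], in which [1/f] is needed only with one order of
    smoothness less. *)
Lemma CkV (V : normedModType R) (U : set V) k (f : V -> R) : open U ->
  (forall x, U x -> f x != 0) -> Ck k U f -> Ck k U (fun x => (f x)^-1).
Proof.
move=> oU f0; elim: k => [|k IH] Cf.
  by move=> x Ux; apply: cvgV; [exact: f0|exact: Cf].
have [df Df] := Cf; have Cfi := IH (Ck_le Cf).
split=> [x Ux|v]; first by apply: differentiableV; [exact: df|exact: f0].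
apply: (Ck_ext oU (f := (cst (-1) * (fun x => (f x)^-1) * (fun x => (f x)^-1)) * 'D_v f)).
  move=> x Ux; rewrite deriveV ?f0 //; last exact/diff_derivable/df.
  by rewrite !fctE mulN1r mulNr expr2 invfM.
by apply: (CkM oU); [apply: (CkM oU) => //; apply: (CkM oU) => //; exact: Ck_cst|exact: Df].
Qed.

End calculus.

(** * Bump functions *)

Section bump.
Context {R : realType}.

(* Closed under differentiation: [flat n' = - n *: flat n.+1 + flat n.+2]. *)
Definition flat n (t : R) : R := if 0 < t then t^-1 ^+ n * expR (- t^-1) else 0.

Lemma flat_le0 n t : t <= 0 -> flat n t = 0.
Proof. by rewrite /flat ltNge => ->. Qed.

Lemma flat_gt0 t : 0 < t -> 0 < flat 0 t.
Proof. by move=> t0; rewrite /flat t0 expr0 mul1r expR_gt0. Qed.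

Lemma flat_ge0 t : 0 <= flat 0 t.
Proof. by case: (leP t 0) => [/flat_le0->//|/flat_gt0/ltW]. Qed.

(** With [u = 1/t] this is [u^(n+2) / (n+2)! <= exp u], a term of the exponential series. The
    exponent 2 on the right is what makes the derivative at 0 vanish. *)
Lemma flat_bound n t : `|flat n t| <= n.+2`!%:R * `|t| ^+ 2.
Proof.
rewrite /flat; case: ifPn => t0; last by rewrite normr0 mulr_ge0 // ler0n.
have u0 : 0 < t^-1 by rewrite invr_gt0.
have := expR_ge1Dxn n.+1 (ltW u0); rewrite expRN => h.
have {}h : t^-1 ^+ n.+2 / n.+2`!%:R <= expR t^-1 by apply: le_trans h; rewrite lerDr.
rewrite ger0_norm ?mulr_ge0 ?invr_ge0 ?exprn_ge0 ?expR_ge0 ?(ltW u0) // (gtr0_norm t0).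
rewrite ler_pdivrMr ?expR_gt0 // -mulrA -ler_pdivrMl ?ltr0n ?fact_gt0 //.
rewrite -ler_pdivrMl ?exprn_gt0 //; apply: le_trans h.
by rewrite -exprVn mulrCA -exprD mulrC lexx.
Qed.

Lemma is_derive_flat n (t : R) :
  is_derive t 1 (flat n) (- n%:R * flat n.+1 t + flat n.+2 t).
Proof.
have [t0|t0|->] := ltgtP t 0.
- rewrite !flat_le0 ?(ltW t0) // mulr0 addr0.
  have E : \near t, (cst 0 : R -> R) t = flat n t.
    by apply: filterS (lt_le_nbhsl t0) => s s0; rewrite flat_le0.
  exact: (near_eq_is_derive E).
- have E : \forall s \near t, ((fun s => s^-1) ^+ n * (expR \o (fun s => - s^-1))) s = flat n s.
    by apply: filterS (lt_nbhsr t0) => s s0; rewrite /flat s0 !fctE.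
  apply: (near_eq_is_derive E).
  have tN0 : t != 0 by rewrite gt_eqF.
  have dV : is_derive t 1 (fun s : R => s^-1) (- t ^- 2).
    by apply: is_derive_eq; [exact: is_deriveV|rewrite [LHS]mulr1].
  have dE : is_derive t 1 (expR \o (fun s : R => - s^-1)) (expR (- t^-1) * t ^- 2).
    have := is_deriveN dV; rewrite opprK => dN.
    exact: (@is_derive1_comp _ expR (fun s : R => - s^-1)).
  have [dM dME] := is_deriveM (is_deriveX n dV) dE; apply: DeriveDef => //; rewrite dME.
  have SE (a b : R) : a *: b = a * b by [].
  rewrite /flat t0 fctE /= -!exprVn !SE; set u := t^-1; set x := expR _.
  case: n {E dM dME} => [|n]; first by rewrite !expr0 expr2; ring.
  by rewrite /= !exprS; ring.
(* At 0 the claimed derivative is 0, and [flat_bound] is a quadratic remainder for the zero map. *)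
- rewrite !flat_le0 // mulr0 addr0.
  have L0 : continuous (\0 : R -> R) by move=> s; exact: cvg_cst.
  have [|df dE] := @quadratic_diff R R R (flat n) (\0 : {linear R -> R}) 0 n.+2`!%:R L0.
    apply: filterE => h.
    by rewrite (flat_le0 n (lexx 0)) add0r /= !subr0; exact: flat_bound.
  apply: DeriveDef; first exact: diff_derivable.
  by rewrite deriveE // dE.
Qed.

Lemma differentiable_flat n t : differentiable (flat n) t.
Proof. by apply/derivable1_diffP; case: (is_derive_flat n t). Qed.

(** The induction on [k] is for all [n] at once, since the derivative of [flat n] involves
    [flat n.+1] and [flat n.+2]. *)
Lemma Ck_flat (V : normedModType R) (U : set V) k n (f : V -> R) : open U ->
  Ck k U f -> Ck k U (flat n \o f).
Proof.
move=> oU; elim: k n f => [|k IH] n f Cf.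
  move=> x Ux; apply: continuous_comp; first exact: Cf.
  exact/differentiable_continuous/differentiable_flat.
have [df Df] := Cf; split=> [x Ux|v].
  by apply: differentiable_comp; [exact: df|exact: differentiable_flat].
apply: (Ck_ext oU (f := (cst (- n%:R) * (flat n.+1 \o f) + (flat n.+2 \o f)) * 'D_v f)).
  move=> x Ux; rewrite [RHS]deriveE; last first.
    by apply: differentiable_comp; [exact: df|exact: differentiable_flat].
  rewrite diff_comp /=; [|exact: df|exact: differentiable_flat].
  rewrite -(deriveE _ (df _ Ux)).
  have -> : 'D_v f x = 'D_v f x *: (1 : R) by rewrite [RHS]mulr1.
  rewrite linearZ /= -deriveE; last exact: differentiable_flat.
  have [_ ->] := is_derive_flat n (f x).
  by rewrite !fctE /= mulrC.
apply: (CkM oU _ (Df v)); apply: (CkD oU); last by apply: IH; exact: Ck_le.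
by apply: (CkM oU); [exact: Ck_cst|apply: IH; exact: Ck_le].
Qed.

Definition step (s : R) : R := flat 0 s / (flat 0 s + flat 0 (1 - s)).

Lemma step_den_gt0 s : 0 < flat 0 s + flat 0 (1 - s).
Proof.
have [s0|s0] := ltP 0 s.
  by rewrite ltr_pwDl ?flat_gt0 ?flat_ge0.
by rewrite ltr_wpDl ?flat_ge0 // flat_gt0 // subr_gt0 (le_lt_trans s0).
Qed.

Lemma step_le0 s : s <= 0 -> step s = 0.
Proof. by move=> s0; rewrite /step flat_le0 // mul0r. Qed.

Lemma step_ge1 s : 1 <= s -> step s = 1.
Proof.
move=> s1; rewrite /step (flat_le0 _ (t := 1 - s)) ?subr_le0 // addr0 divff //.
by rewrite gt_eqF // flat_gt0 // (lt_le_trans ltr01).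
Qed.

Lemma Ck_step (V : normedModType R) (U : set V) k (f : V -> R) : open U ->
  Ck k U f -> Ck k U (step \o f).
Proof.
move=> oU Cf; have C1 : Ck k U (flat 0 \o f) by exact: Ck_flat.
have C2 : Ck k U (flat 0 \o (cst 1 + cst (-1) * f)).
  apply: Ck_flat => //; apply: (CkD oU); first exact: Ck_cst.
  by apply: (CkM oU) => //; exact: Ck_cst.
have {}C2 : Ck k U (flat 0 \o (fun x => 1 - f x)).
  by apply: (Ck_ext oU _ C2) => x _; rewrite /= !fctE /= mulN1r.
apply: (CkM oU C1); apply: (CkV oU) => [x _|]; last exact: (CkD oU C1 C2).
by rewrite gt_eqF // step_den_gt0.
Qed.

Lemma derive_coordinate m (x v : 'rV[R]_m) i :
  'D_v (fun y : 'rV[R]_m => y 0 i) x = v 0 i.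
Proof.
rewrite deriveE; last exact: differentiable_coord.
pose L (h : 'rV[R]_m) : R := h 0 i.
have Ll : linear L by move=> a u w; rewrite /L !rVE.
pose LL := GRing.isLinear.Build R 'rV[R]_m R *:%R L Ll.
pose LLL : {linear 'rV[R]_m -> R} := HB.pack L LL.
have -> : (fun y : 'rV[R]_m => y 0 i) = LLL by [].
by rewrite diff_lin //= => y; exact: coord_continuous.
Qed.

Lemma Ck_coordinate m (U : set 'rV[R]_m) k i : open U -> Ck k U (fun x : 'rV[R]_m => x 0 i).
Proof.
move=> oU; case: k => [x _|k]; first exact: coord_continuous.
split=> [x _|v]; first exact: differentiable_coord.
by apply: (Ck_ext oU _ (Ck_cst oU k (v 0 i))) => x _; rewrite derive_coordinate.
Qed.

(* For the maximum norm a product of one-variable bumps is supported in a ball. *)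
Definition rV_bump m (c : 'rV[R]_m) (r : R) (x : 'rV[R]_m) : R :=
  \prod_i step (2 - 4 * (x 0 i - c 0 i) ^+ 2 / r ^+ 2).

(** For [t = x_i - c_i] the argument [2 - 4 t^2 / r^2] of [step] is at least 1 if [|t| <= r/2], and
    at most 0 if [|t| >= r]. It uses [t^2] because [|t|] is not smooth. *)
Lemma rV_bump1 m (c : 'rV[R]_m) (r : R) x : 0 < r ->
  cball c (r / 2) x -> rV_bump c r x = 1.
Proof.
move=> r0 /cballC xc; rewrite /rV_bump big1 // => i _; rewrite step_ge1 //.
have := le_trans (coord_le_norm _ i) xc; rewrite !rVE; set t := _ - _ => tr.
rewrite lerBrDl -lerBrDr ler_pdivrMr ?exprn_gt0 //.
rewrite -(@real_normK _ t) ?num_real //.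
have : `|t| ^+ 2 <= (r / 2) ^+ 2 by rewrite lerXn2r // nnegrE divr_ge0 // ltW.
by rewrite expr_div_n => h; lra.
Qed.

Lemma rV_bump0 m (c : 'rV[R]_m) (r : R) x : 0 < r -> ~ cball c r x -> rV_bump c r x = 0.
Proof.
move=> r0 xc; have [i ri] : exists i, r < `|(x - c) 0 i|.
  apply: contrapT => h; apply: xc; rewrite /closed_ball_ /= distrC.
  apply: rV_norm_le (ltW r0) _ => i; rewrite leNgt; apply/negP => hi.
  by apply: h; exists i.
rewrite /rV_bump (bigD1 i) //= step_le0 ?mul0r //.
move: ri; rewrite !rVE; set t := _ - _ => ri.
rewrite subr_le0 ler_pdivlMr ?exprn_gt0 // -(@real_normK _ t) ?num_real //.
have : r ^+ 2 <= `|t| ^+ 2 by rewrite lerXn2r ?nnegrE // ltW.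
by move=> h; have := exprn_gt0 2 r0; lra.
Qed.

Lemma Ck_rV_bump m (U : set 'rV[R]_m) k (c : 'rV[R]_m) (r : R) : open U ->
  Ck k U (rV_bump c r).
Proof.
move=> oU; rewrite /rV_bump.
have P n (F : 'I_n -> 'rV[R]_m -> R) : (forall i, Ck k U (F i)) ->
    Ck k U (fun x => \prod_i F i x).
  move=> CF; rewrite -(_ : \prod_i F i = (fun x => \prod_i F i x)); last first.
    by apply/funext => x; elim/big_ind2 : _ => // f a g b <- <-.
  by elim/big_ind : _ => //; [exact: Ck_cst|move=> f g; exact: CkM].
apply: P => i; suff C : Ck k U (fun x => 2 - 4 * (x 0 i - c 0 i) ^+ 2 / r ^+ 2).
  exact: (Ck_step oU C).
have C : Ck k U (cst 2 + cst (- 4 / r ^+ 2) * (((fun x => x 0 i) + cst (- c 0 i))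
                 * ((fun x => x 0 i) + cst (- c 0 i)))).
  by do ?[apply: (CkD oU)|apply: (CkM oU)|exact: Ck_coordinate|exact: Ck_cst].
by apply: (Ck_ext oU _ C) => x _; rewrite !fctE expr2; ring.
Qed.

End bump.

(** * Integrals along rays and Hadamard's lemma *)

Section unit_integral.
Context {R : realType}.
Local Notation mu := (@lebesgue_measure R).

Lemma is_derive_integral (a : R) (h : R -> R) (t : R) : continuous h -> a < t ->
  is_derive t 1 (fun x => \int[mu]_(s in `[a, x]) h s)%R (h t).
Proof.
move=> ch at_; have tt1 : t < t + 1 by rewrite ltrDl.
have ih : mu.-integrable `[a, t + 1] (EFin \o h).
  apply: continuous_compact_integrable; first exact: segment_compact.
  exact: continuous_subspaceT.
have [d dE] := continuous_FTC1_closed tt1 ih at_ (ch t).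
by apply: DeriveDef; [exact: d|rewrite -derive1E; exact: dE].
Qed.

Definition unit_int (h : R -> R) : R := \int[mu]_(t in `[0, 1]) h t.

Lemma unit_int_FTC (h A : R -> R) : continuous h ->
  (forall t : R, 0 <= t <= 1 -> is_derive t 1 A (h t)) -> unit_int h = A 1 - A 0.
Proof.
move=> ch dA.
have cA t : 0 <= t <= 1 -> {for t, continuous A}.
  by move=> /dA[dt _]; apply/differentiable_continuous/derivable1_diffP.
rewrite /unit_int /Rintegral (@continuous_FTC2 _ h A 0 1) //.
- exact: continuous_subspaceT.
- split.
  + by move=> t; rewrite in_itv /= => /andP[t0 t1]; case: (dA t); rewrite ?(ltW t0) ?(ltW t1).
  + by apply: cvg_at_right_filter; apply: cA; rewrite lexx ler01.
  + by apply: cvg_at_left_filter; apply: cA; rewrite lexx ler01.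
- move=> t; rewrite in_itv /= => /andP[t0 t1]; rewrite derive1E.
  by case: (dA t); rewrite ?(ltW t0) ?(ltW t1).
Qed.

(** This reduces linearity and the norm estimate for [unit_int] to rules for derivatives and the
    mean value inequality. The lower limit [-1] in the proof makes 0 an interior point, so that the
    derivative there is two-sided. *)
Lemma unit_int_antiderivative (h : R -> R) : continuous h ->
  exists2 H : R -> R, forall t : R, 0 <= t <= 1 -> is_derive t 1 H (h t) &
    unit_int h = H 1 - H 0.
Proof.
move=> ch; pose H x := (\int[mu]_(s in `[-1, x]) h s)%R.
have dH (t : R) : 0 <= t <= 1 -> is_derive t 1 H (h t).
  by move=> /andP[t0 _]; apply: is_derive_integral => //; apply: lt_le_trans t0; rewrite oppr_lt0.
by exists H => //; exact: unit_int_FTC.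
Qed.

Lemma unit_int_lin (a : R) (h k : R -> R) : continuous h -> continuous k ->
  unit_int (fun t => a * h t + k t) = a * unit_int h + unit_int k.
Proof.
move=> ch ck; have [H dH ->] := unit_int_antiderivative ch.
have [K dK ->] := unit_int_antiderivative ck.
have C : continuous (fun t => a * h t + k t).
  by move=> t; apply: cvgD; [apply: cvgM; [exact: cvg_cst|exact: ch]|exact: ck].
have D (t : R) : 0 <= t <= 1 -> is_derive t 1 (a *: H + K) (a * h t + k t).
  move=> /[dup] /dH dHt /dK dKt; exact: (is_deriveD (is_deriveZ a dHt) dKt).
rewrite (unit_int_FTC C D).
by rewrite -[(a *: H + K) 1]/(a * H 1 + K 1) -[(a *: H + K) 0]/(a * H 0 + K 0); ring.
Qed.

Lemma unit_int_cst (c : R) : unit_int (cst c) = c.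
Proof.
have D (t : R) : 0 <= t <= 1 -> is_derive t 1 (c *: (id : R -> R)) ((cst c : R -> R) t).
  by move=> _; have := is_deriveZ c (is_derive_id t (1 : R)); rewrite [_ *: 1]mulr1.
rewrite (unit_int_FTC (@cst_continuous _ _ c) D).
by rewrite -[(c *: id) 1]/(c * 1) -[(c *: id) 0]/(c * 0) mulr1 mulr0 subr0.
Qed.

Lemma unit_int_le (h : R -> R) K : continuous h ->
  (forall t, 0 <= t <= 1 -> `|h t| <= K) -> `|unit_int h| <= K.
Proof.
move=> ch hK; have [H dH ->] := unit_int_antiderivative ch.
by have := mean_value_le ler01 dH hK; rewrite subr0 mulr1.
Qed.

Lemma unit_int_sum m (a : 'I_m -> R) (h : 'I_m -> R -> R) :
  (forall i, continuous (h i)) ->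
  unit_int (fun t => \sum_i a i * h i t) = \sum_i a i * unit_int (h i).
Proof.
elim: m a h => [|m IH] a h ch.
  by rewrite big_ord0; under eq_fun do rewrite big_ord0; exact: unit_int_cst.
under eq_fun do rewrite big_ord_recl; rewrite big_ord_recl unit_int_lin //.
  by rewrite IH // => i; exact: ch.
move=> t; have := @Ck_sum R R setT openT R 0 m (fun i t => a (lift ord0 i) * h (lift ord0 i) t).
rewrite fct_sumE; apply => // i s _.
by apply: cvgM; [exact: cvg_cst|exact: ch].
Qed.

End unit_integral.

Section hadamard.
Context {R : realType} {m : nat}.
Variable q : 'rV[R]_m.

(** The weight [t ^+ k] makes this family closed under differentiation in [x]: each derivative
    brings out one factor [t]. *)
Definition ray_int k (g : 'rV[R]_m -> R) (x : 'rV[R]_m) : R :=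
  unit_int (fun t => t ^+ k * g (q + t *: (x - q))).

Lemma ray_continuous k (g : 'rV[R]_m -> R) v : continuous g ->
  continuous (fun t : R => t ^+ k * g (q + t *: v)).
Proof.
move=> cg t; apply: cvgM; first exact: exprn_continuous.
apply: (@continuous_comp _ _ _ (fun t : R => q + t *: v) g); last exact: cg.
by apply: cvgD; [exact: cvg_cst|apply: cvgZ; [exact: cvg_id|exact: cvg_cst]].
Qed.

Lemma smooth_derive (V W : normedModType R) (U : set V) (f : V -> W) v :
  smooth_on U f -> smooth_on U ('D_v f).
Proof. by move=> sf k; have [_] := sf k.+1; apply. Qed.

Lemma smooth_continuous (V W : normedModType R) (f : V -> W) :
  smooth_on setT f -> continuous f.
Proof. by move=> sf x; exact: (sf 0). Qed.

Lemma smooth_differentiable (V W : normedModType R) (U : set V) (f : V -> W) x :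
  smooth_on U f -> U x -> differentiable f x.
Proof. by move=> sf; have [+ _] := sf 1; apply. Qed.

Lemma ray_int_derive_sum k (g : 'rV[R]_m -> R) x v : smooth_on setT g ->
  ray_int k ('D_v g) x = \sum_i v 0 i * ray_int k ('D_(delta_mx 0 i) g) x.
Proof.
move=> sg; rewrite /ray_int -(@unit_int_sum _ m (v 0)
  (fun i t => t ^+ k * 'D_(delta_mx 0 i) g (q + t *: (x - q)))).
  congr unit_int; apply/funext => t; rewrite derive_coord; last exact: smooth_differentiable sg _.
  by rewrite mulr_sumr; apply: eq_bigr => i _; rewrite mulrCA.
move=> i; apply: (@ray_continuous k ('D_(delta_mx 0 i) g) (x - q)).
exact/smooth_continuous/smooth_derive.
Qed.

(** Differentiation under the integral sign: the Taylor remainder of [g] is bounded by [K |h|^2]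
    uniformly in [t], and integration preserves the bound. *)
Lemma derive_ray_int k (g : 'rV[R]_m -> R) x : smooth_on setT g ->
  differentiable (ray_int k g) x /\
  forall v, 'D_v (ray_int k g) x = ray_int k.+1 ('D_v g) x.
Proof.
move=> sg; have cg := smooth_continuous sg.
(* This ball contains the segments from [q] to [x] and, for [|h| < 1], from [q] to [x + h]. *)
have [K K0 hK] := C2_taylor (c := q) (e := `|x - q| + 1) (sg 2) (@subsetT _ _).
have [|df dE] := @quadratic_differentiable R m (ray_int k g) x
    (fun i => ray_int k.+1 ('D_(delta_mx 0 i) g) x) K.
  have small : \forall h \near (0 : 'rV[R]_m), `|h| < 1.
    by apply/nbhs_normP; exists 1 => //= h; rewrite /= sub0r normrN.
  apply: filterS small => h h1; rewrite -ray_int_derive_sum //.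
  have -> : ray_int k g (x + h) - ray_int k g x - ray_int k.+1 ('D_h g) x =
      -1 * ray_int k.+1 ('D_h g) x + (-1 * ray_int k g x + ray_int k g (x + h)) by ring.
  have c1 := @ray_continuous k g (x + h - q) cg.
  have c2 := @ray_continuous k g (x - q) cg.
  have c3 := @ray_continuous k.+1 ('D_h g) (x - q) (smooth_continuous (smooth_derive h sg)).
  have c4 : continuous (fun t : R => -1 * (t ^+ k * g (q + t *: (x - q))) +
      t ^+ k * g (q + t *: (x + h - q))).
    by move=> t; apply: cvgD; [apply: cvgM; [exact: cvg_cst|exact: c2]|exact: c1].
  rewrite /ray_int -(unit_int_lin _ c2 c1) -(unit_int_lin _ c3 c4).
  apply: unit_int_le => [t|t /andP[t0 t1]].
    by apply: cvgD; [apply: cvgM; [exact: cvg_cst|exact: c3]|exact: c4].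
  set z := q + t *: (x - q).
  have -> : q + t *: (x + h - q) = z + t *: h.
    by rewrite /z -[RHS]addrA -scalerDr (addrAC x (- q)).
  have dth : t * 'D_h g z = 'D_(t *: h) g z.
    rewrite !derive_coord; [|exact: smooth_differentiable sg _..].
    by rewrite mulr_sumr; apply: eq_bigr => i _; rewrite rVZE mulrA.
  have -> : -1 * (t ^+ k.+1 * 'D_h g z) + (-1 * (t ^+ k * g z) + t ^+ k * g (z + t *: h))
      = t ^+ k * (g (z + t *: h) - g z - 'D_(t *: h) g z).
    by rewrite -dth exprS; ring.
  have nt (v : 'rV[R]_m) : `|t *: v| <= `|v| by rewrite normrZ ger0_norm // ler_piMl.
  rewrite normrM ger0_norm ?exprn_ge0 //.
  apply: le_trans (_ : 1 * (K * `|t *: h| ^+ 2) <= _).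
    apply: ler_pM => //; rewrite ?exprn_ge0 ?exprn_ile1 //; apply: hK.
      by rewrite /closed_ball_ /= opprD addrA subrr sub0r normrN (le_trans (nt _)) // lerDl ler01.
    rewrite /closed_ball_ /= !opprD !addrA subrr sub0r -opprD normrN.
    by apply: le_trans (ler_normD _ _) _; apply: lerD => //; apply: le_trans (nt _) (ltW h1).
  by rewrite mul1r; apply: ler_wpM2l => //; rewrite lerXn2r ?nnegrE.
by split=> // v; rewrite dE ray_int_derive_sum.
Qed.

Lemma smooth_ray_int k (g : 'rV[R]_m -> R) :
  smooth_on setT g -> smooth_on setT (ray_int k g).
Proof.
move=> sg j; elim: j k g sg => [|j IH] k g sg.
  by move=> x _; apply: differentiable_continuous; case: (derive_ray_int k x sg).
split=> [x _|v]; first by case: (derive_ray_int k x sg).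
have -> : 'D_v (ray_int k g) = ray_int k.+1 ('D_v g).
  by apply/funext => x; case: (derive_ray_int k x sg).
by apply: IH; exact: smooth_derive.
Qed.

(** The factor [h i] is the mean of the [i]-th partial derivative over the segment from [q] to [x];
    the formula is the fundamental theorem of calculus along that segment. *)
Lemma hadamard (f : 'rV[R]_m -> R) : smooth_on setT f ->
  exists2 h : 'I_m -> 'rV[R]_m -> R, forall i, smooth_on setT (h i) &
  (forall x, f x = f q + \sum_i (x 0 i - q 0 i) * h i x) /\
  (forall i, h i q = 'D_(delta_mx 0 i) f q).
Proof.
move=> sf; exists (fun i => ray_int 0 ('D_(delta_mx 0 i) f)).
  by move=> i; apply: smooth_ray_int; exact: smooth_derive.
split=> [x|i]; last first.
  rewrite /ray_int; under eq_fun do rewrite expr0 mul1r subrr scaler0 addr0.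
  exact: unit_int_cst.
have D (t : R) : 0 <= t <= 1 ->
    is_derive t 1 (fun s => f (q + s *: (x - q))) (t ^+ 0 * 'D_(x - q) f (q + t *: (x - q))).
  by move=> _; rewrite expr0 mul1r; apply: is_derive_line; exact: smooth_differentiable sf _.
have c := @ray_continuous 0 ('D_(x - q) f) (x - q) (smooth_continuous (smooth_derive (x - q) sf)).
have := unit_int_FTC c D; rewrite scale1r scale0r addr0 [q + _]addrC subrK => E.
apply/eqP; rewrite addrC -subr_eq -E; apply/eqP.
rewrite -[LHS]/(ray_int 0 ('D_(x - q) f) x) ray_int_derive_sum //.
by apply: eq_bigr => i _; rewrite !rVE.
Qed.

End hadamard.

(** * Flows of commuting vector fields *)

Section picard.
Context {R : realType}.

Lemma addrBB (V : zmodType) (x y z : V) : (x + y) - (x + z) = y - z.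
Proof. by rewrite opprD addrACA subrr add0r. Qed.

Lemma pow2_small (C e : R) : 0 < e -> exists n, C / 2 ^+ n < e.
Proof.
move=> e0; have [n hn] : exists n, C / e < n%:R.
  exists (Num.truncn `|C / e|).+1; apply: le_lt_trans (ler_norm _) _; exact: truncnS_gt.
exists n; rewrite ltr_pdivrMr ?exprn_gt0 // mulrC -ltr_pdivrMr //.
by apply: lt_trans hn _; rewrite -natrX ltr_nat ltn_expl.
Qed.

(** With [D n = 2 C / 2^n] the intervals from [u n - D n] to [u n + D n] are nested, because
    [D n = D n.+1 + C / 2^n]. The supremum of their left ends lies in all of them. *)
Lemma geometric_limit (u : nat -> R) C : (forall n, `|u n.+1 - u n| <= C / 2 ^+ n) ->
  exists l, forall n, `|l - u n| <= 2 * C / 2 ^+ n.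
Proof.
move=> uC; pose D n := 2 * C / 2 ^+ n; pose a n := u n - D n; pose b n := u n + D n.
have DS n : D n = D n.+1 + C / 2 ^+ n by rewrite /D exprS invfM; field; rewrite expf_neq0.
have aS n : a n <= a n.+1.
  have := uC n; rewrite ler_norml /a (DS n) => /andP[h _].
  by have := DS n; rewrite /D exprS invfM; lra.
have bS n : b n.+1 <= b n.
  have := uC n; rewrite ler_norml /b (DS n) => /andP[_ h].
  by have := DS n; rewrite /D exprS invfM; lra.
have D0 n : 0 <= D n.
  have C0 : 0 <= C by apply: le_trans (normr_ge0 _) (le_trans (uC 0) _); rewrite expr0 divr1.
  by rewrite /D divr_ge0 // ?mulr_ge0 ?exprn_ge0.
have am i j : (i <= j)%N -> a i <= a j by exact: (@nondecreasing_seqP _ _ a).1.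
have bm i j : (i <= j)%N -> b j <= b i by exact: (@nonincreasing_seqP _ _ b).1.
have ab i j : a i <= b j.
  apply: le_trans (am _ _ (leq_maxl i j)) _; apply: le_trans (bm _ _ (leq_maxr i j)).
  by rewrite /a /b; have := D0 (maxn i j); lra.
have ub n : ubound (range a) (b n) by move=> _ [i _ <-].
have sa : has_sup (range a) by split; [exists (a 0), 0|exists (b 0)].
exists (sup (range a)) => n; rewrite -/(D n) ler_norml.
have h1 : a n <= sup (range a) by apply: ub_le_sup; [exact: sa.2|exists n].
have h2 : sup (range a) <= b n by apply: ge_sup; [exact: sa.1|exact: ub].
by move: h1 h2; rewrite /a /b; lra.
Qed.

Lemma mean_value_sym m (f df : R -> 'rV[R]_m) (T K : R) : 0 <= K ->
  (forall t : R, - T <= t <= T -> is_derive t 1 f (df t)) ->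
  (forall t, - T <= t <= T -> `|df t| <= K) ->
  forall a b, - T <= a <= T -> - T <= b <= T -> `|f b - f a| <= K * `|b - a|.
Proof.
move=> K0 fd dK a b /andP[a1 a2] /andP[b1 b2].
wlog ab : a b a1 a2 b1 b2 / a <= b.
  by move=> wl; have [ab|/ltW ba] := leP a b; [exact: wl|rewrite distrC (distrC b); exact: wl].
rewrite (ger0_norm (x := b - a)) ?subr_ge0 //.
by apply: (@mean_value_rV_le _ _ f df) => // t /andP[t1 t2]; [apply: fd|apply: dK];
  rewrite (le_trans a1 t1) (le_trans t2 b2).
Qed.

(* Stopping time at [2] keeps all Picard iterates continuous on the whole line. *)
Definition clamp (t : R) : R := if t < -2 then -2 else if 2 < t then 2 else t.

Lemma near_time (t : R) : -2 < t < 2 -> \forall s \near t, -2 <= s <= 2.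
Proof.
move=> t2; have tI : t \in `]-2, 2[ by rewrite in_itv.
apply: filterS (near_in_itvoo tI) => s; rewrite in_itv /= => /andP[s1 s2].
by rewrite !ltW.
Qed.

Lemma clamp_in t : -2 <= clamp t <= 2.
Proof. by rewrite /clamp; case: (ltP t (-2)); case: (ltP 2 t); lra. Qed.

Lemma clampE t : -2 <= t <= 2 -> clamp t = t.
Proof. by rewrite /clamp; case: (ltP t (-2)); case: (ltP 2 t); lra. Qed.

Lemma clamp_lip s t : `|clamp s - clamp t| <= `|s - t|.
Proof.
wlog st : s t / s <= t.
  by move=> wl; have [|/ltW] := leP s t; [exact: wl|rewrite distrC (distrC s); exact: wl].
rewrite distrC (distrC s) (ger0_norm (x := t - s)) ?subr_ge0 // ger0_norm.
  by rewrite /clamp; case: (ltP s (-2)); case: (ltP 2 s); case: (ltP t (-2)); case: (ltP 2 t); lra.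
by rewrite /clamp; case: (ltP s (-2)); case: (ltP 2 s); case: (ltP t (-2)); case: (ltP 2 t); lra.
Qed.

Lemma lipschitz_continuous (V W : normedModType R) (f : V -> W) K :
  (forall x y, `|f y - f x| <= K * `|y - x|) -> continuous f.
Proof.
move=> fK x; apply/cvgrPdist_le => e e0.
have K0 : 0 < `|K| + 1 by rewrite ltr_wpDl.
have d0 : 0 < e / (`|K| + 1) by rewrite divr_gt0.
apply/nbhs_normP; exists (e / (`|K| + 1)) => // y /= xy.
apply: le_trans (fK y x) _; apply: le_trans (_ : (`|K| + 1) * `|x - y| <= _).
  by apply: ler_wpM2r => //; apply: le_trans (ler_norm _) _; rewrite lerDl.
by rewrite mulrC -ler_pdivlMr // ltW.
Qed.

Section integral_operator.
Variables (m : nat) (f : 'rV[R]_m -> 'rV[R]_m) (y0 : 'rV[R]_m) (B L : R).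
Hypotheses (B0 : 0 <= B) (L0 : 0 <= L) (L4 : L <= 4^-1).
Hypothesis fB : forall y, `|f y| <= B.
Hypothesis fL : forall x y, `|f y - f x| <= L * `|y - x|.

(** The lower limit [-3] lies to the left of [[-2, 2]], so that the integral has a two-sided
    derivative at every time of that interval. *)
Let prim (g : R -> 'rV[R]_m) (t : R) : 'rV[R]_m :=
  \row_i (\int[@lebesgue_measure R]_(s in `[-3, t]) (f (g s) 0 i)).

Let is_derive_prim g (t : R) : continuous g -> -3 < t -> is_derive t 1 (prim g) (f (g t)).
Proof.
move=> cg t3; apply: is_derive_row => i.
have ch : continuous (fun s : R => f (g s) 0 i).
  move=> s; apply: (@continuous_comp _ _ _ (fun s => f (g s)) (fun v : 'rV[R]_m => v 0 i)).
    by apply: continuous_comp; [exact: cg|exact: lipschitz_continuous fL _].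
  exact: coord_continuous.
have -> : (fun s => prim g s 0 i) =
    (fun t => \int[@lebesgue_measure R]_(s in `[-3, t]) (f (g s) 0 i))%R.
  by apply/funext => s; rewrite mxE.
exact: is_derive_integral.
Qed.

(** The Picard operator, sending [g] to [y0] plus the integral of [f (g s)] from 0 to [t], with the
    time stopped at the ends of [[-2, 2]]. *)
Let P (g : R -> 'rV[R]_m) (t : R) : 'rV[R]_m := y0 + (prim g (clamp t) - prim g 0).

Let in3 (t : R) : -2 <= t <= 2 -> -3 < t.
Proof. by move=> /andP[t1 _]; lra. Qed.

Let P0 g : P g 0 = y0.
Proof. by rewrite /P clampE ?subrr ?addr0 //; lra. Qed.

Let P_lip g s t : continuous g -> `|P g t - P g s| <= B * `|t - s|.
Proof.
move=> cg; have -> : P g t - P g s = prim g (clamp t) - prim g (clamp s).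
  by rewrite /P addrBB opprB subrKA.
apply: le_trans (_ : B * `|clamp t - clamp s| <= _); last first.
  by apply: ler_wpM2l => //; exact: clamp_lip.
apply: (@mean_value_sym _ (prim g) (f \o g) 2) => [//|x x2|x _||].
- by apply: is_derive_prim => //; exact: in3.
- exact: fB.
- exact: clamp_in.
- exact: clamp_in.
Qed.

Let P_derive g (t : R) : continuous g -> -2 < t < 2 -> is_derive t 1 (P g) (f (g t)).
Proof.
move=> cg t2; have t2' : -2 <= t <= 2 by case/andP: t2 => /ltW -> /ltW ->.
have E : \forall s \near t, y0 + (prim g s - prim g 0) = P g s.
  by apply: filterS (near_time t2) => s s2; rewrite /P clampE.
apply: (near_eq_is_derive E).
have := is_deriveD (is_derive_cst (y0 - prim g 0) t (1 : R)) (is_derive_prim cg (in3 t2')).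
rewrite add0r; congr is_derive; apply/funext => s.
by rewrite !fctE /= addrAC addrA.
Qed.

(** Times in [[-2, 2]] are at distance at most 2 from 0, and [2 L <= 1/2]. *)
Let P_contract (g h : R -> 'rV[R]_m) (e : R) : continuous g -> continuous h ->
  (forall s, -2 <= s <= 2 -> `|g s - h s| <= e) ->
  forall t, -2 <= t <= 2 -> `|P g t - P h t| <= e / 2.
Proof.
move=> cg ch ghe t t2.
have e0 : 0 <= e by apply: le_trans (normr_ge0 _) (ghe 0 _); lra.
have -> : P g t - P h t = (prim g t - prim h t) - (prim g 0 - prim h 0).
  by rewrite /P clampE // addrBB !opprD !opprK addrACA.
apply: le_trans (_ : L * e * `|t - 0| <= _).
  apply: (@mean_value_sym _ (prim g - prim h) (fun s => f (g s) - f (h s)) 2) => [|s s2|s s2||//].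
  - by rewrite mulr_ge0.
  - by apply: is_deriveB; apply: is_derive_prim => //; exact: in3.
  - by apply: le_trans (fL _ _) _; apply: ler_wpM2l => //; exact: ghe.
  - lra.
rewrite subr0; have t2n : `|t| <= 2 by rewrite ler_norml; lra.
apply: le_trans (_ : L * e * 2 <= _); first by apply: ler_wpM2l => //; rewrite mulr_ge0.
by have : L * e <= 4^-1 * e by [apply: ler_wpM2r]; lra.
Qed.

Lemma picard : exists y : R -> 'rV[R]_m, y 0 = y0 /\
  forall t : R, -2 < t < 2 -> is_derive t 1 y (f (y t)).
Proof.
pose u n := iter n P (cst y0).
have cu n : continuous (u n).
  elim: n => [|n IH]; first exact: cst_continuous.
  by apply: (@lipschitz_continuous _ _ _ B) => s t; exact: P_lip.
have uS n t : -2 <= t <= 2 -> `|u n.+1 t - u n t| <= 2 * B / 2 ^+ n.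
  elim: n t => [|n IH] t t2.
    rewrite expr0 divr1 /= -[X in _ - X](P0 (cst y0)).
    apply: le_trans (P_lip _ _ (cu 0)) _; rewrite subr0 mulrC; apply: ler_wpM2r => //.
    by rewrite ler_norml; lra.
  rewrite exprSr invfM mulrA; apply: (P_contract (cu n.+1) (cu n)) => // s s2; exact: IH.
have /choice[y yE] t : exists l : 'rV[R]_m, forall n, `|l - u n (clamp t)| <= 2 * (2 * B) / 2 ^+ n.
  have /choice[l hl] i : exists l, forall n, `|l - u n (clamp t) 0 i| <= 2 * (2 * B) / 2 ^+ n.
    apply: geometric_limit => n; apply: le_trans (uS n _ (clamp_in t)).
    by rewrite -rVNE -rVDE; exact: coord_le_norm.
  exists (\row_i l i) => n; apply: rV_norm_le => [|i]; last by rewrite !rVE mxE.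
  by rewrite divr_ge0 ?exprn_ge0 // !mulr_ge0.
set D := 2 * (2 * B) in yE.
have yu n t : -2 <= t <= 2 -> `|y t - u n t| <= D / 2 ^+ n.
  by move=> t2; have := yE t n; rewrite clampE.
(* All iterates have Lipschitz constant [B], and this bound passes to the limit; continuity is
   needed to apply [P] to [y]. *)
have cy : continuous y.
  apply: (@lipschitz_continuous _ _ _ B) => s t; apply/ler_addgt0Pr => e e0.
  have [n hn] := pow2_small (2 * D) e0.
  have uL : `|u n (clamp t) - u n (clamp s)| <= B * `|t - s|.
    apply: le_trans (_ : B * `|clamp t - clamp s| <= _); last first.
      by apply: ler_wpM2l => //; exact: clamp_lip.
    case: n {hn} => [|n]; first by rewrite /= subrr normr0 mulr_ge0.
    exact: P_lip.
  have -> : y t - y s = (u n (clamp t) - u n (clamp s)) +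
      ((y t - u n (clamp t)) - (y s - u n (clamp s))).
    by rewrite opprB [RHS]addrC addrAC !subrKA.
  apply: le_trans (ler_normD _ _) _; apply: lerD => //; apply: le_trans (ler_normB _ _) _.
  by apply: le_trans (lerD (yE t n) (yE s n)) _; lra.
(* [y] is compared with [u n.+1 = P (u n)], which is close to [P y] because [P] is a contraction. *)
have yP t : -2 <= t <= 2 -> y t = P y t.
  move=> t2; apply/eqP; rewrite -subr_eq0 -normr_le0; apply/ler_addgt0Pr => e e0.
  have [n hn] := pow2_small D e0; rewrite add0r.
  have -> : y t - P y t = (y t - u n.+1 t) + (u n.+1 t - P y t) by rewrite addrA subrK.
  apply: le_trans (ler_normD _ _) _; apply: le_trans (lerD (yu n.+1 t t2) _) _.
    rewrite distrC; apply: (P_contract cy (cu n) (e := D / 2 ^+ n)) t2 => s s2; exact: yu.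
  by rewrite exprSr invfM mulrA; lra.
exists y; split=> [|t t2]; first by rewrite yP ?P0 //; lra.
apply: near_eq_is_derive (P_derive cy t2).
by apply: filterS (near_time t2) => s s2; rewrite -yP.
Qed.

End integral_operator.
End picard.

(** * Differentiability of the flow in the coefficients of the frame *)

Section flow.
Context {R : realType}.

(** For [L <= 1/4] on an interval of length 1 no exponential appears: the maximum [N] of [|w - y|]
    satisfies [N <= e + L N <= e + N/4]. *)
Lemma gronwall_small m (f : 'rV[R]_m -> 'rV[R]_m) (L : R) (w dw y : R -> 'rV[R]_m) (e : R) :
  0 <= L -> L <= 4^-1 -> (forall x z, `|f z - f x| <= L * `|z - x|) ->
  (forall t : R, 0 <= t <= 1 -> is_derive t 1 w (dw t)) ->
  (forall t : R, 0 <= t <= 1 -> is_derive t 1 y (f (y t))) ->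
  (forall t, 0 <= t <= 1 -> `|dw t - f (w t)| <= e) -> w 0 = y 0 ->
  forall t, 0 <= t <= 1 -> `|w t - y t| <= 2 * e.
Proof.
move=> L0 L4 fL dW dY we wy0.
have dd (t : R) : 0 <= t <= 1 -> is_derive t 1 (w - y) (dw t - f (y t)).
  by move=> t01; apply: is_deriveB; [exact: dW|exact: dY].
have cN : {within `[0, 1], continuous (fun t : R => `|(w - y) t|)}.
  apply: continuous_in_subspaceT => t /set_mem /=; rewrite in_itv /= => t01.
  apply: (@continuous_comp _ _ _ (w - y)); last exact: norm_continuous.
  have [d _] := dd t t01.
  by apply/differentiable_continuous/derivable1_diffP.
have [s s01 sm] := EVT_max ler01 cN; rewrite in_itv /= in s01.
set N := `|(w - y) s| in sm.
have NM t : 0 <= t <= 1 -> `|w t - y t| <= N by move=> t01; apply: sm; rewrite in_itv.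
have e0 : 0 <= e by apply: le_trans (normr_ge0 _) (we 0 _); rewrite lexx ler01.
have NL : N <= e + L * N.
  have K0 : 0 <= e + L * N by rewrite addr_ge0 // mulr_ge0 // normr_ge0.
  case/andP: s01 => s0 s1.
  have := @mean_value_rV_le _ _ (w - y) (fun t => dw t - f (y t)) 0 s (e + L * N) s0 K0.
  have d0 : (w - y) 0 = 0 by rewrite -[LHS]/(w 0 - y 0) wy0 subrr.
  rewrite d0 !subr0.
  move=> h; have {}h : N <= (e + L * N) * s.
    apply: h => t /andP[t0 ts]; have t01 : 0 <= t <= 1 by rewrite t0 (le_trans ts).
      exact: dd.
    rewrite -(subrKA (f (w t))); apply: le_trans (ler_normD _ _) _; apply: lerD; first exact: we.
    by apply: le_trans (fL _ _) _; apply: ler_wpM2l => //; exact: NM.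
  by apply: le_trans h _; rewrite ler_piMr.
have N4 : L * N <= 4^-1 * N by apply: ler_wpM2r => //; exact: normr_ge0.
by move=> t /NM; lra.
Qed.

Lemma is_derive_comp_rV m (g : 'rV[R]_m -> R) (y : R -> 'rV[R]_m) (t : R) (v : 'rV[R]_m) :
  differentiable g (y t) -> is_derive t 1 y v -> is_derive t 1 (g \o y) ('D_v g (y t)).
Proof.
move=> dg [dy yv]; have dy' : differentiable y t by apply/derivable1_diffP.
apply: DeriveDef; first by apply/derivable1_diffP; exact: differentiable_comp.
rewrite deriveE; last exact: differentiable_comp.
by rewrite diff_comp //= -(deriveE _ dy') yv -deriveE.
Qed.

Variables (r m : nat) (Z : 'I_r -> 'rV[R]_m -> 'rV[R]_m) (y0 : 'rV[R]_m) (rho B L : R).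
Hypotheses (rho0 : 0 < rho) (B0 : 0 <= B) (L0 : 0 <= L).
Hypothesis Zs : forall a i, smooth_on setT (fun y => Z a y 0 i).
Hypothesis ZB : forall a y, `|Z a y| <= B.
Hypothesis ZL : forall a x y, `|Z a y - Z a x| <= L * `|y - x|.
Hypothesis ZC : forall y a b i, cball y0 rho y ->
  'D_(Z a y) (fun x => Z b x 0 i) y = 'D_(Z b y) (fun x => Z a x 0 i) y.

Definition frame_comb (u : 'rV[R]_r) (y : 'rV[R]_m) : 'rV[R]_m := \sum_a u 0 a *: Z a y.
Local Notation V := frame_comb.

Lemma frame_comb_coord u y i : V u y 0 i = \sum_a u 0 a * Z a y 0 i.
Proof. by rewrite /V summxE; apply: eq_bigr => a _; rewrite rVZE. Qed.

Lemma sum_coord_le (u : 'rV[R]_r) n (F : 'I_r -> 'rV[R]_n) (K : R) : 0 <= K ->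
  (forall a, `|F a| <= K) -> `|\sum_a u 0 a *: F a| <= r%:R * `|u| * K.
Proof.
move=> K0 FK; apply: le_trans (ler_norm_sum _ _ _) _.
apply: le_trans (_ : \sum_(a < r) `|u| * K <= _).
  by apply: ler_sum => a _; rewrite normrZ ler_pM // coord_le_norm.
by rewrite sumr_const card_ord -mulrA mulr_natl.
Qed.

Lemma frame_comb_le u y : `|V u y| <= r%:R * `|u| * B.
Proof. by apply: sum_coord_le => // a; exact: ZB. Qed.

Lemma frame_comb_lip u x y : `|V u y - V u x| <= r%:R * `|u| * L * `|y - x|.
Proof.
rewrite /V -sumrB -[leRHS]mulrA; under eq_bigr do rewrite -scalerBr.
by apply: sum_coord_le => [|a]; rewrite ?mulr_ge0.
Qed.

Lemma frame_combD u v y : V (u + v) y = V u y + V v y.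
Proof. by rewrite /V -big_split; apply: eq_bigr => a _; rewrite rVDE scalerDl. Qed.

Lemma frame_comb_diff u y i : differentiable (fun x => V u x 0 i) y /\
  forall v, 'D_v (fun x => V u x 0 i) y = \sum_a u 0 a * 'D_v (fun x => Z a x 0 i) y.
Proof.
have -> : (fun x => V u x 0 i) = \sum_a (u 0 a *: (fun x => Z a x 0 i)).
  by apply/funext => x; rewrite fct_sumE frame_comb_coord.
have d a : differentiable (fun x => Z a x 0 i) y by exact: smooth_differentiable (Zs a i) _.
split; first by apply: differentiable_sum => a; exact: differentiableZ.
move=> v; rewrite derive_sum; last by move=> a; apply: derivableZ; exact: diff_derivable.
by apply: eq_bigr => a _; rewrite deriveZ //; exact: diff_derivable.
Qed.

Lemma frame_comb_comm u v y i : cball y0 rho y ->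
  'D_(V u y) (fun x => V v x 0 i) y = 'D_(V v y) (fun x => V u x 0 i) y.
Proof.
move=> yr; have lin a w : 'D_(V w y) (fun x => Z a x 0 i) y =
    \sum_b w 0 b * 'D_(Z b y) (fun x => Z a x 0 i) y.
  have d : differentiable (fun x => Z a x 0 i) y by exact: smooth_differentiable (Zs a i) _.
  rewrite deriveE // /V linear_sum; apply: eq_bigr => b _.
  by rewrite linearZ /= -deriveE.
rewrite !(frame_comb_diff _ _ _).2; under eq_bigr do rewrite lin mulr_sumr.
under [RHS]eq_bigr do rewrite lin mulr_sumr.
rewrite exchange_big; apply: eq_bigr => a _; apply: eq_bigr => b _.
by rewrite mulrCA ZC.
Qed.

(** The first bound is the Lipschitz constant required by [picard] and [gronwall_small] for
    [|u| <= e]. The second says [r e B <= rho/8]: solutions stay within [rho/8] of [y0], and a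
    further displacement by [t *: V h] with [|h| <= 2 e] adds at most [rho/4], so that commutation
    is available throughout. *)
Lemma flow_radius : exists2 e : R, 0 < e &
  r%:R * e * L <= 4^-1 /\ 2 * (r%:R * (2 * e) * B) <= rho / 2.
Proof.
have rL : 0 <= r%:R * L by rewrite mulr_ge0.
have rB : 0 <= r%:R * B by rewrite mulr_ge0.
exists (Num.min (4^-1 / (r%:R * L + 1)) (rho / 8 / (r%:R * B + 1))).
  by rewrite lt_min !divr_gt0 // ltr_wpDl.
set e := Num.min _ _.
have e1 : e * (r%:R * L + 1) <= 4^-1 by rewrite -ler_pdivlMr ?ltr_wpDl // ge_min lexx.
have e2 : e * (r%:R * B + 1) <= rho / 8 by rewrite -ler_pdivlMr ?ltr_wpDl // ge_min lexx orbT.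
have e0 : 0 <= e by rewrite le_min !divr_ge0 // ?addr_ge0 // ltW.
split; first by move: e1; rewrite mulrDr mulrCA mulrA => h; lra.
have -> : 2 * (r%:R * (2 * e) * B) = 4 * (e * (r%:R * B)) by ring.
by move: e2; rewrite mulrDr => h; lra.
Qed.

(* [w t = y u t + t *: V h (y u t)] is compared with the solution for [u + h]: their
   equations differ by [O(|h|^2)] as [D_(V u) (V h) = D_(V h) (V u)]. *)
Lemma commuting_flow : exists2 e : R, 0 < e & exists F : 'rV[R]_r -> 'rV[R]_m,
  F 0 = y0 /\ forall u, `|u| < e -> `|F u - y0| < rho /\
  forall i, differentiable (fun v => F v 0 i) u /\
    forall h, 'D_h (fun v => F v 0 i) u = V h (F u) 0 i.
Proof.
have [e e0 [eL eB]] := flow_radius; exists e => //.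
have VL (u : 'rV[R]_r) : `|u| <= e -> 0 <= r%:R * `|u| * L /\ r%:R * `|u| * L <= 4^-1.
  move=> ue; split; first by rewrite !mulr_ge0.
  by apply: le_trans eL; apply: ler_wpM2r => //; apply: ler_wpM2l.
have /choice[y yP] (u : 'rV[R]_r) : exists y : R -> 'rV[R]_m, `|u| <= e -> y 0 = y0 /\
    forall t : R, -2 < t < 2 -> is_derive t 1 y (V u (y t)).
  have [ue|ue] := leP `|u| e; last by exists (cst 0).
  have [l0 l4] := VL u ue.
  have hB : 0 <= r%:R * `|u| * B by rewrite !mulr_ge0.
  have [y yE] := picard y0 hB l0 l4 (frame_comb_le u) (frame_comb_lip u).
  by exists y.
have y0E u : `|u| <= e -> y u 0 = y0 by move=> /yP[].
have yD u : `|u| <= e -> forall t : R, 0 <= t <= 1 -> is_derive t 1 (y u) (V u (y u t)).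
  by move=> /yP[_ yD] t /andP[t0 t1]; apply: yD; lra.
have yB u t : `|u| <= e -> 0 <= t <= 1 -> `|y u t - y0| <= r%:R * `|u| * B.
  move=> ue /andP[t0 t1]; rewrite -(y0E u ue).
  apply: le_trans (_ : r%:R * `|u| * B * (t - 0) <= _); last first.
    by rewrite subr0 ler_piMr // !mulr_ge0.
  apply: (@mean_value_rV_le _ _ (y u) (fun t => V u (y u t))) => //.
  - by rewrite !mulr_ge0.
  - by move=> s /andP[s0 st]; apply: yD => //; rewrite s0 (le_trans st).
  - by move=> s _; exact: frame_comb_le.
have rB k (v : 'rV[R]_r) : `|v| <= k * e -> r%:R * `|v| * B <= k * (r%:R * e * B).
  move=> vk; have -> : k * (r%:R * e * B) = r%:R * (k * e) * B by ring.
  by apply: ler_wpM2r => //; apply: ler_wpM2l.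
have reB : 0 <= r%:R * e * B by rewrite !mulr_ge0 // ltW.
have yR u t : `|u| <= e -> 0 <= t <= 1 -> `|y u t - y0| <= rho / 8.
  move=> ue t01; apply: le_trans (yB u t ue t01) _.
  apply: le_trans (rB 1 u _) _; first by rewrite mul1r.
  by lra.
have /choice[K hK] (ai : 'I_r * 'I_m) : exists K, 0 <= K /\ forall x h,
    cball y0 rho x -> cball y0 rho (x + h) ->
    `|Z ai.1 (x + h) 0 ai.2 - Z ai.1 x 0 ai.2 - 'D_h (fun x => Z ai.1 x 0 ai.2) x| <= K * `|h| ^+ 2.
  have [K K0 KP] := C2_taylor (c := y0) (e := rho) (Zs ai.1 ai.2 2) (@subsetT _ _).
  by exists K.
pose KK := \sum_ai K ai.
have KK0 : 0 <= KK by apply: sumr_ge0 => ai _; case: (hK ai).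
have KKP a i : K (a, i) <= KK.
  by rewrite /KK (bigD1 (a, i)) //= lerDl; apply: sumr_ge0 => ai _; case: (hK ai).
(* The first summand bounds the Taylor remainder of [V u] for the displacement [t *: V h z], the
   second the variation of [V h] over that displacement. *)
pose C := r%:R * e * (KK * (r%:R * B) ^+ 2) + r%:R * L * (r%:R * B).
have main u h : `|u| <= e -> `|u + h| <= e -> `|h| <= 2 * e ->
    `|y (u + h) 1 - y u 1 - V h (y u 1)| <= 2 * (C * `|h| ^+ 2).
  move=> ue uhe he; have [l0 l4] := VL _ uhe.
  pose w t := y u t + t *: V h (y u t).
  pose dw t : 'rV[R]_m := V u (y u t) + \row_i (V h (y u t) 0 i
     + t * 'D_(V u (y u t)) (fun x => V h x 0 i) (y u t)).
  have wD (t : R) : 0 <= t <= 1 -> is_derive t 1 w (dw t).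
    move=> t01; apply: is_deriveD; first exact: yD.
    apply: is_derive_row => i; rewrite mxE.
    have -> : (fun s => (s *: V h (y u s)) 0 i) = id * ((fun x => V h x 0 i) \o y u).
      by apply/funext => s; rewrite rVZE.
    have D1 := is_derive_comp_rV (frame_comb_diff h (y u t) i).1 (yD u ue t t01).
    have [d dE] := is_deriveM (is_derive_id t (1 : R)) D1; apply: DeriveDef; first exact: d.
    by rewrite dE addrC [X in X + _]mulr1.
  have ww : w 0 = y (u + h) 0 by rewrite /w scale0r addr0 !y0E.
  have := gronwall_small l0 l4 (frame_comb_lip (u + h)) wD (yD _ uhe) _ ww (t := 1).
  rewrite /w scale1r distrC opprD addrA; apply; last by rewrite ler01 lexx.
  move=> t t01; set z := y u t; set hv := t *: V h z.
  have hvB : `|hv| <= r%:R * B * `|h|.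
    case/andP: t01 => t0 t1; rewrite normrZ ger0_norm // mulrAC.
    by apply: le_trans (frame_comb_le h z); rewrite ler_piMl.
  have zr : cball y0 rho z.
    by rewrite /closed_ball_ /= distrC; apply: le_trans (yR u t ue t01) _; lra.
  have zhr : cball y0 rho (z + hv).
    rewrite /closed_ball_ /= distrC addrAC; apply: le_trans (ler_normD _ _) _.
    have := yR u t ue t01; have := rB 2 h he; rewrite -/z.
    by move: hvB; rewrite [r%:R * B * _]mulrAC => h1 h2 h3; lra.
  apply: rV_norm_le => [|i].
    by rewrite mulr_ge0 // ?exprn_ge0 // addr_ge0 // !mulr_ge0 ?exprn_ge0 ?mulr_ge0 // ltW.
  have [dV DV] := frame_comb_diff u z i.
  have tD : t * 'D_(V u z) (fun x => V h x 0 i) z = 'D_hv (fun x => V u x 0 i) z.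
    by rewrite frame_comb_comm // (deriveE _ dV) (deriveE _ dV) linearZ.
  have -> : (dw t - V (u + h) (z + hv)) 0 i =
      - (V u (z + hv) 0 i - V u z 0 i - 'D_hv (fun x => V u x 0 i) z)
      - (V h (z + hv) - V h z) 0 i.
    by rewrite frame_combD !rVE mxE -/z tD; ring.
  apply: le_trans (ler_normB _ _) _; rewrite normrN mulrDl; apply: lerD.
    rewrite DV !frame_comb_coord -!sumrB.
    apply: le_trans (_ : r%:R * e * (KK * `|hv| ^+ 2) <= _); last first.
      rewrite -[leRHS]mulrA; apply: ler_wpM2l; first by rewrite mulr_ge0 // ltW.
      rewrite -mulrA -exprMn; apply: ler_wpM2l => //.
      by rewrite lerXn2r // nnegrE ?mulr_ge0 // ?mulr_ge0.
    apply: le_trans (ler_norm_sum _ _ _) _.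
    apply: le_trans (_ : \sum_(a < r) e * (KK * `|hv| ^+ 2) <= _); last first.
      by rewrite sumr_const card_ord -mulrA mulr_natl.
    apply: ler_sum => a _; rewrite -!mulrBr normrM; apply: ler_pM => //.
      exact: le_trans (coord_le_norm _ _) ue.
    apply: le_trans ((hK (a, i)).2 z hv zr zhr) _; apply: ler_wpM2r; first exact: exprn_ge0.
    exact: KKP.
  apply: le_trans (coord_le_norm _ _) _; apply: le_trans (frame_comb_lip _ _ _) _.
  have -> : z + hv - z = hv by rewrite addrC addKr.
  have -> : r%:R * L * (r%:R * B) * `|h| ^+ 2 = r%:R * `|h| * L * (r%:R * B * `|h|).
    by rewrite expr2; ring.
  by apply: ler_wpM2l => //; rewrite !mulr_ge0.
exists (fun u => y u 1); split.
  have z0 : `|0 : 'rV[R]_r| <= e by rewrite normr0 ltW.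
  have := yB 0 1 z0; rewrite normr0 mulr0 mul0r ler01 lexx => /(_ isT).
  by rewrite normr_le0 subr_eq0 => /eqP.
move=> u ue; split.
  have u1 := yR u 1 (ltW ue); apply: le_lt_trans (u1 _) _; first by rewrite ler01 lexx.
  by rewrite ltr_pdivrMr // ltr_pMr // ltr1n.
move=> i; have [|df dE] := @quadratic_differentiable R r (fun v => y v 1 0 i) u
    (fun a => Z a (y u 1) 0 i) (2 * C).
  have small : \forall h \near (0 : 'rV[R]_r), `|h| < e - `|u|.
    apply/nbhs_normP; exists (e - `|u|); first by rewrite /= subr_gt0.
    by move=> h; rewrite /= sub0r normrN.
  apply: filterS small => h hh; rewrite -frame_comb_coord -mulrA.
  have hu : `|u + h| <= e by apply: le_trans (ler_normD _ _) _; rewrite addrC -lerBrDr ltW.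
  have h2 : `|h| <= 2 * e by have := normr_ge0 u; move: hh e0; lra.
  apply: le_trans (main u h (ltW ue) hu h2).
  by apply: le_trans (coord_le_norm _ i); rewrite !rVE.
by split=> // h; rewrite dE frame_comb_coord.
Qed.

End flow.

(** * Smooth functions and vector fields *)

Section fields.
Context {R : realType} {m : nat} (M : manifold R m).
Local Notation vf := (vector_field M).
Implicit Types (X Y Z : vf) (f h : Cinf M).

Lemma Cinf_ext f h : (forall p, f p = h p) -> f = h.
Proof. by move=> fh; apply/val_inj/funext. Qed.

Lemma vf_ext X Y : (forall f, X f = Y f) -> X = Y.
Proof. by move=> XY; apply/val_inj/funext. Qed.

Lemma vf_addE X Y f : (X + Y) f = X f + Y f. Proof. by []. Qed.
Lemma vf_oppE X f : (- X) f = - X f. Proof. by []. Qed.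
Lemma vf_scaleE h X f : (h *: X) f = h * X f. Proof. by []. Qed.

Lemma vf_sumE n (u : 'I_n -> Cinf M) (F : 'I_n -> vf) f :
  (\sum_i u i *: F i) f = \sum_i u i * F i f.
Proof. by elim/big_ind2 : _ => // X X' Y Y' <- <-. Qed.

Lemma vfD X f h : X (f + h) = X f + X h.
Proof. by have := (vfP X).1 1 f h; rewrite !scale1r. Qed.

Lemma vf0 X : X 0 = 0.
Proof. by apply: (@addrI _ (X 0)); rewrite -vfD !addr0. Qed.

Lemma vfN X f : X (- f) = - X f.
Proof. by apply/eqP; rewrite -subr_eq0 opprK -vfD addNr vf0. Qed.

Lemma vfB X f h : X (f - h) = X f - X h.
Proof. by rewrite vfD vfN. Qed.

Lemma vfM X f h : X (f * h) = f * X h + h * X f.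
Proof. exact: (vfP X).2. Qed.

Lemma vf1 X : X 1 = 0.
Proof. by have := vfM X 1 1; rewrite !mul1r -[LHS]addr0 => /addrI. Qed.

Lemma vf_cst X a : X (cst_Cinf M a) = 0.
Proof.
have -> : cst_Cinf M a = a *: (1 : Cinf M) + 0.
  by apply: Cinf_ext => p; rewrite addr0 scale_CinfE mulr1.
by rewrite (vfP X).1 vf1 vf0 scaler0 addr0.
Qed.

Lemma bracketE X Y f : bracket X Y f = X (Y f) - Y (X f). Proof. by []. Qed.

Lemma bracketC X Y : bracket X Y = - bracket Y X.
Proof. by apply: vf_ext => f; rewrite vf_oppE !bracketE opprB. Qed.

Lemma bracketxx X : bracket X X = 0.
Proof. by apply: vf_ext => f; rewrite bracketE subrr. Qed.

Lemma bracketDr X Y Z : bracket X (Y + Z) = bracket X Y + bracket X Z.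
Proof. by apply: vf_ext => f; rewrite vf_addE !bracketE !vf_addE vfD; ring. Qed.

Lemma bracketNr X Y : bracket X (- Y) = - bracket X Y.
Proof. by apply: vf_ext => f; rewrite vf_oppE !bracketE !vf_oppE vfN; ring. Qed.

Lemma bracketZr X Y h : bracket X (h *: Y) = X h *: Y + h *: bracket X Y.
Proof.
by apply: vf_ext => f; rewrite vf_addE !vf_scaleE !bracketE vf_scaleE vfM vf_scaleE; ring.
Qed.

Lemma jacobi X Y Z :
  bracket X (bracket Y Z) = bracket (bracket X Y) Z + bracket Y (bracket X Z).
Proof. by apply: vf_ext => f; rewrite vf_addE !bracketE !vfB; ring. Qed.

Lemma cst_CinfM_inj (a : R) f : a != 0 -> cst_Cinf M a * f = 0 -> f = 0.
Proof.
move=> a0; rewrite -scale_CinfE => /(congr1 ( *:%R a^-1)).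
by rewrite scalerA mulVf // scale1r scaler0.
Qed.

Lemma sqr_Cinf_eq0 f : f * f = 0 -> f = 0.
Proof.
move=> ff; apply: Cinf_ext => p; have /eqP : f p * f p = 0.
  by rewrite -[f p * f p]/((f * f) p) ff.
by rewrite mulf_eq0 orbb => /eqP.
Qed.

End fields.

(** * Algebra of the metric *)

Section metric.
Context {R : realType} {m : nat} {M : manifold R m} (g : riemannian_metric M).
Local Notation vf := (vector_field M).
Implicit Types (X Y Z : vf) (f h : Cinf M).

Lemma metric_Dl X Y Z : g (X + Y) Z = g X Z + g Y Z.
Proof. by have := metric_lin g 1 X Y Z; rewrite scale1r mul1r. Qed.

Lemma metric_0l Z : g 0 Z = 0.
Proof. by apply: (@addrI _ (g 0 Z)); rewrite -metric_Dl !addr0. Qed.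

Lemma metric_Zl f X Z : g (f *: X) Z = f * g X Z.
Proof. by rewrite -[f *: X]addr0 metric_lin metric_0l addr0. Qed.

Lemma metric_Nl X Z : g (- X) Z = - g X Z.
Proof. by rewrite -scaleN1r metric_Zl mulN1r. Qed.

Lemma metric_Dr X Y Z : g Z (X + Y) = g Z X + g Z Y.
Proof. by rewrite !(Defs.metric_sym g Z) metric_Dl. Qed.

Lemma metric_Zr f X Z : g Z (f *: X) = f * g Z X.
Proof. by rewrite !(Defs.metric_sym g Z) metric_Zl. Qed.

Lemma metric_Nr X Z : g Z (- X) = - g Z X.
Proof. by rewrite !(Defs.metric_sym g Z) metric_Nl. Qed.

Lemma metric_nondeg X : (forall Y, g X Y = 0) -> X = 0.
Proof.
move=> X0; apply: vf_ext => f; apply: Cinf_ext => p.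
have /metric_def : g X X p = 0 by rewrite X0.
by move=> /(congr1 (fun v => v f)).
Qed.

Lemma metric_inj X Y : (forall Z, g X Z = g Y Z) -> X = Y.
Proof.
move=> XY; apply/eqP; rewrite -subr_eq0; apply/eqP/metric_nondeg => Z.
by rewrite metric_Dl metric_Nl XY subrr.
Qed.

Definition metricE := (metric_Dl, metric_Nl, metric_Zl, metric_Dr, metric_Nr, metric_Zr).

End metric.

(** * From functions in a chart to global smooth functions *)

Section charts.
Context {R : realType} {m : nat} {M : manifold R m}.
Implicit Types (c d : chart R m M) (p q : M) (f : Cinf M).

Lemma open_chart_preimage c (O : set M) : open O -> open (chart_cod c `&` chart_inv c @^-1` O).
Proof.
move=> oO; rewrite openE => x [cx Ox]; apply: filterI.
  by apply: open_nbhs_nbhs; split => //; exact: open_chart_cod.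
by apply: (chart_inv_cts cx); apply: open_nbhs_nbhs.
Qed.

Lemma open_chart_image c (O : set M) : open O -> open (c @` (chart_dom c `&` O)).
Proof.
move=> oO; have -> : c @` (chart_dom c `&` O) = chart_cod c `&` chart_inv c @^-1` O.
  apply/seteqP; split => [_ [p [cp Op] <-]|_ [[p cp <-]]] /=; last first.
    by rewrite chart_mapK // => Op; exists p.
  by split; [exists p|rewrite chart_mapK].
exact: open_chart_preimage.
Qed.

Lemma chart_cod_map c p : chart_dom c p -> chart_cod c (c p).
Proof. by move=> cp; exists p. Qed.

Lemma chart_invK c y : chart_cod c y -> chart_dom c (chart_inv c y) /\ c (chart_inv c y) = y.
Proof. by move=> [q cq <-]; rewrite chart_mapK. Qed.

Definition chart_ext c (u : 'rV[R]_m -> R) (p : M) : R :=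
  if `[<chart_dom c p>] then u (c p) else 0.

Lemma chart_extE c u p : chart_dom c p -> chart_ext c u p = u (c p).
Proof. by move=> cp; rewrite /chart_ext ifT //; exact/asboolP. Qed.

Lemma chart_extN c u p : ~ chart_dom c p -> chart_ext c u p = 0.
Proof. by move=> cp; rewrite /chart_ext ifF //; apply/asboolP. Qed.

Lemma chart_ext_smooth c u (C : set 'rV[R]_m) : atlas c -> compact C -> C `<=` chart_cod c ->
  smooth_on (chart_cod c) u -> (forall y, ~ C y -> u y = 0) ->
  chart_ext c u \in smooth_fun M.
Proof.
move=> ca cC Cc su u0; apply/asboolP => d da k; apply: Ck_local => _ [q dq <-].
have [cq|cq] := pselect (chart_dom c q).
  pose A := d @` (chart_dom d `&` chart_dom c).
  have oA : open A by apply: open_chart_image; exact: chart_dom_open.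
  exists A; split; first by exists q.
  have uE x : A x -> (u \o (c \o chart_inv d)) x = (chart_ext c u \o chart_inv d) x.
    by move=> [r [dr cr] <-] /=; rewrite chart_mapK // chart_extE.
  apply: (Ck_ext oA uE); apply: (Ck_comp oA _ (atlas_smooth da ca k) (su k)).
  by move=> _ [r [dr cr] <-] /=; rewrite chart_mapK //; exact: chart_cod_map.
have cK : closed (chart_inv c @` C).
  apply: (compact_closed (@manifold_hausdorff _ _ M)).
  apply: continuous_compact => //; apply: continuous_in_subspaceT => x /set_mem /Cc.
  exact: chart_inv_cts.
pose A := chart_cod d `&` chart_inv d @^-1` (~` (chart_inv c @` C)).
have oA : open A by apply: open_chart_preimage; exact: closed_openC.
exists A; split.
  split; first exact: chart_cod_map.
  by rewrite /= chart_mapK // => -[y /Cc /chart_invK[+ _] yq]; rewrite yq.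
apply: (Ck_ext oA (f := cst 0)) => [x [_ /= xK]|]; last exact: Ck_cst.
have [cx|cx] := pselect (chart_dom c (chart_inv d x)); last by rewrite chart_extN.
rewrite chart_extE // u0 // => Cx; apply: xK; exists (c (chart_inv d x)) => //.
by rewrite chart_mapK.
Qed.

Lemma chart_ball c p (U : set M) : chart_dom c p -> nbhs p U ->
  exists2 r : R, 0 < r & forall y, cball (c p) r y -> chart_cod c y /\ U (chart_inv c y).
Proof.
move=> cp; rewrite nbhsE => -[ O [oO Op] OU].
pose A := chart_cod c `&` chart_inv c @^-1` O.
have oA : open A by exact: open_chart_preimage.
have : nbhs (c p) A.
  apply: open_nbhs_nbhs; split => //; split; first exact: chart_cod_map.
  by rewrite /= chart_mapK.
move=> /nbhs_closedballP[r rA]; exists r%:num => // y yr.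
have [cy Oy] : A y.
  by apply: rA; rewrite closed_ballE.
by split=> //; exact: OU.
Qed.

Lemma near_chart c p (r : R) : chart_dom c p -> 0 < r ->
  \forall q \near p, chart_dom c q /\ cball (c p) r (c q).
Proof.
move=> cp r0; apply: filterI.
  by apply: open_nbhs_nbhs; split=> //; exact: chart_dom_open.
apply: (chart_map_cts cp); apply/nbhs_closedballP.
by exists (PosNum r0); rewrite closed_ballE.
Qed.

(** Smoothness is local, and the space is covered by [O] and the complement of the closed ball,
    where the product is 0. *)
Lemma smooth_bump_mul (O : set 'rV[R]_m) (a : 'rV[R]_m) (r : R) (u : 'rV[R]_m -> R) :
  open O -> 0 < r -> cball a r `<=` O -> smooth_on O u -> smooth_on setT (rV_bump a r * u).
Proof.
move=> oO r0 aO su k; apply: Ck_local => x _; have [Ox|Ox] := pselect (O x).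
  by exists O; split=> //; apply: (CkM oO) => //; exact: Ck_rV_bump.
have oC : open (~` cball a r) by apply: closed_openC; exact: closed_closed_ball_.
exists (~` cball a r); split; first by move=> /aO.
apply: (Ck_ext oC (f := cst 0)) => [y ay|]; last exact: Ck_cst.
by rewrite !fctE rV_bump0 // mul0r.
Qed.

Lemma Ck_subset (V W : normedModType R) k (U O : set V) (u : V -> W) :
  O `<=` U -> Ck k U u -> Ck k O u.
Proof.
move=> OU; elim: k u => [|k IH] u; first by move=> cu x /OU; exact: cu.
by move=> [du Du]; split=> [x /OU|v]; [exact: du|exact/IH/Du].
Qed.

Lemma bump_ext_smooth c (a : 'rV[R]_m) (r : R) u : atlas c -> 0 < r ->
  cball a r `<=` chart_cod c -> smooth_on (chart_cod c) u ->
  chart_ext c (rV_bump a r * u) \in smooth_fun M.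
Proof.
move=> ca r0 ac su; apply: (chart_ext_smooth ca (@compact_cball _ _ a r)) => //.
  move=> k; apply: (@Ck_subset _ _ _ setT) => //.
  exact: (smooth_bump_mul (open_chart_cod c)).
by move=> y ay; rewrite fctE rV_bump0 // mul0r.
Qed.

(** One radius serves all [u], so several functions can be extended with their values kept on the
    same ball. The factor 1/2 comes from [rV_bump1]. *)
Lemma local_extension c p (U : set M) : atlas c -> chart_dom c p -> nbhs p U ->
  exists2 r : R, 0 < r & cball (c p) r `<=` chart_cod c /\
  forall u, smooth_on (chart_cod c) u -> exists2 f : Cinf M,
    forall q, chart_dom c q -> cball (c p) (r / 2) (c q) -> f q = u (c q) &
    forall q, ~ U q -> f q = 0.
Proof.
move=> ca cp /(chart_ball cp)[r r0 rU]; exists r => //.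
have rc : cball (c p) r `<=` chart_cod c by move=> y /rU[].
split=> // u su; exists (MkCinf (bump_ext_smooth ca r0 rc su)) => q /=.
  by move=> cq qr; rewrite chart_extE // fctE rV_bump1 // mul1r.
move=> Uq; have [cq|cq] := pselect (chart_dom c q); last by rewrite chart_extN.
rewrite chart_extE // fctE rV_bump0 ?mul0r // => /rU[_].
by rewrite chart_mapK.
Qed.

Lemma bump_exists p (U : set M) : nbhs p U ->
  exists2 b : Cinf M, (\forall q \near p, b q = 1) & forall q, ~ U q -> b q = 0.
Proof.
move=> Up; have [c ca cp] := atlas_cover p.
have [r r0 [rc /(_ (cst 1))[k|f f1 f0]]] := local_extension ca cp Up.
  by apply: Ck_cst; exact: open_chart_cod.
exists f => //; have r20 : 0 < r / 2 by rewrite divr_gt0.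
by apply: filterS (near_chart cp r20) => q [cq rq]; rewrite f1.
Qed.

End charts.

(** * Tangent vectors as directional derivatives in a chart *)

Section tangent.
Context {R : realType} {m : nat} {M : manifold R m}.
Implicit Types (c d : chart R m M) (p q : M) (f h : Cinf M).

Section at_point.
Variables (p : M) (v : Cinf M -> R).
Hypothesis vp : tangent_space M p v.

Lemma tangentD f h : v (f + h) = v f + v h.
Proof. by have := vp.1 1 f h; rewrite scale1r mul1r. Qed.

Lemma tangent0 : v 0 = 0.
Proof. by apply: (@addrI _ (v 0)); rewrite -tangentD !addr0. Qed.

Lemma tangentN f : v (- f) = - v f.
Proof. by apply/eqP; rewrite -subr_eq0 opprK -tangentD addNr tangent0. Qed.

Lemma tangentZ a f : v (a *: f) = a * v f.
Proof. by have := vp.1 a f 0; rewrite addr0 tangent0 addr0. Qed.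

Lemma tangentM f h : v (f * h) = f p * v h + h p * v f.
Proof. exact: vp.2. Qed.

Lemma tangent1 : v 1 = 0.
Proof.
have := tangentM 1 1; rewrite mulr1 -[(1 : Cinf M) p]/(1 : R) !mul1r -[LHS]addr0.
by move=> /addrI.
Qed.

Lemma tangent_sum n (F : 'I_n -> Cinf M) : v (\sum_i F i) = \sum_i v (F i).
Proof. by elim/big_ind2 : _ => //; [exact: tangent0|move=> ? ? ? ? <- <-; exact: tangentD]. Qed.

(** Locality of derivations: take a bump function [b] vanishing where [f] does not. Then
    [b * f = 0], and the Leibniz rule at [p] leaves [v f]. *)
Lemma tangent_near0 f : (\forall q \near p, f q = 0) -> v f = 0.
Proof.
move=> f0; have [b b1 bN] := bump_exists f0.
have bf : b * f = 0.
  apply: Cinf_ext => q; rewrite -[(b * f) q]/(b q * f q).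
  by have [->|/bN->] := pselect (f q = 0); rewrite ?mulr0 ?mul0r.
have := tangentM b f; rewrite bf tangent0 (nbhs_singleton b1) (nbhs_singleton f0).
by rewrite mul1r mul0r addr0.
Qed.

Lemma tangent_near f h : (\forall q \near p, f q = h q) -> v f = v h.
Proof.
move=> fh; apply/eqP; rewrite -subr_eq0; apply/eqP.
rewrite -(tangent_near0 (f := f - h)).
  by rewrite tangentD tangentN.
by apply: filterS fh => q fq; rewrite -[LHS]/(f q - h q) fq subrr.
Qed.

(** By Hadamard's lemma [f = f p + \sum_i x i * H i] near [p], where the [x i] are the coordinates
    centred at [p]. As [v] kills constants and [x i p = 0], this gives
    [v f = \sum_i v (x i) * H i p], and [H i p] is the [i]-th partial derivative. *)
Lemma tangent_chart c : atlas c -> chart_dom c p ->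
  exists a : 'rV[R]_m, forall f, v f = 'D_a (f \o chart_inv c) (c p).
Proof.
move=> ca cp; have [r r0 [rc ext]] := local_extension ca cp filterT.
have r20 : 0 < r / 2 by rewrite divr_gt0.
have oc := open_chart_cod c.
have /choice[x xE] (i : 'I_m) : exists x : Cinf M, forall q, chart_dom c q ->
    cball (c p) (r / 2) (c q) -> x q = c q 0 i - c p 0 i.
  have [|x xE _] := ext ((fun y => y 0 i) + cst (- c p 0 i)); last by exists x.
  by move=> k; apply: (CkD oc); [exact: Ck_coordinate|exact: Ck_cst].
exists (\row_i v (x i)) => f.
have sf := smooth_funP (valP f) ca.
have [h sh [hE h0]] := hadamard (c p) (smooth_bump_mul oc r0 rc sf).
have /choice[H HE] (i : 'I_m) : exists H : Cinf M, forall q, chart_dom c q ->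
    cball (c p) (r / 2) (c q) -> H q = h i (c q).
  have [|H HE _] := ext (h i); last by exists H.
  by move=> k; exact: Ck_subset (sh i k).
have xp i : x i p = 0 by rewrite xE // ?subrr //; apply: cball_center; exact: ltW.
have -> : v f = v (f p *: (1 : Cinf M) + \sum_i x i * H i).
  apply: tangent_near; apply: filterS (near_chart cp r20) => q [cq rq].
  have := hE (c q); rewrite !fctE /= !chart_mapK // !rV_bump1 //; last first.
    by apply: cball_center; exact: ltW.
  rewrite !mul1r => ->; rewrite -[RHS]/(f p * 1 + (\sum_i x i * H i : Cinf M) q) mulr1.
  congr (_ + _); rewrite -[RHS]/(val (\sum_i x i * H i) q) raddf_sum fct_sumE.
  by apply: eq_bigr => i _; rewrite -[RHS]/(x i q * H i q) xE // HE.
rewrite tangentD tangentZ tangent1 mulr0 add0r tangent_sum.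
have dfi : differentiable (f \o chart_inv c) (c p).
  exact: smooth_differentiable sf (chart_cod_map cp).
rewrite derive_coord //; apply: eq_bigr => i _.
rewrite tangentM xp mul0r add0r mxE mulrC HE // ?h0; last by apply: cball_center; exact: ltW.
congr (_ * _); apply: near_eq_derive.
have : \forall y \near c p, cball (c p) (r / 2) y.
  by apply/nbhs_closedballP; exists (PosNum r20); rewrite closed_ballE.
by apply: filterS => y yr; rewrite fctE rV_bump1 // mul1r.
Qed.

End at_point.

Lemma value_at_tangent (X : vector_field M) p : tangent_space M p (value_at X p).
Proof.
have [l pr] := vfP X; split=> [a f h|f h]; first by rewrite /value_at l.
by rewrite /value_at pr.
Qed.

Lemma chart_tangent c p a : atlas c -> chart_dom c p ->
  tangent_space M p (fun f => 'D_a (f \o chart_inv c) (c p)).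
Proof.
move=> ca cp; have df f : derivable (f \o chart_inv c) (c p) a.
  apply: diff_derivable; apply: smooth_differentiable (chart_cod_map cp).
  exact: smooth_funP (valP f) ca.
split=> [k f h|f h].
  rewrite -[RHS]/(k *: 'D_a (f \o chart_inv c) (c p) + _) -deriveZ // -deriveD //.
  exact: derivableZ.
have := deriveM (df f) (df h); by rewrite /= chart_mapK // => <-.
Qed.

End tangent.

(** * Coordinate frames and tensoriality *)

Section local_frames.
Context {R : realType} {m : nat} {M : manifold R m}.
Implicit Types (c : chart R m M) (p q : M) (f h : Cinf M) (X Y : vector_field M).

Lemma near_cball (a : 'rV[R]_m) (r : R) : 0 < r -> \forall y \near a, cball a r y.
Proof. by move=> r0; apply/nbhs_closedballP; exists (PosNum r0); rewrite closed_ballE. Qed.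

Lemma cball_near (a y : 'rV[R]_m) (r : R) : `|y - a| < r -> \forall z \near y, cball a r z.
Proof.
move=> ya; have e0 : 0 < r - `|y - a| by rewrite subr_gt0.
apply: filterS (near_cball y e0) => z /cballC zy.
rewrite /closed_ball_ /= distrC -[z](subrK y) -addrA; apply: le_trans (ler_normD _ _) _.
by rewrite -lerBrDr.
Qed.

(** The global function [x i] is a coordinate only on a closed ball. The last clause asks for a
    strict inequality because a derivative at [c q] sees a whole neighbourhood. *)
Lemma local_coordinates c p : atlas c -> chart_dom c p ->
  exists2 r : R, 0 < r & cball (c p) r `<=` chart_cod c /\
  exists x : 'I_m -> Cinf M,
    (forall q i, chart_dom c q -> cball (c p) r (c q) -> x i q = c q 0 i) /\
    forall X f q, chart_dom c q -> `|c q - c p| < r ->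
      X f q = 'D_(\row_i X (x i) q) (f \o chart_inv c) (c q).
Proof.
move=> ca cp; have [r r0 [rc ext]] := local_extension ca cp filterT.
have r20 : 0 < r / 2 by rewrite divr_gt0.
exists (r / 2) => //; split.
  by move=> y yr; apply: rc; apply: le_trans yr _; rewrite ler_pdivrMr // ler_pMr // ler1n.
have /choice[x xE] (i : 'I_m) : exists x : Cinf M, forall q, chart_dom c q ->
    cball (c p) (r / 2) (c q) -> x q = c q 0 i.
  have [|x xE _] := ext (fun y => y 0 i); last by exists x.
  by move=> k; apply: Ck_coordinate; exact: open_chart_cod.
exists x; split=> [q i cq|X f q cq rq]; first exact: xE.
have [a aE] := tangent_chart (value_at_tangent X q) ca cq.
have -> : \row_i X (x i) q = a.
  apply/rowP => i; rewrite mxE -[LHS]/(value_at X q (x i)) aE.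
  rewrite -(derive_coordinate (c q) a i).
  apply: near_eq_derive.
  have oc : \forall y \near c q, chart_cod c y.
    by apply: open_nbhs_nbhs; split; [exact: open_chart_cod|exact: chart_cod_map].
  apply: filterS2 oc (cball_near rq) => y /chart_invK[cy yK] yr.
  by rewrite /= xE // yK.
exact: aE.
Qed.

Section frame_field.
Variables (c : chart R m M) (a : 'rV[R]_m) (r : R) (i : 'I_m).
Hypotheses (ca : atlas c) (r0 : 0 < r) (rc : cball a r `<=` chart_cod c).

(** The action on [f] of the [i]-th coordinate field of [c], cut off so as to be defined on all of
    [M]. *)
Definition frame_fun f : Cinf M :=
  MkCinf (bump_ext_smooth ca r0 rc
    (smooth_derive (delta_mx 0 i) (smooth_funP (valP f) ca))).

Lemma frame_funE f q : chart_dom c q -> frame_fun f q =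
  rV_bump a r (c q) * 'D_(delta_mx 0 i) (f \o chart_inv c) (c q).
Proof. by move=> cq; rewrite /= chart_extE. Qed.

Lemma frame_derivation : frame_fun \in @derivation R m M.
Proof.
have T q cq := @chart_tangent _ _ M c q (delta_mx 0 i) ca cq.
apply/asboolP; split=> [k f h|f h]; apply: Cinf_ext => q.
  rewrite -[RHS]/(k * frame_fun f q + frame_fun h q).
  have [cq|cq] := pselect (chart_dom c q).
    by rewrite !frame_funE // (T _ cq).1; ring.
  by rewrite /= !chart_extN // mulr0 addr0.
rewrite -[RHS]/(f q * frame_fun h q + h q * frame_fun f q).
have [cq|cq] := pselect (chart_dom c q).
  by rewrite !frame_funE // (T _ cq).2; ring.
by rewrite /= !chart_extN // !mulr0 addr0.
Qed.

Definition frame_field : vector_field M := MkVectorField frame_derivation.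

End frame_field.

(* Near [p] the field [X] is a combination of frame fields with coefficients
   vanishing at [p]; the bump function [b] makes this global. *)
Lemma tensorial (w : vector_field M -> Cinf M) X p :
  (forall f Y Z, w (f *: Y + Z) = f * w Y + w Z) -> value_at X p = 0 -> w X p = 0.
Proof.
move=> wl Xp; have [c ca cp] := atlas_cover p.
have [r r0 [rc [x [xE XE]]]] := local_coordinates ca cp.
have wD Y Z : w (Y + Z) = w Y + w Z by rewrite -[Y]scale1r wl mul1r scale1r.
have w0 : w 0 = 0 by apply: (@addrI _ (w 0)); rewrite -wD !addr0.
have wZ f Y : w (f *: Y) = f * w Y by rewrite -[f *: Y]addr0 wl w0 addr0.
have r20 : 0 < r / 2 by rewrite divr_gt0.
have [b b1 b0] := bump_exists (near_chart cp r20).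
pose E i := frame_field i ca r0 rc.
(* [b] vanishes off the ball of radius [r / 2], on which the cut-off factor of [E i] is 1. *)
have bX : b *: X = \sum_i (b * X (x i)) *: E i.
  apply: vf_ext => f; apply: Cinf_ext => q.
  rewrite vf_sumE -[LHS]/(b q * X f q) -[RHS]/(val (\sum_i _) q) raddf_sum fct_sumE.
  have [[cq rq]|/b0 bq] := pselect (chart_dom c q /\ cball (c p) (r / 2) (c q)); last first.
    rewrite bq mul0r big1 // => i _.
    by rewrite -[LHS]/(b q * X (x i) q * E i f q) bq !mul0r.
  rewrite XE //; last first.
    apply: le_lt_trans (cballC rq) _; rewrite ltr_pdivrMr // ltr_pMr // ltr1n //.
  rewrite derive_coord; last first.
    exact: smooth_differentiable (smooth_funP (valP f) ca) (chart_cod_map cq).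
  rewrite mulr_sumr; apply: eq_bigr => i _.
  rewrite -[RHS]/(b q * X (x i) q * E i f q) mxE frame_funE // rV_bump1 // mul1r.
  by rewrite mulrA.
have : w (b *: X) p = 0.
  rewrite bX; have -> : w (\sum_i (b * X (x i)) *: E i) = \sum_i (b * X (x i)) * w (E i).
    by elim/big_ind2 : _ => // u u' v v' <- <-; rewrite wD.
  rewrite -[LHS]/(val (\sum_i _) p) raddf_sum fct_sumE big1 // => i _.
  rewrite -[LHS]/(b p * X (x i) p * w (E i) p).
  have -> : X (x i) p = value_at X p (x i) by [].
  by rewrite Xp mulr0 mul0r.
by rewrite wZ -[(b * w X) p]/(b p * w X p) (nbhs_singleton b1) mul1r.
Qed.

Lemma tensorial_eq (w : vector_field M -> Cinf M) X Y p :
  (forall f Y Z, w (f *: Y + Z) = f * w Y + w Z) -> value_at X p = value_at Y p ->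
  w X p = w Y p.
Proof.
move=> wl XY; have wB : w (X - Y) = w X - w Y.
  by rewrite -scaleN1r addrC wl mulN1r addrC.
have : w (X - Y) p = 0.
  apply: tensorial wl _; apply/funext => f; rewrite -[LHS]/(value_at X p f - value_at Y p f).
  by rewrite XY subrr.
by rewrite wB => /eqP; rewrite -[(w X - w Y) p]/(w X p - w Y p) subr_eq0 => /eqP.
Qed.

End local_frames.

(** * The Frobenius theorem *)

Section evaluation.
Context {R : realType} {m : nat} {M : manifold R m}.

(** Evaluation gets a name in order to be declared a ring morphism; sums and determinants over
    [Cinf M] can then be evaluated at a point. *)
Definition Cinf_eval (p : M) (f : Cinf M) : R := f p.

Lemma Cinf_eval_is_zmod_morphism p : zmod_morphism (Cinf_eval p).
Proof. by []. Qed.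

Lemma Cinf_eval_is_monoid_morphism p : monoid_morphism (Cinf_eval p).
Proof. by []. Qed.

HB.instance Definition _ p :=
  GRing.isZmodMorphism.Build (Cinf M) R (Cinf_eval p) (Cinf_eval_is_zmod_morphism p).
HB.instance Definition _ p :=
  GRing.isMonoidMorphism.Build (Cinf M) R (Cinf_eval p) (Cinf_eval_is_monoid_morphism p).

Lemma Cinf_sumE n (F : 'I_n -> Cinf M) p : (\sum_i F i : Cinf M) p = \sum_i F i p.
Proof. exact: (raddf_sum (Cinf_eval p)). Qed.

Lemma Cinf_mulE (f h : Cinf M) p : (f * h) p = f p * h p. Proof. by []. Qed.

(** Used to invert, near a point, the determinant of a change of frame while staying in the ring
    [Cinf M]. *)
Lemma near_inverse (f : Cinf M) p : f p != 0 ->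
  exists h : Cinf M, \forall q \near p, h q * f q = 1.
Proof.
move=> fp; have [c ca cp] := atlas_cover p.
have cf : continuous_at p f.
  have sf := smooth_funP (valP f) ca.
  have cfi : {for c p, continuous (f \o chart_inv c)} := sf 0 _ (chart_cod_map cp).
  have : {for p, continuous ((f \o chart_inv c) \o c)}.
    by apply: continuous_comp => //; exact: chart_map_cts.
  rewrite /prop_for /continuous_at /= chart_mapK //; apply: cvg_trans.
  apply: near_eq_cvg.
  have : \forall q \near p, chart_dom c q.
    by apply: open_nbhs_nbhs; split => //; exact: chart_dom_open.
  by apply: filterS => q cq; rewrite /= chart_mapK.
have f0 : \forall q \near p, f q != 0 by exact: (cvgr_neq0 (f p)).
have [b b1 b0] := bump_exists f0.
(* [d] has no zero, and equals [f * f] where [b = 1]. *)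
pose d := f * f + (1 - b) * (1 - b).
have d0 q : d q != 0.
  have -> : d q = f q ^+ 2 + (1 - b q) ^+ 2 by [].
  have [fq|/negP/negPn/eqP fq] := pselect (f q != 0).
    by rewrite gt_eqF // ltr_pwDl ?sqr_ge0 // exprn_even_gt0.
  by rewrite b0 ?fq ?eqxx // subr0 expr1n expr0n add0r oner_neq0.
have sV : (fun q => (d q)^-1) \in smooth_fun M.
  apply/asboolP => e ea k.
  apply: (CkV (open_chart_cod e) (f := d \o chart_inv e)) => [y _|]; first exact: d0.
  exact: (smooth_funP (valP d) ea).
exists (f * MkCinf sV); apply: filterS2 b1 f0 => q bq fq.
rewrite -[LHS]/(f q * (f q * f q + (1 - b q) * (1 - b q))^-1 * f q) bq subrr mulr0 addr0.
by rewrite invfM mulrA divff // mul1r mulVf.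
Qed.

End evaluation.

Section commuting_frame.
Context {R : realType} {m : nat} {M : manifold R m}.
Variables (r : nat) (xi : 'I_r -> vector_field M).

Definition in_span (X : vector_field M) := exists C : 'I_r -> Cinf M, X = \sum_k C k *: xi k.

Lemma in_spanD X Y : in_span X -> in_span Y -> in_span (X + Y).
Proof.
move=> [C ->] [D ->]; exists (fun k => C k + D k); rewrite -big_split.
by apply: eq_bigr => k _; rewrite scalerDl.
Qed.

Lemma in_spanZ f X : in_span X -> in_span (f *: X).
Proof.
move=> [C ->]; exists (fun k => f * C k); rewrite scaler_sumr.
by apply: eq_bigr => k _; rewrite scalerA.
Qed.

Lemma in_span_xi i : in_span (xi i).
Proof.
exists (fun k => if k == i then 1 else 0); rewrite (bigD1 i) //= eqxx scale1r big1 ?addr0 //.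
by move=> k /negPf ->; rewrite scale0r.
Qed.

Lemma in_span0 : in_span 0.
Proof. by exists (fun _ => 0); rewrite big1 // => k _; rewrite scale0r. Qed.

Lemma in_spanN X : in_span X -> in_span (- X).
Proof. by move=> sX; rewrite -scaleN1r; exact: in_spanZ. Qed.

Lemma in_span_sum n (F : 'I_n -> vector_field M) :
  (forall i, in_span (F i)) -> in_span (\sum_i F i).
Proof. by move=> sF; elim/big_ind : _ => //; [exact: in_span0|move=> X Y; exact: in_spanD]. Qed.

Hypothesis involutive : forall i j, in_span (bracket (xi i) (xi j)).

Lemma in_span_bracket X Y : in_span X -> in_span Y -> in_span (bracket X Y).
Proof.
have sum_r Z n (F : 'I_n -> vector_field M) :
    (forall i, in_span (bracket Z (F i))) -> in_span (bracket Z (\sum_i F i)).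
  move=> sF; elim/big_ind : _ => // [|A A' sA sA'].
    by have -> : bracket Z 0 = 0 by [have := bracketDr Z 0 0;
      rewrite addr0 -[LHS]addr0 => /addrI]; exact: in_span0.
  by rewrite bracketDr; exact: in_spanD.
have xiY i Y' : in_span Y' -> in_span (bracket (xi i) Y').
  move=> [D ->]; apply: sum_r => j; rewrite bracketZr.
  by apply: in_spanD; apply: in_spanZ; [exact: in_span_xi|exact: involutive].
move=> [C ->] sY; rewrite bracketC; apply/in_spanN/sum_r => i.
rewrite bracketZr bracketC; apply: in_spanD; apply: in_spanZ; first exact: in_span_xi.
by apply/in_spanN/xiY.
Qed.

Variable p : M.
Hypothesis indep : forall a : 'rV[R]_r, \sum_i a 0 i *: value_at (xi i) p = 0 -> a = 0.

(** A linear relation between the rows of the matrix of components [xi i (x j) p] is one between the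
    values of the [xi i]. The matrix thus has a right inverse [B], whose columns give the
    combinations of coordinates that are sought. *)
Lemma dual_functions : exists w : 'I_r -> Cinf M, forall i j, xi i (w j) p = (i == j)%:R.
Proof.
have [c ca cp] := atlas_cover p.
have [rd rd0 [_ [x [_ xE]]]] := local_coordinates ca cp.
pose Xi : 'M[R]_(r, m) := \matrix_(i, j) xi i (x j) p.
have /row_freeP[B XB] : row_free Xi.
  apply: inj_row_free => a aXi; apply: indep; apply/funext => f.
  rewrite fct_sumE.
  have E i : (a 0 i *: value_at (xi i) p) f =
      a 0 i * 'D_(\row_j xi i (x j) p) (f \o chart_inv c) (c p).
    by rewrite -xE ?subrr ?normr0.
  under eq_bigr do rewrite E.
  have df := smooth_differentiable (smooth_funP (valP f) ca) (chart_cod_map cp).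
  under eq_bigr do rewrite (deriveE _ df) -[_ * _]/(_ *: _ : R) -linearZ.
  rewrite -linear_sum; have -> : \sum_i a 0 i *: (\row_j xi i (x j) p) = a *m Xi.
    by apply/rowP => j; rewrite summxE mxE; apply: eq_bigr => i _; rewrite !mxE.
  by rewrite aXi linear0.
exists (fun j => \sum_k B k j *: x k) => i j.
have -> : xi i (\sum_k B k j *: x k) p = \sum_k B k j * xi i (x k) p.
  rewrite -[LHS]/(value_at (xi i) p _) (tangent_sum (value_at_tangent (xi i) p)).
  by apply: eq_bigr => k _; rewrite (tangentZ (value_at_tangent (xi i) p)).
have := congr1 (fun A : 'M[R]_r => A i j) XB; rewrite !mxE => <-.
by apply: eq_bigr => k _; rewrite mxE mulrC.
Qed.

(** The matrix [S] of the functions [xi i (w j)] is the identity at [p], and the frame is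
    [zeta = S^-1 xi] near [p], the inverse being taken by the adjugate. The bracket of [zeta a] and
    [zeta b] is a combination [\sum_k C k *: xi k] by involutivity. It kills every [w c], since
    [zeta b (w c)] is locally constant; hence [C S = 0], and [C = 0] as [S] is invertible. *)
Lemma commuting_frame : exists (zeta : 'I_r -> vector_field M) (w : 'I_r -> Cinf M)
    (A S : 'I_r -> 'I_r -> Cinf M),
  (forall a, zeta a = \sum_i A a i *: xi i) /\
  \forall q \near p, [/\ forall i f, xi i f q = \sum_a S i a q * zeta a f q,
    forall a b, zeta a (w b) q = (a == b)%:R &
    forall a b f, bracket (zeta a) (zeta b) f q = 0].
Proof.
have [w wE] := dual_functions.
pose S : 'M[Cinf M]_r := \matrix_(i, j) xi i (w j).
have Sp : \det S p != 0.
  rewrite -[\det S p]/(Cinf_eval p (\det S)) -det_map_mx.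
  rewrite (_ : map_mx _ S = 1%:M) ?det1 ?oner_neq0 //.
  by apply/matrixP => i j; rewrite !mxE; exact: wE.
have [h hS] := near_inverse Sp.
pose A : 'M[Cinf M]_r := h *: \adj S.
have AS : A *m S = (h * \det S)%:M by rewrite -scalemxAl mul_adj_mx scale_scalar_mx.
have SA : S *m A = (h * \det S)%:M by rewrite -scalemxAr mul_mx_adj scale_scalar_mx.
pose zeta a := \sum_i A a i *: xi i.
have zetaE a f : zeta a f = \sum_i A a i * xi i f.
  exact: vf_sumE.
have zetaq a f q : zeta a f q = \sum_i A a i q * xi i f q.
  by rewrite zetaE Cinf_sumE.
have entry (B C : 'M[Cinf M]_r) i j q : B *m C = (h * \det S)%:M -> h q * \det S q = 1 ->
    \sum_k B i k q * C k j q = (i == j)%:R.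
  move=> BC hq; have := congr1 (fun D : 'M[Cinf M]_r => D i j q) BC; rewrite !mxE Cinf_sumE.
  under eq_bigr do rewrite Cinf_mulE; move=> ->; case: (i == j); last by rewrite mulr0n.
  by rewrite mulr1n.
exists zeta, w, (fun a i => A a i), (fun i a => S i a); split=> //.
(* An open set is fixed since [zeta b (w c)] has to be constant around each point considered, not
   only at it. *)
have [W [oW Wp] hW] : exists2 W : set M, open_nbhs p W & forall q, W q -> h q * \det S q = 1.
  by move: hS; rewrite /prop_near1 nbhsE => -[ W ? ?]; exists W.
have zw q a b : W q -> zeta a (w b) q = (a == b)%:R.
  move=> /hW hq; rewrite zetaq -(entry _ _ a b q AS hq).
  by apply: eq_bigr => k _; rewrite [S k b]mxE.
have : \forall q \near p, W q by exact: open_nbhs_nbhs.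
apply: filterS => q Wq; have hq := hW q Wq; split=> [i f|a b|a b f].
- under eq_bigr do rewrite zetaq mulr_sumr.
  rewrite exchange_big /= (bigD1 i) //= [X in _ + X]big1 ?addr0.
    have := entry _ _ i i q SA hq; rewrite eqxx => E.
    under eq_bigr do rewrite mulrA.
    by rewrite -mulr_suml E mul1r.
  move=> j ji; under eq_bigr do rewrite mulrA.
  by rewrite -mulr_suml (entry _ _ i j q SA hq) eq_sym (negPf ji) mul0r.
- exact: zw.
- have zs a' : in_span (zeta a') by exists (fun i => A a' i).
  have [C CE] := in_span_bracket (zs a) (zs b).
  have bE f' : bracket (zeta a) (zeta b) f' = \sum_k C k * xi k f'.
    by rewrite CE vf_sumE.
  have zz a' b' b'' : zeta a' (zeta b' (w b'')) q = 0.
    rewrite -[LHS]/(value_at (zeta a') q _).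
    rewrite (tangent_near (value_at_tangent (zeta a') q) (h := (b' == b'')%:R *: (1 : Cinf M))).
      by rewrite (tangentZ (value_at_tangent _ _)) (tangent1 (value_at_tangent _ _)) mulr0.
    apply: filterS (open_nbhs_nbhs (conj oW Wq)) => q' Wq'; rewrite zw //.
    by rewrite -[RHS]/(_ * 1) mulr1.
  have C0 c : \sum_k C k q * S k c q = 0.
    have : bracket (zeta a) (zeta b) (w c) q = 0.
      by rewrite bracketE -[LHS]/(zeta a _ q - zeta b _ q) !zz subrr.
    rewrite bE Cinf_sumE => E; rewrite -[RHS]E.
    by apply: eq_bigr => k _; rewrite [S k c]mxE.
  have Cq k : C k q = 0.
    have : \sum_c (\sum_j C j q * S j c q) * A c k q = 0.
      by rewrite big1 // => c _; rewrite C0 mul0r.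
    under eq_bigr do rewrite mulr_suml.
    rewrite exchange_big /= (bigD1 k) //= [X in _ + X]big1 ?addr0.
      under eq_bigr do rewrite -mulrA.
      by rewrite -mulr_sumr (entry _ _ k k q SA hq) eqxx mulr1.
    move=> j jk; under eq_bigr do rewrite -mulrA.
    by rewrite -mulr_sumr (entry _ _ j k q SA hq) (negPf jk) mulr0.
  by rewrite bE Cinf_sumE big1 // => k _; rewrite Cinf_mulE Cq mul0r.
Qed.

End commuting_frame.

(** * The flow of a commuting frame in a chart *)

Section local_flow.
Context {R : realType}.

Lemma compact_support_bounds m (f : 'rV[R]_m -> R) (a : 'rV[R]_m) (e : R) :
  smooth_on setT f -> (forall y, ~ cball a e y -> f y = 0) ->
  (exists2 B, 0 <= B & forall y, `|f y| <= B) /\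
  (exists2 L, 0 <= L & forall x y, `|f y - f x| <= L * `|y - x|).
Proof.
move=> sf f0.
have bnd (h : 'rV[R]_m -> R) : smooth_on setT h -> (forall y, ~ cball a e y -> h y = 0) ->
    exists2 B, 0 <= B & forall y, `|h y| <= B.
  move=> sh h0; have [B B0 hB] := Ck_bounded (c := a) (e := e) (sh 0) (@subsetT _ _).
  exists B => // y; have [/hB//|/h0 ->] := pselect (cball a e y).
  by rewrite normr0.
split; first exact: bnd.
have /choice[K hK] i : exists K, 0 <= K /\ forall y, `|'D_(delta_mx 0 i) f y| <= K.
  have [|y ya|K K0 KP] := bnd ('D_(delta_mx 0 i) f); last by exists K.
    exact: smooth_derive.
  have oC : open (~` cball a e) by apply: closed_openC; exact: closed_closed_ball_.
  transitivity ('D_(delta_mx 0 i) (cst 0 : 'rV[R]_m -> R) y); last by rewrite derive_cst.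
  apply: near_eq_derive; apply: filterS (open_nbhs_nbhs (conj oC ya)) => z za.
  by rewrite f0.
have S0 : 0 <= \sum_i K i by apply: sumr_ge0 => i _; case: (hK i).
exists (m%:R * \sum_i K i) => [|x y]; first by rewrite mulr_ge0.
(* The bounds on the derivatives are global, so any ball containing [x] and [y] will do. *)
apply: (@lipschitz_of_derive _ _ _ 0 (Num.max `|x| `|y|)); last 2 first.
- by rewrite /closed_ball_ /= sub0r normrN le_max lexx.
- by rewrite /closed_ball_ /= sub0r normrN le_max lexx orbT.
move=> z _; split; first exact: smooth_differentiable sf _.
move=> i; apply: le_trans ((hK i).2 z) _; rewrite (bigD1 i) //= lerDl.
by apply: sumr_ge0 => j _; case: (hK j).
Qed.

Lemma open_norm_ball r (e : R) : open [set u : 'rV[R]_r | `|u| < e].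
Proof.
have -> : [set u : 'rV[R]_r | `|u| < e] = Num.Def.normr @^-1` [set x | x < e] by [].
by apply: open_comp => [u _|]; [exact: norm_continuous|exact: open_lt].
Qed.

Context {m : nat} {M : manifold R m}.

(** The components of the frame are cut off at radius [s] to meet the global bounds of
    [commuting_flow]. They are unchanged on the ball of radius [s/2], and commutation is claimed on
    the smaller ball of radius [s/4], each point of which has a neighbourhood where the cut-off is
    invisible to derivatives. *)
Lemma local_flow r (zeta : 'I_r -> vector_field M) (c : chart R m M) (p : M) (G : set M) :
  atlas c -> chart_dom c p -> nbhs p G ->
  (forall q, G q -> forall a b f, bracket (zeta a) (zeta b) f q = 0) ->
  exists2 e : R, 0 < e & exists F : 'rV[R]_r -> 'rV[R]_m,
  [/\ F 0 = c p, smooth_on [set u | `|u| < e] F,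
      forall u, `|u| < e -> chart_cod c (F u) /\ G (chart_inv c (F u)) &
      forall (f : Cinf M) u a, `|u| < e ->
        'D_a ((f \o chart_inv c) \o F) u = \sum_b a 0 b * zeta b f (chart_inv c (F u))].
Proof.
move=> ca cp Gp comm.
have [r1 r10 [r1c [x [_ xE]]]] := local_coordinates ca cp.
have [r2 r20 r2G] := chart_ball cp Gp.
pose s := Num.min r1 r2; have s0 : 0 < s by rewrite lt_min r10.
have sr1 : s <= r1 by rewrite ge_min lexx.
have sr2 : s <= r2 by rewrite ge_min lexx orbT.
have sc : cball (c p) s `<=` chart_cod c by move=> y ys; apply: r1c; exact: le_trans ys sr1.
pose hat a i : 'rV[R]_m -> R := zeta a (x i) \o chart_inv c.
have shat a i : smooth_on (chart_cod c) (hat a i) by exact: smooth_funP (valP _) ca.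
pose Z a y : 'rV[R]_m := \row_i (rV_bump (c p) s * hat a i) y.
have ZE a i : (fun y => Z a y 0 i) = rV_bump (c p) s * hat a i.
  by apply/funext => y; rewrite mxE.
have Zs a i : smooth_on setT (fun y => Z a y 0 i).
  by rewrite ZE; exact: (smooth_bump_mul (open_chart_cod c)).
have Z0 a i y : ~ cball (c p) s y -> Z a y 0 i = 0.
  by move=> ys; rewrite -[LHS]/((fun y => Z a y 0 i) y) ZE fctE rV_bump0 // mul0r.
have /choice[B hB] (ai : 'I_r * 'I_m) : exists B, 0 <= B /\ forall y, `|Z ai.1 y 0 ai.2| <= B.
  by have [[B B0 BP] _] := compact_support_bounds (Zs ai.1 ai.2) (@Z0 ai.1 ai.2); exists B.
have /choice[L hL] (ai : 'I_r * 'I_m) : exists L, 0 <= L /\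
    forall x y, `|Z ai.1 y 0 ai.2 - Z ai.1 x 0 ai.2| <= L * `|y - x|.
  by have [_ [L L0 LP]] := compact_support_bounds (Zs ai.1 ai.2) (@Z0 ai.1 ai.2); exists L.
have BS0 : 0 <= \sum_ai B ai by apply: sumr_ge0 => ai _; case: (hB ai).
have LS0 : 0 <= \sum_ai L ai by apply: sumr_ge0 => ai _; case: (hL ai).
have ZB a y : `|Z a y| <= \sum_ai B ai.
  apply: rV_norm_le => // i; apply: le_trans ((hB (a, i)).2 y) _.
  by rewrite (bigD1 (a, i)) //= lerDl; apply: sumr_ge0 => ai _; case: (hB ai).
have ZL a x1 y : `|Z a y - Z a x1| <= (\sum_ai L ai) * `|y - x1|.
  apply: rV_norm_le => [|i]; first by rewrite mulr_ge0.
  rewrite !rVE; apply: le_trans ((hL (a, i)).2 x1 y) _; apply: ler_wpM2r => //.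
  by rewrite (bigD1 (a, i)) //= lerDl; apply: sumr_ge0 => ai _; case: (hL ai).
have q0 : 0 < s / 4 by rewrite divr_gt0.
have small y : cball (c p) (s / 4) y -> `|y - c p| < s / 2.
  by move=> /cballC ys; apply: le_lt_trans ys _; lra.
have good y : cball (c p) (s / 4) y -> chart_cod c y.
  by move=> /small ys; apply: sc; rewrite /closed_ball_ /= distrC; lra.
have Zy a y : cball (c p) (s / 4) y -> Z a y = \row_i zeta a (x i) (chart_inv c y).
  move=> ys; apply/rowP => i; rewrite !mxE fctE rV_bump1 ?mul1r //.
  by have := small y ys; rewrite /closed_ball_ /= distrC => /ltW.
have field_derive a y f : cball (c p) (s / 4) y ->
    zeta a f (chart_inv c y) = 'D_(Z a y) (f \o chart_inv c) y.
  move=> ys; have [cy yK] := chart_invK (good y ys).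
  rewrite xE // ?yK ?Zy //; have := small y ys; lra.
have ZC y a b i : cball (c p) (s / 4) y ->
    'D_(Z a y) (fun x => Z b x 0 i) y = 'D_(Z b y) (fun x => Z a x 0 i) y.
  move=> ys; have E a' b' : 'D_(Z a' y) (fun x => Z b' x 0 i) y =
      zeta a' (zeta b' (x i)) (chart_inv c y).
    rewrite field_derive //; apply: near_eq_derive.
    apply: filterS (cball_near (small y ys)) => z zs.
    by rewrite mxE fctE rV_bump1 // mul1r.
  have Gy : G (chart_inv c y).
    by apply: (r2G y _).2; have := small y ys; rewrite /closed_ball_ /= distrC; lra.
  rewrite !E; apply/eqP; rewrite -subr_eq0; apply/eqP.
  exact: (comm _ Gy a b (x i)).
have [e e0 [F [F0 FE]]] := commuting_flow q0 BS0 LS0 Zs ZB ZL ZC.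
have Fs u : `|u| < e -> cball (c p) (s / 4) (F u).
  by move=> /FE[/ltW + _]; rewrite /closed_ball_ /= distrC.
have dF u : `|u| < e -> differentiable F u.
  by move=> ue; apply: differentiable_row => i; case: ((FE u ue).2 i).
have DF u a : `|u| < e -> 'D_a F u = frame_comb Z a (F u).
  move=> ue; rewrite derive_mx; last exact/diff_derivable/dF.
  by apply/rowP => i; rewrite mxE; case: ((FE u ue).2 i).
exists e => //; exists F; split=> // [k|u ue|f u a ue].
- have oU := @open_norm_ball r e; elim: k => [|k IH].
    by move=> u ue; exact/differentiable_continuous/dF.
  apply: (Ck_row oU) => i; split=> [u ue|h]; first by case: ((FE u ue).2 i).
  have C : Ck k [set u | `|u| < e] (\sum_a (cst (h 0 a) * ((fun y => Z a y 0 i) \o F))).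
    apply: Ck_sum => // a; apply: CkM => //; first exact: Ck_cst.
    exact: (Ck_comp oU _ IH (Zs a i k)).
  apply: (Ck_ext oU _ C) => u ue; have [_ ->] := (FE u ue).2 i.
  by rewrite fct_sumE frame_comb_coord.
- have Fu := Fs u ue; split; first exact: good.
  by apply: (r2G _ _).2; have := small _ Fu; rewrite /closed_ball_ /= distrC; lra.
- have Fu := Fs u ue.
  have df : differentiable (f \o chart_inv c) (F u).
    exact: smooth_differentiable (smooth_funP (valP f) ca) (good _ Fu).
  rewrite deriveE; last by apply: differentiable_comp => //; exact: dF.
  rewrite diff_comp //=; last exact: dF.
  rewrite -(deriveE _ (dF u ue)) DF // /frame_comb linear_sum.
  by apply: eq_bigr => b _; rewrite linearZ /= -deriveE // field_derive.
Qed.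

End local_flow.

(** * The parameter domain as a manifold *)

Section disc.
Context {R : realType} (r : nat).

Lemma rV_second_countable : @second_countable 'rV[R]_r.
Proof.
pose bl (a : 'rV[rat]_r * nat) : set 'rV[R]_r := [set y | `|y - map_mx ratr a.1| < a.2.+1%:R^-1].
exists (range bl).
  by apply: card_le_trans (card_image_le _ _) _; exact: countableP.
split=> [_ [a _ <-]|x P].
  have -> : bl a = ball (map_mx ratr a.1 : 'rV[R]_r) a.2.+1%:R^-1.
    by apply/seteqP; split=> y; rewrite -ball_normE /ball_ /bl /= distrC.
  exact: ball_open.
move=> /nbhs_ballP[e e0 eP].
have [n hn] : exists n, n.+1%:R^-1 < e / 2.
  exists (Num.truncn (e / 2)^-1); rewrite invf_plt ?posrE ?divr_gt0 ?ltr0n //.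
  exact: truncnS_gt.
have n0 : 0 < n.+1%:R^-1 :> R by rewrite invr_gt0 ltr0n.
(* [rV_norm_le] yields only a weak inequality, so the rational centre is sought within half of the
   radius [n.+1%:R^-1]. *)
have [d d0 dE] : exists2 d : R, 0 < d & d = n.+1%:R^-1 / 2.
  by exists (n.+1%:R^-1 / 2) => //; rewrite divr_gt0.
have /choice[q hq] i : exists q : rat, `|x 0 i - ratr q| < d.
  have [|q] := @rat_in_itvoo R (x 0 i - d) (x 0 i + d); first by lra.
  by rewrite in_itv /= => /andP[q1 q2]; exists q; rewrite ltr_norml; lra.
have xq : bl (\row_i q i, n) x.
  rewrite /bl /=; apply: le_lt_trans (_ : d < _).
    apply: rV_norm_le => [|i]; first exact: ltW.
    by rewrite !rVE !mxE ltW.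
  by rewrite dE ltr_pdivrMr // ltr_pMr // ltr1n.
exists (bl (\row_i q i, n)); first by split=> //; exists (\row_i q i, n).
move=> y yq; apply: eP; rewrite -ball_normE /ball_ /=.
rewrite -(subrKA (map_mx ratr (\row_i q i))); apply: le_lt_trans (ler_normD _ _) _.
rewrite [`|_ - y|]distrC; have -> : e = e / 2 + e / 2 by rewrite -splitr.
by apply: ltrD; [exact: lt_trans xq hn|exact: lt_trans yq hn].
Qed.

Variable e : R.
Hypothesis e0 : 0 < e.

(* The domain of the local flow is made a manifold by putting on the whole space of
   row vectors a single chart, with image the open ball of radius [e]. *)
Definition to_disc (x : 'rV[R]_r) : 'rV[R]_r := (e / (1 + `|x|)) *: x.
Definition of_disc (y : 'rV[R]_r) : 'rV[R]_r := (e - `|y|)^-1 *: y.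

Let norm_to_disc x : `|to_disc x| = e * `|x| / (1 + `|x|).
Proof.
rewrite normrZ ger0_norm; last by rewrite divr_ge0 ?ltW.
by rewrite mulrAC.
Qed.

Lemma to_disc_lt x : `|to_disc x| < e.
Proof. by rewrite norm_to_disc ltr_pdivrMr // ltr_pM2l // ltrDr ltr01. Qed.

Lemma to_discK x : of_disc (to_disc x) = x.
Proof.
rewrite /of_disc norm_to_disc /to_disc scalerA -[RHS]scale1r; congr (_ *: _).
have D0 : 1 + `|x| != 0 by rewrite gt_eqF.
have e0' : e != 0 by rewrite gt_eqF.
have -> : e - e * `|x| / (1 + `|x|) = e / (1 + `|x|) by field.
by rewrite mulVf // mulf_neq0 // invr_eq0.
Qed.

Lemma of_discK y : `|y| < e -> to_disc (of_disc y) = y.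
Proof.
move=> ye; have D0 : 0 < e - `|y| by rewrite subr_gt0.
rewrite /to_disc {2}/of_disc scalerA -[RHS]scale1r; congr (_ *: _).
have -> : `|of_disc y| = `|y| / (e - `|y|).
  by rewrite normrZ gtr0_norm ?invr_gt0 // mulrC.
have D0' : e - `|y| != 0 by rewrite gt_eqF.
have e0' : e != 0 by rewrite gt_eqF.
by field; rewrite D0' /= subrK.
Qed.

Let cod_disc : to_disc @` setT = [set y | `|y| < e].
Proof.
apply/seteqP; split=> [_ [x _ <-]|y ye]; first exact: to_disc_lt.
by exists (of_disc y) => //; exact: of_discK.
Qed.

Lemma to_disc_cts (x : 'rV[R]_r) : {for x, continuous to_disc}.
Proof.
have n0 : 1 + `|x| != 0 by rewrite gt_eqF.
have c : {for x, continuous (fun z : 'rV[R]_r => 1 + `|z|)}.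
  apply: (@lipschitz_continuous R 'rV[R]_r R _ 1) => u v.
  by rewrite addrBB mul1r ler_dist_dist.
have cV := @continuousV R 'rV[R]_r (fun z => 1 + `|z|) x n0 c.
have ce : {for x, continuous (cst e : 'rV[R]_r -> R)} by exact: cst_continuous.
exact: (@continuousZ R 'rV[R]_r _ (fun z => e / (1 + `|z|)) id x (continuousM ce cV) cvg_id).
Qed.

Lemma of_disc_cts y : `|y| < e -> {for y, continuous of_disc}.
Proof.
move=> ye; have n0 : e - `|y| != 0 by rewrite gt_eqF // subr_gt0.
have c : {for y, continuous (fun z : 'rV[R]_r => e - `|z|)}.
  apply: (@lipschitz_continuous R 'rV[R]_r R _ 1) => u v.
  by rewrite addrBB -opprD normrN mul1r ler_dist_dist.
have cV := @continuousV R 'rV[R]_r (fun z => e - `|z|) y n0 c.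
exact: (@continuousZ R 'rV[R]_r _ (fun z => (e - `|z|)^-1) id y cV cvg_id).
Qed.

Let open_cod_disc : open (to_disc @` setT).
Proof. by rewrite cod_disc; exact: open_norm_ball. Qed.

Let of_disc_cts_cod y : (to_disc @` setT) y -> {for y, continuous of_disc}.
Proof. by rewrite cod_disc; exact: of_disc_cts. Qed.

Definition disc_chart : chart R r 'rV[R]_r :=
  @Chart R r 'rV[R]_r setT to_disc of_disc openT open_cod_disc
    (fun x _ => to_discK x) (fun x _ => @to_disc_cts x) of_disc_cts_cod.

Let disc_cover (p : 'rV[R]_r) : exists2 c, [set disc_chart] c & chart_dom c p.
Proof. by exists disc_chart. Qed.

Let disc_smooth c d : [set disc_chart] c -> [set disc_chart] d ->
  smooth_on (c @` (chart_dom c `&` chart_dom d)) (d \o chart_inv c).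
Proof.
move=> -> -> k /=; rewrite setIT cod_disc; have oU := @open_norm_ball R r e.
apply: (Ck_ext oU (f := id)) => [y ye|]; first by rewrite /= of_discK.
by apply: Ck_row => // i; exact: Ck_coordinate.
Qed.

Definition disc_manifold : manifold R r :=
  @Manifold R r 'rV[R]_r (@norm_hausdorff _ _) rV_second_countable [set disc_chart]
    disc_cover disc_smooth.

End disc.

(** * Integral manifolds through a point *)

Section frobenius.
Context {R : realType} {m : nat} {M : manifold R m}.

Lemma sum_mul_delta r (d : 'rV[R]_r) b : \sum_k d 0 k * (k == b)%:R = d 0 b.
Proof.
rewrite (bigD1 b) //= eqxx mulr1 big1 ?addr0 // => k kb.
by rewrite (negPf kb) mulr0.
Qed.

Section leaf_through_point.
Variables (r : nat) (zeta : 'I_r -> vector_field M) (w : 'I_r -> Cinf M).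
Variables (c : chart R m M) (p : M) (e : R) (F : 'rV[R]_r -> 'rV[R]_m).
Hypotheses (ca : atlas c) (e0 : 0 < e).
Hypothesis sF : smooth_on [set u | `|u| < e] F.
Hypothesis cF : forall u, `|u| < e -> chart_cod c (F u).
Hypothesis DF : forall (f : Cinf M) u a, `|u| < e ->
  'D_a ((f \o chart_inv c) \o F) u = \sum_b a 0 b * zeta b f (chart_inv c (F u)).
Hypothesis zw : forall u, `|u| < e ->
  forall a b, zeta a (w b) (chart_inv c (F u)) = (a == b)%:R.

Local Notation N := (disc_manifold r e0).

Definition plaque_fun (x : N) : M := chart_inv c (F (to_disc e x)).

Lemma plaque_fun_cts : continuous plaque_fun.
Proof.
move=> x; have xe : `|to_disc e x| < e by exact: to_disc_lt.
apply: (@continuous_comp _ _ _ (to_disc e) (chart_inv c \o F)); first exact: to_disc_cts.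
apply: continuous_comp; first exact: sF 0 _ xe.
by apply: chart_inv_cts; exact: cF.
Qed.

(** [to_disc] and [of_disc] cancel on the ball, so in charts the map is [F] followed by a transition
    map of the atlas of [M]. *)
Lemma plaque_fun_smooth (d : chart R r N) (d' : chart R m M) : atlas d -> atlas d' ->
  smooth_on (d @` (chart_dom d `&` plaque_fun @^-1` chart_dom d'))
            (d' \o plaque_fun \o chart_inv d).
Proof.
move=> -> d'a k; set A := (X in Ck k X).
have oA : open A.
  apply: (@open_chart_image _ _ N); apply: open_comp => [x _|]; first exact: plaque_fun_cts.
  exact: chart_dom_open.
have oc : open (c @` (chart_dom c `&` chart_dom d')).
  by apply: open_chart_image; exact: chart_dom_open.
have AU u : A u -> `|u| < e /\ (c @` (chart_dom c `&` chart_dom d')) (F u).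
  move=> [x [_ xd] <-]; have xe : `|to_disc e x| < e by exact: to_disc_lt.
  split=> //; exists (plaque_fun x); last by have [] := chart_invK (cF xe).
  by split=> //; have [] := chart_invK (cF xe).
apply: (Ck_ext oA (f := (d' \o chart_inv c) \o F)) => [u /AU[ue _]|].
  by rewrite /= /plaque_fun of_discK.
have FA : Ck k A F by apply: Ck_subset (sF k) => u /AU[].
apply: Ck_row => // i.
exact: (Ck_comp oA (fun u Au => (AU u Au).2) FA (Ck_coord oc i (atlas_smooth ca d'a k))).
Qed.

Definition plaque : smooth_map N M := MkSmoothMap plaque_fun_cts plaque_fun_smooth.

Lemma plaque_derive (f : Cinf M) (x : N) a :
  'D_a (pullback plaque f \o of_disc e) (to_disc e x) = \sum_b a 0 b * zeta b f (plaque x).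
Proof.
have xe : `|to_disc e x| < e by exact: to_disc_lt.
rewrite -DF //; apply: near_eq_derive.
apply: filterS (open_nbhs_nbhs (conj (@open_norm_ball R r e) xe)) => u ue.
by rewrite /= /plaque_fun of_discK.
Qed.

Lemma tangent_plaque (x : N) v : tangent_space N x v ->
  exists a : 'rV[R]_r, v = fun f => 'D_a (f \o of_disc e) (to_disc e x).
Proof.
move=> vx; have [a aE] := @tangent_chart _ _ N x v vx (disc_chart r e0) erefl I.
by exists a; apply/funext.
Qed.

Lemma plaque_tangent (x : N) (a : 'rV[R]_r) :
  tangent_space N x (fun f => 'D_a (f \o of_disc e) (to_disc e x)).
Proof. exact: (@chart_tangent _ _ N (disc_chart r e0) x a erefl I). Qed.

(** The functions [w b] recover the parameters: along [F] the function [w b] minus the [b]-th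
    coordinate has zero derivative because [zeta a (w b)] is the Kronecker symbol, so it is constant
    on the ball. *)
Lemma plaque_inj : injective plaque.
Proof.
move=> x y xy; rewrite -(to_discK e0 x) -(to_discK e0 y); congr of_disc; apply/rowP => b.
set u := to_disc e x; set v := to_disc e y.
have ue : `|u| < e by exact: to_disc_lt.
have ve : `|v| < e by exact: to_disc_lt.
pose h : 'rV[R]_r -> R := ((w b \o chart_inv c) \o F) - (fun z => z 0 b).
have h0 z : `|z| < e -> differentiable h z /\ forall i, `|'D_(delta_mx 0 i) h z| <= 0.
  move=> ze; have dw : differentiable ((w b \o chart_inv c) \o F) z.
    apply: differentiable_comp; first exact: smooth_differentiable sF ze.
    exact: smooth_differentiable (smooth_funP (valP (w b)) ca) (cF ze).
  have dz : differentiable (fun z : 'rV[R]_r => z 0 b) z by exact: differentiable_coord.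
  split=> [|i]; first exact: differentiableB.
  rewrite /h deriveB; [|exact: diff_derivable..].
  rewrite derive_coordinate DF //; under eq_bigr do rewrite zw //.
  by rewrite sum_mul_delta subrr normr0.
have hv : h v = h u.
  apply/eqP; rewrite -subr_eq0 -normr_le0; apply: le_trans (_ : r%:R * 0 * `|v - u| <= _).
    (* A closed ball about 0 containing [u] and [v] and still inside the open ball of radius [e];
       the Lipschitz constant is 0. *)
    apply: (@lipschitz_of_derive R r h 0 (Num.max `|u| `|v|) 0).
    - move=> z; rewrite /closed_ball_ /= sub0r normrN => zm; apply: h0.
      by apply: le_lt_trans zm _; rewrite gt_max ue.
    - by rewrite /closed_ball_ /= sub0r normrN le_max lexx.
    - by rewrite /closed_ball_ /= sub0r normrN le_max lexx orbT.
  by rewrite mulr0 mul0r.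
have wxy : w b (chart_inv c (F u)) = w b (chart_inv c (F v)) by exact: (congr1 (w b) xy).
by move: hv; rewrite -[h v]/(w b (chart_inv c (F v)) - v 0 b)
  -[h u]/(w b (chart_inv c (F u)) - u 0 b) wxy => /addrI /oppr_inj.
Qed.

Lemma plaque_integral (D : tangent_distribution M) :
  (forall x : N, D (plaque x) = [set v | exists a : 'rV[R]_r,
     v = \sum_b a 0 b *: value_at (zeta b) (plaque x)]) ->
  integral_manifold D plaque.
Proof.
move=> DE; have dE (x : N) a : differential plaque (fun f => 'D_a (f \o of_disc e) (to_disc e x)) =
    \sum_b a 0 b *: value_at (zeta b) (plaque x).
  by apply/funext => f; rewrite /differential plaque_derive fct_sumE.
split; first by exists 0.
- exact: plaque_inj.
- move=> x v v' /set_mem vx /set_mem v'x.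
  have [a ->] := tangent_plaque vx; have [a' ->] := tangent_plaque v'x.
  (* Immersion: the image of a tangent vector, applied to [w b], returns its [b]-th coefficient. *)
  move=> E; have {E} aw b : a 0 b = a' 0 b.
    have xe : `|to_disc e x| < e by exact: to_disc_lt.
    have zP k : zeta k (w b) (plaque x) = (k == b)%:R by exact: zw xe k b.
    have Z (d : 'rV[R]_r) : \sum_k d 0 k * zeta k (w b) (plaque x) = d 0 b.
      by rewrite -[RHS]sum_mul_delta; apply: eq_bigr => k _; rewrite zP.
    have := congr1 (fun v => v (w b)) E.
    by rewrite /differential !plaque_derive !Z.
  by have -> : a = a' by apply/rowP.
- move=> x; rewrite DE; apply/seteqP; split=> [_ [v vx <-]|_ [a ->]].
    by have [a ->] := tangent_plaque vx; exists a.
  by exists (fun f => 'D_a (f \o of_disc e) (to_disc e x)); [exact: plaque_tangent|].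
Qed.

End leaf_through_point.

Theorem frobenius r (xi : 'I_r -> vector_field M) :
  (forall i j, in_span xi (bracket (xi i) (xi j))) ->
  (forall p (a : 'rV[R]_r), \sum_i a 0 i *: value_at (xi i) p = 0 -> a = 0) ->
  integrable_distribution (span_distribution xi).
Proof.
move=> involutive indep p; have [c ca cp] := atlas_cover p.
have [zeta [w [A [S [zE near_p]]]]] := commuting_frame involutive (indep p).
have [e e0 [F [F0 sF cF DF]]] := local_flow ca cp near_p (fun q Gq => let: And3 _ _ k := Gq in k).
have zw u : `|u| < e -> forall a b, zeta a (w b) (chart_inv c (F u)) = (a == b)%:R.
  by move=> /cF[_ []].
have cF' u : `|u| < e -> chart_cod c (F u) by move=> /cF[].
exists r, (disc_manifold r e0), (plaque ca e0 sF cF'); split.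
  apply: (plaque_integral DF zw) => x.
  have xe : `|to_disc e x| < e by exact: to_disc_lt.
  have [_ [xiE _ _]] := cF _ xe.
  have zetaE b f : zeta b f (plaque ca e0 sF cF' x) =
      \sum_i A b i (plaque ca e0 sF cF' x) * xi i f (plaque ca e0 sF cF' x).
    by rewrite zE vf_sumE Cinf_sumE.
  (* The two frames span the same space: [S] and [A] convert the coefficients in either
     direction. *)
  apply/seteqP; split=> [_ [a ->]|_ [a ->]].
    exists (\row_b \sum_i a i * S i b (plaque ca e0 sF cF' x)); apply/funext => f.
    rewrite !fct_sumE; under [RHS]eq_bigr do rewrite mxE -[_ f]/(_ * _) mulr_suml.
    rewrite exchange_big; apply: eq_bigr => i _ /=.
    rewrite -[LHS]/(a i * xi i f (plaque ca e0 sF cF' x)) xiE mulr_sumr.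
    by apply: eq_bigr => b _; rewrite mulrA.
  exists (fun i => \sum_b a 0 b * A b i (plaque ca e0 sF cF' x)); apply/funext => f.
  rewrite !fct_sumE; under [RHS]eq_bigr do rewrite -[_ f]/(_ * _) mulr_suml.
  rewrite exchange_big; apply: eq_bigr => b _ /=.
  rewrite -[LHS]/(a 0 b * zeta b f (plaque ca e0 sF cF' x)) zetaE mulr_sumr.
  by apply: eq_bigr => i _; rewrite mulrA.
exists 0 => //; rewrite /= /plaque_fun /to_disc scaler0 F0 chart_mapK //.
Qed.

End frobenius.

(** * The Killing property and the covariant derivatives of the Reeb fields *)

Lemma even_permutation_rot i j k : even_permutation i j k -> even_permutation j k i.
Proof.
move=> [s [es [-> -> ->]]].
(* This product is the 3-cycle sending 0 to 1, 1 to 2 and 2 to 0, applied before [s]. *)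
exists (perm_mul (perm_mul (tperm 0 2%:R) (tperm 1 2%:R)) s); split.
  by rewrite !odd_permM !odd_tperm /= -/odd_perm.
by rewrite !permM; split; congr (s _); rewrite !permE //=; apply/val_inj.
Qed.

Lemma even_permutation012 : even_permutation 0 1 2%:R.
Proof. by exists 1%g; rewrite odd_perm1 !perm1. Qed.

Lemma even_permutationE i : exists j k, even_permutation i j k.
Proof.
have e0 := even_permutation012; have e1 := even_permutation_rot e0.
have e2 := even_permutation_rot e1.
case: i => [[|[|[|]]]] // p.
- by exists 1, 2%:R; have -> : Ordinal p = 0 by apply/val_inj.
- by exists 2%:R, 0; have -> : Ordinal p = 1 by apply/val_inj.
- by exists 0, 1; have -> : Ordinal p = 2%:R by apply/val_inj.
Qed.

Lemma even_permutation_pair i j :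
  i != j -> exists k, even_permutation i j k \/ even_permutation j i k.
Proof.
have e0 := even_permutation012; have e1 := even_permutation_rot e0.
have e2 := even_permutation_rot e1.
have E0 (p : (0 < 3)%N) : Ordinal p = 0 by apply/val_inj.
have E1 (p : (1 < 3)%N) : Ordinal p = 1 by apply/val_inj.
have E2 (p : (2 < 3)%N) : Ordinal p = 2%:R by apply/val_inj.
case: i j => [[|[|[|//]]]] p [[|[|[|//]]]] q; rewrite ?E0 ?E1 ?E2 ?eqxx // => _;
  by [exists 2%:R; tauto|exists 1; tauto|exists 0; tauto].
Qed.

Section contact.
Context {R : realType} {m : nat} {M : manifold R m} (g : riemannian_metric M).
Local Notation vf := (vector_field M).
Variables (phi : {linear vf -> vf}) (xi : vf) (eta : {scalar vf}).
Hypothesis acm : almost_contact_metric g phi xi eta.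

Let phi2 X : phi (phi X) = - X + eta X *: xi. Proof. by case: acm. Qed.
Let eta_xi : eta xi = 1. Proof. by case: acm. Qed.
Let gphi X Y : g (phi X) (phi Y) = g X Y - eta X * eta Y. Proof. by case: acm. Qed.

(** From [phi^2 xi = 0] and the formula for [phi^2 (phi xi)] one gets [phi xi = f xi] with
    [f = eta (phi xi)]. Applying [phi] and then [eta] gives [f^2 = 0], and the ring of real
    functions has no nilpotents. *)
Lemma contact_phi_xi : phi xi = 0.
Proof.
have p2 : phi (phi xi) = 0 by rewrite phi2 eta_xi scale1r addNr.
have := phi2 (phi xi); rewrite p2 linear0 => /eqP.
rewrite eq_sym addrC subr_eq0 => /eqP pE.
have : phi (eta (phi xi) *: xi) = 0 by rewrite pE p2.
rewrite linearZ /= => /(congr1 eta); rewrite linearZ /= linear0 => /sqr_Cinf_eq0.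
by move=> e0; rewrite -pE e0 scale0r.
Qed.

(** Compute [phi^3 X] in two ways, as [phi^2] of [phi X] and as [phi] of [phi^2 X]. *)
Lemma contact_eta_phi X : eta (phi X) = 0.
Proof.
have := phi2 (phi X); rewrite [phi (phi X)]phi2 linearD linearN linearZ /=.
rewrite contact_phi_xi scaler0 addr0 -[LHS]addr0 => /addrI /esym /(congr1 eta).
by rewrite linearZ /= eta_xi linear0 => <-; rewrite /= mulr1.
Qed.

Lemma contact_metric_xi X : g X xi = eta X.
Proof.
have := gphi X xi; rewrite contact_phi_xi Defs.metric_sym metric_0l eta_xi mulr1.
by move=> /esym/eqP; rewrite subr_eq0 => /eqP.
Qed.

Lemma contact_phi_skew X Y : g (phi X) Y = - g X (phi Y).
Proof.
have := gphi X (phi Y); rewrite phi2 contact_eta_phi mulr0 subr0 => <-.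
by rewrite metric_Dr metric_Nr metric_Zr contact_metric_xi contact_eta_phi mulr0 addr0 opprK.
Qed.

End contact.

Section killing.
Context {R : realType} {m : nat} {M : manifold R m} (g : riemannian_metric M).
Local Notation vf := (vector_field M).
Implicit Types (X Y Z W : vf).

Definition lie_form (xi : vf) (eta : {scalar vf}) X : Cinf M :=
  xi (eta X) - eta (bracket xi X).

Definition lie_form2 (xi : vf) (w : vf -> vf -> Cinf M) X Y : Cinf M :=
  xi (w X Y) - w (bracket xi X) Y - w X (bracket xi Y).

Definition lie_endo (xi : vf) (phi : vf -> vf) X : vf :=
  bracket xi (phi X) - phi (bracket xi X).

Lemma lie_form_cartan xi eta X : lie_form xi eta X = ext_diff eta xi X + X (eta xi).
Proof. by rewrite /lie_form /ext_diff; ring. Qed.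

(** The right-hand side is the exterior derivative of the Lie derivative of [eta], written out
    because [lie_form xi eta] is a plain function and not a [{scalar vf}]. The Jacobi identity
    matches the bracket terms. *)
Lemma lie_ext_diff xi eta X Y :
  lie_form2 xi (ext_diff eta) X Y =
  X (lie_form xi eta Y) - Y (lie_form xi eta X) - lie_form xi eta (bracket X Y).
Proof.
rewrite /lie_form2 /ext_diff /lie_form !vfB !bracketE (jacobi xi X Y) linearD /=.
by ring.
Qed.

Lemma lie_wedge_form xi (eta zeta : {scalar vf}) X Y :
  lie_form2 xi (wedge_form eta zeta) X Y =
  lie_form xi eta X * zeta Y - lie_form xi eta Y * zeta X +
  eta X * lie_form xi zeta Y - eta Y * lie_form xi zeta X.
Proof. by rewrite /lie_form2 /wedge_form /lie_form vfB !vfM; ring. Qed.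

(** The Leibniz rule for [g X (phi Y)], by which knowledge of the fundamental forms becomes
    knowledge of the Lie derivative of [g]. *)
Lemma lie_fundamental_form xi (phi : {linear vf -> vf}) X Y :
  lie_form2 xi (fundamental_form g phi) X Y =
  lie_metric g xi X (phi Y) + g X (lie_endo xi phi Y).
Proof.
by rewrite /lie_form2 /fundamental_form /lie_metric /lie_endo metric_Dr metric_Nr; ring.
Qed.

Lemma lie_metricC xi X Y : lie_metric g xi X Y = lie_metric g xi Y X.
Proof.
by rewrite /lie_metric !(Defs.metric_sym g Y) (Defs.metric_sym g X (bracket xi Y)); ring.
Qed.

Lemma lie_metric_Dr xi X Y Z :
  lie_metric g xi X (Y + Z) = lie_metric g xi X Y + lie_metric g xi X Z.
Proof. by rewrite /lie_metric bracketDr !metric_Dr vfD; ring. Qed.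

Lemma lie_metric_Nr xi X Y : lie_metric g xi X (- Y) = - lie_metric g xi X Y.
Proof. by rewrite /lie_metric bracketNr !metric_Nr vfN; ring. Qed.

Lemma lie_metric_Zr xi f X Y : lie_metric g xi X (f *: Y) = f * lie_metric g xi X Y.
Proof. by rewrite /lie_metric bracketZr metric_Dr !metric_Zr vfM; ring. Qed.

End killing.

Lemma cst_CinfM R m (M : manifold R m) (a b : R) :
  cst_Cinf M (a * b) = cst_Cinf M a * cst_Cinf M b.
Proof. exact: Cinf_ext. Qed.

Lemma cst_CinfD R m (M : manifold R m) (a b : R) :
  cst_Cinf M (a + b) = cst_Cinf M a + cst_Cinf M b.
Proof. exact: Cinf_ext. Qed.

Lemma cst_CinfN R m (M : manifold R m) (a : R) : cst_Cinf M (- a) = - cst_Cinf M a.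
Proof. exact: Cinf_ext. Qed.

Lemma cst_Cinf2 R m (M : manifold R m) : cst_Cinf M 2 = 2%:R.
Proof. exact: Cinf_ext. Qed.

Lemma lie_form2_comb R m (M : manifold R m) (xi : vector_field M)
    (w u v : vector_field M -> vector_field M -> Cinf M) (a b : R) X Y :
  (forall X Y, w X Y = cst_Cinf M a * u X Y + cst_Cinf M b * v X Y) ->
  lie_form2 xi w X Y =
  cst_Cinf M a * lie_form2 xi u X Y + cst_Cinf M b * lie_form2 xi v X Y.
Proof. by move=> wE; rewrite /lie_form2 !wE vfD !vfM !vf_cst; ring. Qed.

Section sasaki.
Context {R : realType} {n : nat} {M : manifold R (4 * n + 3)%N}.
Local Notation vf := (vector_field M).
Variables (g : riemannian_metric M) (phi : 'I_3 -> {linear vf -> vf})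
  (xi : 'I_3 -> vf) (eta : 'I_3 -> {scalar vf}) (alpha delta : R).
Hypothesis sasaki : three_alpha_delta_Sasaki g phi xi eta alpha delta.
Implicit Types (X Y Z : vf).

Let ca := cst_Cinf M alpha.
Let cd := cst_Cinf M delta.

Let contact i : almost_contact_metric g (phi i) (xi i) (eta i).
Proof. by case: sasaki => -[]. Qed.

Let eta_xi i : eta i (xi i) = 1. Proof. by case: (contact i). Qed.

Lemma ext_diff_eta i j k X Y : even_permutation i j k -> ext_diff (eta i) X Y =
  2 * ca * g X (phi i Y) + 2 * (ca - cd) * wedge_form (eta j) (eta k) X Y.
Proof.
case: sasaki => _ _ /(_ i j k) dE /dE ->.
by rewrite !cst_CinfM cst_CinfD cst_CinfN cst_Cinf2.
Qed.

Lemma eta_phi i j k X : even_permutation i j k ->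
  eta i (phi j X) = eta k X /\ eta j (phi i X) = - eta k X.
Proof.
case: sasaki => -[_ /(_ i j k) A] _ _ /A[_ _ _ /(_ X)[]] -> e2.
by split=> //; apply/esym/eqP; rewrite eqr_oppLR e2.
Qed.

Lemma phi_phi i j k X : even_permutation i j k ->
  phi i (phi j X) = phi k X + eta j X *: xi i /\
  phi j (phi i X) = - phi k X + eta i X *: xi j.
Proof.
case: sasaki => -[_ /(_ i j k) A] _ _ /A[/(_ X) p1 /(_ X) p2 _ _].
by split; [rewrite p1 subrK|rewrite p2 opprD opprK subrK].
Qed.

Lemma phi_xi i j k : even_permutation i j k ->
  phi i (xi j) = xi k /\ phi j (xi i) = - xi k.
Proof.
case: sasaki => -[_ /(_ i j k) A] _ _ /A[_ _ [-> e2] _].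
by split => //; apply/esym/eqP; rewrite eqr_oppLR e2.
Qed.

(** Up to sign, [eta_i (xi_j)] is a third form applied to [phi_j xi_j], which is 0. *)
Lemma eta_xi0 i j k : even_permutation i j k ->
  eta i (xi j) = 0 /\ eta j (xi i) = 0.
Proof.
move=> /even_permutation_rot e1; have /even_permutation_rot e2 := e1.
have [<- _] := eta_phi (xi i) e2.
rewrite (contact_phi_xi (contact i)) linear0; split => //.
have [_ /eqP] := eta_phi (xi j) e1.
by rewrite (contact_phi_xi (contact j)) linear0 eq_sym oppr_eq0 => /eqP.
Qed.

Section triple.
Variables (i j k : 'I_3).
Hypothesis ijk : even_permutation i j k.
Let jki : even_permutation j k i. Proof. exact: even_permutation_rot. Qed.
Let kij : even_permutation k i j. Proof. exact: even_permutation_rot. Qed.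

Lemma metric_xi_l X : g (xi i) X = eta i X.
Proof. by rewrite Defs.metric_sym (contact_metric_xi (contact i)). Qed.

Lemma lie_eta_same X : lie_form (xi i) (eta i) X = 0.
Proof.
rewrite lie_form_cartan eta_xi vf1 (ext_diff_eta _ _ ijk) metric_xi_l.
rewrite (contact_eta_phi (contact i)) /wedge_form.
by rewrite (eta_xi0 ijk).2 (eta_xi0 kij).1; ring.
Qed.

(** In Cartan's formula the fundamental form contributes [2 alpha eta_k] and the wedge product
    [- 2 (alpha - delta) eta_k]. *)
Lemma lie_eta_next X : lie_form (xi i) (eta j) X = 2 * cd * eta k X.
Proof.
rewrite lie_form_cartan (eta_xi0 ijk).2 vf0 (ext_diff_eta _ _ jki) metric_xi_l.
rewrite (eta_phi _ ijk).1 /wedge_form (eta_xi0 kij).1 eta_xi; ring.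
Qed.

Lemma lie_eta_prev X : lie_form (xi i) (eta k) X = - (2 * cd * eta j X).
Proof.
rewrite lie_form_cartan (eta_xi0 kij).1 vf0 (ext_diff_eta _ _ kij) metric_xi_l.
rewrite (eta_phi _ kij).2 /wedge_form (eta_xi0 ijk).2 eta_xi; ring.
Qed.

End triple.

Let phi_form i := fundamental_form g (phi i).

Lemma lie_ext_diff_eta i j k X Y Z : even_permutation i j k ->
  lie_form2 Z (ext_diff (eta i)) X Y =
  2 * ca * lie_form2 Z (phi_form i) X Y +
  2 * (ca - cd) * lie_form2 Z (wedge_form (eta j) (eta k)) X Y.
Proof.
move=> ijk; case: sasaki => _ _ /(_ _ _ _ ijk) dE.
rewrite (lie_form2_comb _ _ _ dE) /phi_form.
by rewrite !cst_CinfM cst_CinfD cst_CinfN cst_Cinf2.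
Qed.

(** This is where [alpha != 0] enters: the structure equations determine the fundamental forms only
    after division by [2 alpha]. *)
Lemma mul2ca_inj (f h : Cinf M) : 2 * ca * f = 2 * ca * h -> f = h.
Proof.
move=> fh; apply/eqP; rewrite -subr_eq0; apply/eqP.
have a0 : 2 * alpha != 0 by case: sasaki => _ a0 _; rewrite mulf_neq0 // pnatr_eq0.
apply: (cst_CinfM_inj a0).
by rewrite cst_CinfM cst_Cinf2 mulrBr fh subrr.
Qed.

(** Apply the Lie derivative to the structure equations. In the case of [j] the left side becomes
    [2 delta d eta_k], and [eta_k /\ eta_i] becomes [2 delta eta_i /\ eta_j], which is the wedge
    product in the equation for [d eta_k]. The wedge terms cancel; the case of [k] is alike. *)
Lemma lie_phi_form i j k X Y : even_permutation i j k ->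
  [/\ lie_form2 (xi i) (phi_form i) X Y = 0,
      lie_form2 (xi i) (phi_form j) X Y = 2 * cd * phi_form k X Y &
      lie_form2 (xi i) (phi_form k) X Y = - (2 * cd * phi_form j X Y)].
Proof.
move=> ijk; have jki := even_permutation_rot ijk; have kij := even_permutation_rot jki.
have E1 := lie_ext_diff_eta X Y (xi i) ijk.
have E2 := lie_ext_diff_eta X Y (xi i) jki.
have E3 := lie_ext_diff_eta X Y (xi i) kij.
rewrite lie_wedge_form lie_ext_diff
  !(lie_eta_same ijk) !(lie_eta_next ijk) !(lie_eta_prev ijk) in E1.
rewrite lie_wedge_form lie_ext_diff
  !(lie_eta_same ijk) !(lie_eta_next ijk) !(lie_eta_prev ijk) in E2.
rewrite lie_wedge_form lie_ext_diff
  !(lie_eta_same ijk) !(lie_eta_next ijk) !(lie_eta_prev ijk) in E3.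
have D1 := ext_diff_eta X Y ijk; have D2 := ext_diff_eta X Y jki.
have D3 := ext_diff_eta X Y kij.
have X0 Z : Z (2 : Cinf M) = 0 by rewrite -cst_Cinf2 vf_cst.
rewrite ?vfM ?vfN ?vfM !vf_cst !X0 !vf0 in E1 E2 E3.
have lin (u v w : Cinf M) : u = v + w -> v = u - w by move=> ->; rewrite addrK.
split; apply: mul2ca_inj.
- by rewrite (lin _ _ _ E1); ring.
- rewrite (lin _ _ _ E2) mulrCA /phi_form /fundamental_form (lin _ _ _ D3).
  by rewrite /ext_diff /wedge_form; ring.
- have -> P : 2 * ca * (- (2 * cd * P)) = - (2 * cd * (2 * ca * P)) by ring.
  rewrite (lin _ _ _ E3) /phi_form /fundamental_form (lin _ _ _ D2).
  by rewrite /ext_diff /wedge_form; ring.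
Qed.

(** The form [g (xi i)] is [eta i], and both [xi i] and [eta i] have zero Lie derivative along
    [xi i]. *)
Lemma lie_metric_xi i X : lie_metric g (xi i) (xi i) X = 0.
Proof.
have [j [k ijk]] := even_permutationE i.
rewrite /lie_metric !metric_xi_l bracketxx metric_0l -[RHS](lie_eta_same ijk X).
by rewrite /lie_form; ring.
Qed.

Lemma eta_bracket i j k : even_permutation i j k -> eta j (bracket (xi i) (xi j)) = 0.
Proof.
move=> ijk; have jki := even_permutation_rot ijk; have kij := even_permutation_rot jki.
have := lie_eta_next ijk (xi j).
by rewrite /lie_form eta_xi vf1 sub0r (eta_xi0 jki).2 mulr0 => /eqP; rewrite oppr_eq0 => /eqP.
Qed.

(* Lie derivative of [phi k = phi i \o phi j - eta j (x) xi i], paired with [X]. *)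
Lemma lie_metric_phi i j k X Y : even_permutation i j k ->
  lie_metric g (xi i) (phi i X) (phi j Y) = 0.
Proof.
move=> ijk; have jki := even_permutation_rot ijk; have kij := even_permutation_rot jki.
have [E1 _ _] := lie_phi_form X (phi j Y) ijk.
have [_ E2 _] := lie_phi_form (phi i X) Y ijk.
have [_ _ E3] := lie_phi_form X Y ijk.
have PE : lie_endo (xi i) (phi k) Y =
    lie_endo (xi i) (phi i) (phi j Y) + phi i (lie_endo (xi i) (phi j) Y)
    - lie_form (xi i) (eta j) Y *: xi i.
  apply/eqP; rewrite eq_sym subr_eq; apply/eqP.
  have pE Z : phi k Z = phi i (phi j Z) - eta j Z *: xi i.
    by rewrite (phi_phi Z ijk).1 addrK.
  rewrite /lie_endo /lie_form !pE linearB /=.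
  rewrite bracketDr bracketNr bracketZr bracketxx scaler0 addr0.
  by apply: vf_ext => f; rewrite !(vf_addE, vf_oppE, vf_scaleE); ring.
rewrite /phi_form lie_fundamental_form /fundamental_form in E1.
rewrite /phi_form lie_fundamental_form /fundamental_form in E2.
rewrite /phi_form lie_fundamental_form /fundamental_form in E3.
move: (lie_endo _ _ (phi j Y)) (lie_endo _ (phi j) Y) (lie_endo _ (phi k) Y) PE E1 E2 E3.
move=> Pij Pj Pk PE E1 E2 E3; rewrite PE in E3.
rewrite !metricE (contact_metric_xi (contact i)) (lie_eta_next ijk) in E3.
rewrite (phi_phi Y ijk).1 lie_metric_Dr lie_metric_Zr
  (lie_metricC _ _ X (xi i)) lie_metric_xi in E1.
rewrite !(contact_phi_skew (contact i)) (phi_phi Y kij).2 !metricE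
  (contact_metric_xi (contact i)) in E2.
set u := lie_metric g _ (phi i X) _ in E2 *.
set v := lie_metric _ _ _ _ in E1 E3.
(* This is [E2 + E3 - E1]. The terms with [delta] cancel by
   [phi_i phi_k = - phi_j + eta_k (x) xi_i]. *)
have -> : u = (u - g X (phi i Pj)) + (v + (g X Pij + g X (phi i Pj) - 2 * cd * eta k Y * eta i X))
  - (v + eta j Y * 0 + g X Pij) + 2 * cd * eta k Y * eta i X by ring.
by rewrite E1 E2 E3; ring.
Qed.


(** By [X = - phi_i (phi_i X) + eta_i X xi_i] and [lie_metric_xi], the first argument in
    [lie_metric_phi] may be arbitrary. The same decomposition for [j], used in both arguments,
    leaves a multiple of [(L g)(xi_j, xi_j) = - 2 eta_j [xi_i, xi_j]], which is 0 by
    [eta_bracket]. *)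
Theorem sasaki_killing i : killing g (xi i).
Proof.
have [j [k ijk]] := even_permutationE i.
have h0 X Y : lie_metric g (xi i) X (phi j Y) = 0.
  have -> : X = - phi i (phi i X) + eta i X *: xi i.
    by case: (contact i) => -> _ _; rewrite opprD opprK addrNK.
  rewrite lie_metricC lie_metric_Dr lie_metric_Nr lie_metric_Zr.
  rewrite !(lie_metricC _ _ (phi j Y)) (lie_metric_phi _ _ ijk) lie_metric_xi; ring.
have hE X Y : lie_metric g (xi i) X Y = eta j Y * lie_metric g (xi i) X (xi j).
  rewrite -[in LHS](addrNK (eta j Y *: xi j) Y) lie_metric_Dr lie_metric_Zr.
  have -> : Y - eta j Y *: xi j = - phi j (phi j Y).
    by case: (contact j) => -> _ _; rewrite opprD opprK.
  by rewrite lie_metric_Nr h0 oppr0 add0r.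
move=> X Y; rewrite hE lie_metricC hE /lie_metric (Defs.metric_sym g (bracket _ _)).
by rewrite !metric_xi_l eta_xi vf1 (eta_bracket ijk); ring.
Qed.

Section connection.
Variable nabla : vf -> vf -> vf.
Hypothesis lc : levi_civita g nabla.

Theorem nabla_xi i j k X : even_permutation i j k ->
  nabla X (xi i) = - (ca *: phi i X) - (ca - cd) *: (eta k X *: xi j - eta j X *: xi k).
Proof.
move=> ijk; apply: (metric_inj (g := g)) => Y.
have two : forall f h : Cinf M, 2 * f = 2 * h -> f = h.
  move=> f h /eqP; rewrite -subr_eq0 -mulrBr -cst_Cinf2 => /eqP.
  by move=> /cst_CinfM_inj; rewrite pnatr_eq0 => /(_ isT)/eqP; rewrite subr_eq0 => /eqP.
apply: two.
have [_ tor cmp] := lc.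
have K : lie_metric g (xi i) X Y = 0 by exact: sasaki_killing.
have D := ext_diff_eta X Y ijk.
have E1 := cmp X Y (xi i); have E2 := cmp Y X (xi i); have E3 := cmp (xi i) X Y.
rewrite /lie_metric -!tor in K.
rewrite /ext_diff -!(contact_metric_xi (contact i)) -tor in D.
rewrite E1 E2 in D; rewrite E3 in K; rewrite /wedge_form in D.
rewrite !metricE in D K *.
rewrite (contact_phi_skew (contact i)) !metric_xi_l.
rewrite (Defs.metric_sym g Y (nabla X _)) (Defs.metric_sym g X (nabla Y _)) in D.
rewrite (Defs.metric_sym g X (nabla Y _)) in K.
set A := g (nabla X (xi i)) Y in D K *; set B := g (nabla Y (xi i)) X in D K.
set C := 2 * ca * _ + _ in D.
(* [D] amounts to [A - B = C] and [K] to [A + B = 0], whence [2 A = C]. *)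
transitivity (C + 0 : Cinf M); last by rewrite /C; ring.
by rewrite -D -[in RHS]K; ring.
Qed.

Theorem nabla_xi_same i : nabla (xi i) (xi i) = 0.
Proof.
have [j [k ijk]] := even_permutationE i.
have kij := even_permutation_rot (even_permutation_rot ijk).
rewrite (nabla_xi _ ijk) (contact_phi_xi (contact i)) (eta_xi0 ijk).2 (eta_xi0 kij).1.
by rewrite !scale0r subrr !scaler0 oppr0 addr0.
Qed.

Theorem nabla_xi_next i j k : even_permutation i j k ->
  nabla (xi i) (xi j) = cd *: xi k /\ nabla (xi j) (xi i) = - (cd *: xi k).
Proof.
move=> ijk; have jki := even_permutation_rot ijk; have kij := even_permutation_rot jki.
rewrite (nabla_xi _ ijk) (nabla_xi _ jki) (phi_xi ijk).1 (phi_xi ijk).2 !eta_xi.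
rewrite (eta_xi0 kij).1 (eta_xi0 jki).2 !scale0r scale1r subr0 sub0r.
split; first by rewrite scalerN opprK scalerBl opprB addrC subrK.
by rewrite scalerN opprK scalerBl addrA addNr add0r.
Qed.

End connection.
End sasaki.

(** * The vertical distribution *)

Section leaves.
Context {R : realType} {n : nat} {M : manifold R (4 * n + 3)%N}.
Local Notation vf := (vector_field M).
Variables (g : riemannian_metric M) (phi : 'I_3 -> {linear vf -> vf})
  (xi : 'I_3 -> vf) (eta : 'I_3 -> {scalar vf}) (alpha delta : R)
  (nabla : vf -> vf -> vf).
Hypothesis sasaki : three_alpha_delta_Sasaki g phi xi eta alpha delta.
Hypothesis lc : levi_civita g nabla.
Implicit Types (X Y Z W : vf).

Let eta_xi_delta i j : eta i (xi j) = (i == j)%:R.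
Proof.
have [->|ij] := eqVneq i j; first by case: sasaki => -[/(_ j)[]].
by have [k [/(eta_xi0 sasaki)[]|/(eta_xi0 sasaki)[]]] := even_permutation_pair ij.
Qed.

Lemma eta_sum j (C : 'I_3 -> Cinf M) : eta j (\sum_i C i *: xi i) = C j.
Proof.
rewrite linear_sum (bigD1 j) //= linearZ /= eta_xi_delta eqxx mulr1 big1 ?addr0 // => i ij.
by rewrite linearZ /= eta_xi_delta eq_sym (negPf ij) mulr0.
Qed.

Lemma value_atD X Y p : value_at (X + Y) p = value_at X p + value_at Y p.
Proof. by []. Qed.

Lemma value_atZ f X p : value_at (f *: X) p = f p *: value_at X p.
Proof. by []. Qed.

Lemma value_at_sum k (C : 'I_k -> Cinf M) (F : 'I_k -> vf) p :
  value_at (\sum_i C i *: F i) p = \sum_i C i p *: value_at (F i) p.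
Proof. by apply/funext => f; rewrite fct_sumE /value_at vf_sumE Cinf_sumE. Qed.

(** By tensoriality [X] may be replaced by the global combination of the [xi i] with constant
    coefficients [a i]. *)
Lemma eta_value j (a : 'I_3 -> R) X p :
  value_at X p = \sum_i a i *: value_at (xi i) p -> eta j X p = a j.
Proof.
move=> Xp; have -> : eta j X p = eta j (\sum_i cst_Cinf M (a i) *: xi i) p.
  apply: tensorial_eq; first by move=> f Y Z; rewrite linearP.
  by rewrite value_at_sum.
by rewrite eta_sum.
Qed.

Lemma xi_independent p (a : 'rV[R]_3) :
  \sum_i a 0 i *: value_at (xi i) p = 0 -> a = 0.
Proof.
by move=> ap; apply/rowP => j; rewrite mxE -(@eta_value j (a 0) 0 p) ?linear0 //.
Qed.

Lemma in_span_nabla_xi i j : in_span xi (nabla (xi j) (xi i)).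
Proof.
have [->|] := eqVneq i j; first by rewrite (nabla_xi_same sasaki lc); exact: in_span0.
move=> /even_permutation_pair[k [] /(nabla_xi_next sasaki lc)[]] e1 e2.
  by rewrite e2; apply/in_spanN/in_spanZ/in_span_xi.
by rewrite e1; apply/in_spanZ/in_span_xi.
Qed.

Lemma in_span_bracket_xi i j : in_span xi (bracket (xi i) (xi j)).
Proof.
case: lc => _ <- _; apply: in_spanD; first exact: in_span_nabla_xi.
by apply: in_spanN; exact: in_span_nabla_xi.
Qed.

Lemma in_span_value X p : in_span xi X -> span_distribution xi p (value_at X p).
Proof. by move=> [C ->]; exists (fun i => C i p); exact: value_at_sum. Qed.

Definition vertical_part X : vf := \sum_i eta i X *: xi i.

Lemma vertical_partE X p : span_distribution xi p (value_at X p) ->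
  value_at X p = value_at (vertical_part X) p.
Proof.
move=> [a aE]; rewrite /vertical_part value_at_sum aE; apply: eq_bigr => i _.
by rewrite (eta_value i aE).
Qed.

Let nablaDl X Y Z : nabla (X + Y) Z = nabla X Z + nabla Y Z.
Proof. by case: lc => -[/(_ 1 X Y Z)] + _ _ _ _; rewrite !scale1r. Qed.

Let nabla0l Z : nabla 0 Z = 0.
Proof. by apply: (@addrI _ (nabla 0 Z)); rewrite -nablaDl !addr0. Qed.

Let nablaZl f X Z : nabla (f *: X) Z = f *: nabla X Z.
Proof. by case: lc => -[/(_ f X 0 Z)] + _ _ _ _; rewrite nabla0l !addr0. Qed.

Let nablaDr X Y Z : nabla X (Y + Z) = nabla X Y + nabla X Z.
Proof. by case: lc => -[]. Qed.

Let nabla0r X : nabla X 0 = 0.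
Proof. by apply: (@addrI _ (nabla X 0)); rewrite -nablaDr !addr0. Qed.

Lemma nabla_value X Y Z p : value_at X p = value_at Y p ->
  value_at (nabla X Z) p = value_at (nabla Y Z) p.
Proof.
move=> XY; apply/funext => f.
by apply: (tensorial_eq (w := fun X => nabla X Z f)) => // h V W; rewrite nablaDl nablaZl.
Qed.

(** [X] is vertical at [p] only. In [nabla X (xi i)] it can be exchanged for [vertical_part X],
    which lies in the span over [Cinf M]; where it differentiates [eta i Y] it only produces a
    coefficient. *)
Lemma nabla_vertical_span X Y p : span_distribution xi p (value_at X p) ->
  span_distribution xi p (value_at (nabla X (vertical_part Y)) p).
Proof.
move=> Xp; pose T := \sum_i (X (eta i Y) *: xi i + eta i Y *: nabla (vertical_part X) (xi i)).
have -> : value_at (nabla X (vertical_part Y)) p = value_at T p.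
  have -> : nabla X (vertical_part Y) =
      \sum_i (X (eta i Y) *: xi i + eta i Y *: nabla X (xi i)).
    rewrite /vertical_part; elim/big_ind2 : _ => [|V V' W W' <- <-|i _].
    - exact: nabla0r.
    - exact: nablaDr.
    - by case: lc => -[].
  rewrite /T; elim/big_ind2 : _ => // [V V' W W' VV' WW'|i _].
    by rewrite !value_atD VV' WW'.
  by rewrite !value_atD !value_atZ (nabla_value _ (vertical_partE Xp)).
apply: in_span_value; apply: in_span_sum => i; apply: in_spanD.
  exact/in_spanZ/in_span_xi.
apply: in_spanZ; rewrite /vertical_part.
elim/big_ind : _ => [|V W sV sW|j _]; first by rewrite nabla0l; exact: in_span0.
  by rewrite nablaDl; exact: in_spanD.
by rewrite nablaZl; apply: in_spanZ; exact: in_span_nabla_xi.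
Qed.

Section along.
Variables (d : nat) (N : manifold R d) (F : smooth_map N M).

(* Only the normal derivative of [Z] could survive, and
   [g (nabla_X Z) W = X (g Z W) - g Z (nabla_X W)] involves [Z] along [F] only. *)
Lemma nabla_along0 X Z q : tangent_along F X q ->
  (\forall r \near q, value_at Z (F r) = 0) -> value_at (nabla X Z) (F q) = 0.
Proof.
move=> [v vq vX] Z0.
have gZ W r : value_at Z (F r) = 0 -> g Z W (F r) = 0.
  apply: (tensorial (w := fun Z => g Z W)) => f Y V; exact: metric_lin.
(* Definiteness reduces the claim to the squared norm of [nabla X Z], so the metric identity is used
   with [nabla X Z] itself as second field. *)
apply: (@metric_def _ _ _ g).
case: lc => _ _ /(_ X Z (nabla X Z)) /(congr1 (fun f : Cinf M => f (F q))).
have -> : X (g Z (nabla X Z)) (F q) = 0.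
  rewrite -[LHS]/(value_at X (F q) _) -vX; apply: (tangent_near0 vq).
  by apply: filterS Z0 => r; exact: gZ.
rewrite -[RHS]/(g (nabla X Z) (nabla X Z) (F q) + g Z (nabla X (nabla X Z)) (F q)).
by rewrite (gZ _ _ (nbhs_singleton Z0)) addr0.
Qed.

(** [Y] is replaced by its vertical part, a section of the distribution on all of [M]; the
    difference [Z] vanishes along the submanifold, so [nabla_along0] shows that it does not
    contribute. *)
Lemma integral_totally_geodesic :
  integral_manifold (span_distribution xi) F -> totally_geodesic nabla F.
Proof.
move=> [_ _ _ TD] X Y q XY.
have tE W r : tangent_along F W r = span_distribution xi (F r) (value_at W (F r)).
  by rewrite -TD.
rewrite tE; have tD W r : tangent_along F W r -> span_distribution xi (F r) (value_at W (F r)).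
  by rewrite tE.
have [Xq _] := nbhs_singleton XY.
pose Z := Y - vertical_part Y.
have Z0 : \forall r \near q, value_at Z (F r) = 0.
  apply: filterS XY => r [_ /tD /vertical_partE Yr]; apply/funext => f.
  by rewrite -[LHS]/(value_at Y (F r) f - value_at (vertical_part Y) (F r) f) -Yr subrr.
have -> : value_at (nabla X Y) (F q) = value_at (nabla X (vertical_part Y)) (F q).
  have -> : nabla X Y = nabla X Z + nabla X (vertical_part Y) by rewrite -nablaDr /Z subrK.
  by rewrite value_atD nabla_along0 // add0r.
by apply: nabla_vertical_span; exact: tD.
Qed.

End along.
End leaves.

Theorem corollary2p3p1 (R : realType) (n : nat) (M : manifold R (4 * n + 3)%N)
    (g : riemannian_metric M)
    (phi : 'I_3 -> {linear vector_field M -> vector_field M})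
    (xi : 'I_3 -> vector_field M)
    (eta : 'I_3 -> {scalar vector_field M})
    (alpha delta : R)
    (nabla : vector_field M -> vector_field M -> vector_field M) :
  three_alpha_delta_Sasaki g phi xi eta alpha delta ->
  levi_civita g nabla ->
  [/\ forall i j k, even_permutation i j k ->
        [/\ forall X, nabla X (xi i) =
              - (cst_Cinf M alpha *: phi i X)
              - cst_Cinf M (alpha - delta) *: (eta k X *: xi j - eta j X *: xi k),
            nabla (xi i) (xi i) = 0,
            nabla (xi i) (xi j) = - nabla (xi j) (xi i) &
            nabla (xi i) (xi j) = cst_Cinf M delta *: xi k],
      forall i, killing g (xi i),
      integrable_distribution (span_distribution xi) &
      forall d (N : manifold R d) (F : smooth_map N M),
        leaf (span_distribution xi) F -> totally_geodesic nabla F].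
Proof.
move=> sasaki lc; split.
- move=> i j k ijk; have [e1 e2] := nabla_xi_next sasaki lc ijk; split=> // [X||].
  + by rewrite (nabla_xi sasaki lc X ijk) cst_CinfD cst_CinfN.
  + exact: (nabla_xi_same sasaki lc).
  + by rewrite e1 e2 opprK.
- exact: sasaki_killing sasaki.
- apply: frobenius; first exact: in_span_bracket_xi sasaki lc.
  exact: xi_independent sasaki.
- by move=> d N F [iF _ _]; exact: (integral_totally_geodesic sasaki lc iF).
Qed.
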